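(* Let $n\ge1$, $\boldsymbol\mu\in\mathbb C^n$ with $\sum_l\mu_l=0$, and $\boldsymbol m\in\mathbb Z^n$. Then for $z\in\mathbb C^\times$, $$J_{(\boldsymbol\mu,\boldsymbol m)}(z)=(2\pi^2)^{n-1}\sum_{l=1}^nS_l(\boldsymbol\mu,\boldsymbol m)\,J_l\big(2\pi z^{1/n};+,\boldsymbol\mu+\tfrac12\boldsymbol m\big)\,J_l\big(2\pi\overline z^{1/n};+,\boldsymbol\mu-\tfrac12\boldsymbol m\big),$$ with $S_l(\boldsymbol\mu,\boldsymbol m)=\prod_{k\neq l}(\pm i)^{m_l-m_k}\sin\big(\pi(\mu_l-\mu_k\pm\frac12(m_l-m_k))\big)^{-1}$ (the same choice of sign in both places). Here $z^{1/n}$ is the principal branch, $(xe^{i\phi})^{1/n}=x^{1/n}e^{i\phi/n}$, and the right-hand side does not depend on the choice of $\arg z$ modulo $2\pi$. If $2(\mu_l-\mu_k)-|m_l-m_k|\in2\mathbb Z$ for some $l\neq k$ (the non-generic case), the right-hand side is to be replaced by its limit.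
   Context: Bessel functions of the first kind: for $\varsigma\in\{+,-\}$, $\boldsymbol\lambda\in\mathbb C^n$, $l\in\{1,\dots,n\}$ and $z$ in the universal cover of $\mathbb C^\times$, $J_l(z;\varsigma,\boldsymbol\lambda)=\sum_{m=0}^\infty\frac{(\varsigma i^n)^mz^{n(-\lambda_l+m)}}{\prod_{k=1}^n\Gamma(\lambda_k-\lambda_l+m+1)}$. Bessel kernel: $\boldsymbol e=(1,\dots,1)$, $G_k(s)=i^{|k|}(2\pi)^{1-2s}\Gamma(s+\frac{|k|}2)/\Gamma(1-s+\frac{|k|}2)$, $G_{(\boldsymbol\mu,\boldsymbol m)}(s)=\prod_lG_{m_l}(s-\mu_l)$, $j_{(\boldsymbol\mu,\boldsymbol m)}(x)=\frac1{2\pi i}\int_{\mathcal C}G_{(\boldsymbol\mu,\boldsymbol m)}(s)x^{-2s}ds$ ($x>0$) with $\mathcal C$ upward from $\sigma-i\infty$ to $\sigma+i\infty$, $\sigma<\frac12+\frac{2\operatorname{Re}\sum\mu_l-1}{2n}$, equal to $\operatorname{Re}s=\sigma$ for $|\operatorname{Im}s|$ large, with all points $\mu_l-\frac{|m_l|}2-\frac\kappa2$ ($\kappa\in\mathbb N$) on its left; $J_{(\boldsymbol\mu,\boldsymbol m)}(z)=\frac1{2\pi}\sum_{k\in\mathbb Z}j_{(\boldsymbol\mu,\boldsymbol m+k\boldsymbol e)}(|z|)(z/|z|)^k$. *)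

(* Defs.v *)
From HB Require Import structures.
From mathcomp Require Import all_boot all_order all_algebra.
From mathcomp Require Import all_classical all_reals all_analysis.
From mathcomp Require Import complex.
Set Implicit Arguments. Unset Strict Implicit. Unset Printing Implicit Defensive.
Import Order.TTheory GRing.Theory Num.Theory.
Import numFieldNormedType.Exports.
Local Open Scope ring_scope.
Local Open Scope classical_set_scope.
Local Open Scope complex_scope.

Section BesselDefs.
Variable R : realType.

Definition C : numClosedFieldType := Num.ClosedField.clone _ (R[i]).

Definition cRe (z : C) : R := complex.Re z.
Definition cIm (z : C) : R := complex.Im z.
Definition cI : C := 'i.
Definition cR (x : R) : C := x%:C.

Definition cexp (z : C) : C :=
  (expR (cRe z) * cos (cIm z)) +i* (expR (cRe z) * sin (cIm z)).
Definition csin (z : C) : C := (cexp (cI * z) - cexp (- (cI * z))) / (2 * cI).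

Definition rpowC (x : R) (s : C) : C := cexp (s * cR (ln x)).

(** Reciprocal Gamma function (entire), via Gauss' product formula
    1/Gamma(s) = lim_N s(s+1)...(s+N) / (N! N^s);
    and Gamma(s) := 1/(1/Gamma(s)) away from its poles. *)
Definition rgamma_approx (s : C) (N : nat) : C :=
  (\prod_(j < N.+1) (s + j%:R)) / ((N`!)%:R * rpowC N%:R s).
Definition rgamma (s : C) : C := lim (rgamma_approx s @ \oo).
Definition Gamma (s : C) : C := (rgamma s)^-1.

(** Bessel functions of the first kind J_l(w; sg, lam), w in the universal
    cover of C^x, represented by its logarithm L (so w^a := exp (a L)).
    [sg = true] means sigma = +, [sg = false] means sigma = -. *)
Definition besselJ (n : nat) (l : 'I_n) (sg : bool) (lam : 'I_n -> C) (L : C)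
  : C :=
  lim ((fun N : nat => \sum_(k < N)
        ((if sg then 1 else -1) * cI ^+ n) ^+ k
        * cexp (n%:R * (- lam l + k%:R) * L)
        / \prod_(q < n) Gamma (lam q - lam l + k%:R + 1)) @ \oo).

Definition Gk (k : int) (s : C) : C :=
  cI ^+ (absz k) * rpowC (2 * pi) (1 - 2 * s)
  * Gamma (s + (absz k)%:R / 2) / Gamma (1 - s + (absz k)%:R / 2).

Definition Gmu (n : nat) (mu : 'I_n -> C) (m : 'I_n -> int) (s : C) : C :=
  \prod_(l < n) Gk (m l) (s - mu l).

(** Admissible contours.  We use contours that are graphs
    t |-> f(t) + i t (t in R, oriented upward), f continuously differentiable,
    f(t) = sigma for |t| large, all points mu_l - |m_l|/2 - kappa/2
    (kappa in N) lying to the left of the contour, and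
    sigma < 1/2 + (2 Re(sum mu) - 1)/(2n). *)
Definition admissible (n : nat) (mu : 'I_n -> C) (m : 'I_n -> int)
  (sigma : R) (f : R -> R) : Prop :=
  [/\ sigma < 1 / 2 + (2 * cRe (\sum_(l < n) mu l) - 1) / (2 * n%:R),
      (forall t : R, derivable f t 1) /\ continuous (f^`()),
      (exists T : R, forall t : R, T <= `|t| -> f t = sigma)
    & forall (l : 'I_n) (kappa : nat),
        cRe (mu l) - (absz (m l))%:R / 2 - kappa%:R / 2 < f (cIm (mu l))].

Definition cintegral (g : R -> C) : C :=
  (Rintegral lebesgue_measure setT (fun t => cRe (g t)))
  +i* (Rintegral lebesgue_measure setT (fun t => cIm (g t))).

(** j_(mu,m)(x) = 1/(2 pi i) int_C G_(mu,m)(s) x^(-2s) ds, along the contour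
    s = f(t) + i t, ds = (f'(t) + i) dt. *)
Definition jkernel (n : nat) (mu : 'I_n -> C) (m : 'I_n -> int) (f : R -> R)
  (x : R) : C :=
  (2 * cR pi * cI)^-1 *
  cintegral (fun t => Gmu mu m ((f t) +i* t) * rpowC x (- 2 * ((f t) +i* t))
                      * ((f^`() t) +i* 1)).

(** Symmetric partial sums of
    J_(mu,m)(z) = 1/(2 pi) sum_(k in Z) j_(mu, m + k e)(|z|) (z/|z|)^k,
    the k-th term computed along the contour [c k] = (sigma_k, f_k). *)
Definition Jkernel_partial (n : nat) (mu : 'I_n -> C) (m : 'I_n -> int)
  (c : int -> R * (R -> R)) (z : C) (N : nat) : C :=
  (2 * cR pi)^-1 *
  \sum_(i < (2 * N).+1)
     let k : int := (i%:Z - N%:Z)%R in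
     jkernel mu (fun l => m l + k) (c k).2 (cRe `|z|) * (z / `|z|) ^ k.

Definition generic (n : nat) (mu : 'I_n -> C) (m : 'I_n -> int) : Prop :=
  forall l k : 'I_n, l != k -> forall j : int,
    2 * (mu l - mu k) - (absz (m l - m k))%:R != 2 * j%:~R.

Definition Scoef (n : nat) (mu : 'I_n -> C) (m : 'I_n -> int) (b : bool)
  (l : 'I_n) : C :=
  let e : C := if b then 1 else -1 in
  \prod_(k < n | k != l)
     ((e * cI) ^ (m l - m k)
      * (csin (cR pi * (mu l - mu k + e * (m l - m k)%:~R / 2)))^-1).

(** log (2 pi z^(1/n)) for z = x e^(i phi), principal branch
    z^(1/n) = x^(1/n) e^(i phi/n) *)
Definition log_root (n : nat) (x phi : R) : C :=
  (ln (2 * pi) + ln x / n%:R) +i* (phi / n%:R).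

Definition bessel_rhs (n : nat) (mu : 'I_n -> C) (m : 'I_n -> int) (b : bool)
  (x phi : R) : C :=
  cR (2 * pi ^+ 2) ^+ n.-1 *
  \sum_(l < n) Scoef mu m b l
     * besselJ l true (fun q => mu q + (m q)%:~R / 2) (log_root n x phi)
     * besselJ l true (fun q => mu q - (m q)%:~R / 2) (log_root n x (- phi)).

End BesselDefs.

(* Main.v *)
Require Import Defs.
From HB Require Import structures.
From mathcomp Require Import all_boot all_order all_algebra.
From mathcomp Require Import all_classical all_reals all_analysis.
From mathcomp Require Import complex.
From mathcomp Require Import measurable_realfun.
From mathcomp Require Import ring lra zify.
Set Implicit Arguments. Unset Strict Implicit. Unset Printing Implicit Defensive.
Import Order.TTheory GRing.Theory Num.Theory.
Import numFieldNormedType.Exports.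
Local Open Scope ring_scope.
Local Open Scope classical_set_scope.

(** For generic [mu] the poles of the integrand [G(s) x^(-2s)] to the left of
    the contour are simple, and moving the contour to [Re s = -oo] writes
    [j_(mu, m+k)(x)] as a sum of residues over [l] and [kappa >= 0].  By the
    reflection formula the residue at [(l, kappa)], times [(z/|z|)^k / (2 pi)],
    is [(2 pi^2)^(n-1) S_l U_alpha V_beta], where [U] and [V] are the terms of
    the two Bessel series, [alpha - beta = m_l + k] and
    [min(alpha, beta) = kappa].  Summing over [k] runs once through all pairs
    [(alpha, beta)], which gives the product of the two series.

    In the non-generic case [mu] is a limit of generic parameters.  Every
    [j_(mu, m+k)(x)] is continuous in [mu] along a fixed contour, and for large
    [|k|] the contour may be taken to be one vertical line far to the left, on
    which the integrand is [O(k^-2 (1 + |t|)^-2)] uniformly in [mu]; hence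
    the sum over [k] passes to the limit.

    As [1/Gamma] is the limit of Gauss products, [G] is a limit of rational
    functions times [e^(cs)], for which the residue theorem reduces to partial
    fractions and an explicit logarithm.  The reflection formula comes from
    Euler's sine product, and the vertical decay of [G] from comparing
    [1/Gamma(w)] with [1/Gamma(v)] factor by factor when [Im v = - Im w]. *)

(** * The complex modulus and limits *)

Section ComplexBasics.
Variable R : realType.
Local Notation C := (C R).
Implicit Types z w : C.

(** Contours are arbitrary graphs, one for each [k], so their interchangeability has to be obtained
    on the way. For generic [mu] every admissible contour yields the same [residue_series], which
    can therefore be estimated on whichever admissible contour is convenient; for large |k| this is
    a far vertical line. The estimate then passes to non-generic [mu], where poles may coincide, as
    a limit over generic parameters. All constants consequently have to be uniform in the ball
    |mu_l| <= Bmu.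

    The condition sum mu = 0 enters twice. It makes the vertical growth exponent of the integrand
    n(2 Re s - 1) whatever [mu] is, and admissibility of sigma says that this is below -1. It also
    balances the powers of 2 pi in the residues.

    Differentiation and integration are carried out on the real and imaginary parts of curves.
    Functions given as limits are handled through explicit errors: relative ones for [rgamma], whose
    zeros become the poles, and uniform ones on bounded parts of the contours. *)

Definition nrm z : R := cRe `|z|.

Lemma complex_ext z w : cRe z = cRe w -> cIm z = cIm w -> z = w.
Proof. by case: z w => [a b] [c d] /= -> ->. Qed.

Lemma cReD z w : cRe (z + w) = cRe z + cRe w.
Proof. by case: z w => [a b] [c d]. Qed.
Lemma cImD z w : cIm (z + w) = cIm z + cIm w.
Proof. by case: z w => [a b] [c d]. Qed.
Lemma cReN z : cRe (- z) = - cRe z.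
Proof. by case: z => [a b]. Qed.
Lemma cImN z : cIm (- z) = - cIm z.
Proof. by case: z => [a b]. Qed.
Lemma cReB z w : cRe (z - w) = cRe z - cRe w.
Proof. by rewrite cReD cReN. Qed.
Lemma cImB z w : cIm (z - w) = cIm z - cIm w.
Proof. by rewrite cImD cImN. Qed.
Lemma cReM z w : cRe (z * w) = cRe z * cRe w - cIm z * cIm w.
Proof. by case: z w => [a b] [c d]. Qed.
Lemma cImM z w : cIm (z * w) = cRe z * cIm w + cIm z * cRe w.
Proof. by case: z w => [a b] [c d]. Qed.
Lemma cIm_cR (x : R) : cIm (cR x) = 0. Proof. by []. Qed.
Lemma cI_E : cI R = Complex 0 1.
Proof. by rewrite /cI -complexiE. Qed.
Lemma cRe_cI : cRe (cI R) = 0. Proof. by rewrite cI_E. Qed.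
Lemma cIm_cI : cIm (cI R) = 1. Proof. by rewrite cI_E. Qed.
Lemma cI2 : cI R ^+ 2 = -1 :> C. Proof. exact: sqrCi. Qed.
Lemma cI_neq0 : cI R != 0. Proof. exact: neq0Ci. Qed.

Lemma cR0 : cR 0 = 0 :> C. Proof. by []. Qed.
Lemma cR1 : cR 1 = 1 :> C. Proof. by []. Qed.
Lemma cRD (x y : R) : cR (x + y) = cR x + cR y.
Proof. by apply: complex_ext; rewrite ?cReD ?cImD //= addr0. Qed.
Lemma cRN (x : R) : cR (- x) = - cR x.
Proof. by apply: complex_ext; rewrite ?cReN ?cImN //= oppr0. Qed.
Lemma cRB (x y : R) : cR (x - y) = cR x - cR y.
Proof. by rewrite cRD cRN. Qed.
Lemma cRM (x y : R) : cR (x * y) = cR x * cR y.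
Proof. by apply: complex_ext; rewrite ?cReM ?cImM /= ?mulr0 ?mul0r ?subr0 ?addr0. Qed.
Lemma cRX (x : R) n : cR (x ^+ n) = cR x ^+ n.
Proof. by elim: n => [|n IH]; rewrite ?expr0// !exprS cRM IH. Qed.
Lemma cR_nat n : cR n%:R = n%:R :> C.
Proof. by elim: n => [|n IH]; rewrite ?mulr0n// -!natr1 cRD IH. Qed.
Lemma cR_int (k : int) : cR k%:~R = k%:~R :> C.
Proof. by case: k => n; rewrite ?NegzE ?mulrNz ?cRN -!pmulrn cR_nat. Qed.
Lemma cR_inj : injective (@cR R).
Proof. by move=> x y /(congr1 (@cRe R)). Qed.
Lemma cR_eq0 (x : R) : (cR x == 0) = (x == 0).
Proof. by apply/eqP/eqP => [/cR_inj|->]. Qed.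
Lemma cRV (x : R) : cR x^-1 = (cR x)^-1.
Proof.
have [->|x0] := eqVneq x 0; first by rewrite invr0 cR0 invr0.
apply: (@mulfI _ (cR x)); first by rewrite cR_eq0.
by rewrite -cRM !divff ?cR_eq0.
Qed.
Lemma cRe_nat n : cRe (n%:R : C) = n%:R.
Proof. by rewrite -cR_nat. Qed.
Lemma cIm_nat n : cIm (n%:R : C) = 0.
Proof. by rewrite -cR_nat. Qed.
Lemma cRe1 : cRe (1 : C) = 1. Proof. by []. Qed.
Lemma cIm1 : cIm (1 : C) = 0. Proof. by []. Qed.
Lemma cReMR (x : R) z : cRe (cR x * z) = x * cRe z.
Proof. by rewrite cReM /= mul0r subr0. Qed.
Lemma cImMR (x : R) z : cIm (cR x * z) = x * cIm z.
Proof. by rewrite cImM /= mul0r addr0. Qed.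
Lemma complexE' (x y : R) : Complex x y = cR x + cR y * cI R :> C.
Proof.
rewrite cI_E; apply: complex_ext; rewrite ?cReD ?cImD ?cReM ?cImM /=; ring.
Qed.
Lemma cRe_sum (I : Type) (r : seq I) (P : pred I) (F : I -> C) :
  cRe (\sum_(i <- r | P i) F i) = \sum_(i <- r | P i) cRe (F i).
Proof. by apply: (big_morph (@cRe R)) => // x y; rewrite cReD. Qed.
Lemma nrmE z : nrm z = Num.sqrt (cRe z ^+ 2 + cIm z ^+ 2).
Proof. by rewrite /nrm /cRe /cIm (normc_def z). Qed.
Lemma normE z : `|z| = cR (nrm z).
Proof. by rewrite nrmE (normc_def z). Qed.
Lemma nrm_ge0 z : 0 <= nrm z.
Proof. by rewrite nrmE sqrtr_ge0. Qed.
Lemma nrm0 : nrm 0 = 0.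
Proof. by rewrite /nrm normr0. Qed.
Lemma nrm1 : nrm 1 = 1.
Proof. by rewrite /nrm normr1. Qed.
Lemma nrm_eq0 z : (nrm z == 0) = (z == 0).
Proof. by rewrite -(normr_eq0 z) normE cR_eq0. Qed.
Lemma nrm_gt0 z : (0 < nrm z) = (z != 0).
Proof. by rewrite lt_def nrm_eq0 nrm_ge0 andbT. Qed.
Lemma nrmM z w : nrm (z * w) = nrm z * nrm w.
Proof. by apply: cR_inj; rewrite cRM -!normE normrM. Qed.
Lemma nrmN z : nrm (- z) = nrm z.
Proof. by rewrite /nrm normrN. Qed.
Lemma nrmV z : nrm z^-1 = (nrm z)^-1.
Proof. by apply: cR_inj; rewrite cRV -!normE normfV. Qed.
Lemma nrmf_div z w : nrm (z / w) = nrm z / nrm w.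
Proof. by rewrite nrmM nrmV. Qed.
Lemma nrmX z n : nrm (z ^+ n) = nrm z ^+ n.
Proof. by apply: cR_inj; rewrite cRX -!normE normrX. Qed.
Lemma nrmD z w : nrm (z + w) <= nrm z + nrm w.
Proof. by rewrite -lecR; have := ler_normD z w; rewrite !normE -cRD. Qed.
Lemma nrmB z w : nrm (z - w) <= nrm z + nrm w.
Proof. by rewrite -(nrmN w) nrmD. Qed.
Lemma nrm_distC z w : nrm (z - w) = nrm (w - z).
Proof. by rewrite -nrmN opprB. Qed.
Lemma nrm_triB z w : nrm z - nrm w <= nrm (z - w).
Proof. by rewrite lerBlDr -{1}(subrK w z) nrmD. Qed.
Lemma nrm_cR x : nrm (cR x) = `|x|.
Proof. by rewrite nrmE /= expr0n /= addr0 sqrtr_sqr. Qed.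
Lemma nrm_nat n : nrm n%:R = n%:R.
Proof. by rewrite -cR_nat nrm_cR ger0_norm. Qed.
Lemma nrm_cI : nrm (cI R) = 1.
Proof. by rewrite nrmE cRe_cI cIm_cI expr0n add0r expr1n sqrtr1. Qed.
Lemma nrm_prod (I : Type) (r : seq I) (P : pred I) (F : I -> C) :
  nrm (\prod_(i <- r | P i) F i) = \prod_(i <- r | P i) nrm (F i).
Proof. by apply: (big_morph nrm) => [x y|]; rewrite ?nrmM ?nrm1. Qed.
Lemma nrm_sum (I : Type) (r : seq I) (P : pred I) (F : I -> C) :
  nrm (\sum_(i <- r | P i) F i) <= \sum_(i <- r | P i) nrm (F i).
Proof.
elim/big_ind2 : _ => //; first by rewrite nrm0.
by move=> x a y b xa yb; apply: le_trans (nrmD _ _) (lerD xa yb).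
Qed.
Lemma nrm_sqr z : nrm z ^+ 2 = cRe z ^+ 2 + cIm z ^+ 2.
Proof. by rewrite nrmE sqr_sqrtr// addr_ge0// sqr_ge0. Qed.
Lemma re_le_nrm z : `|cRe z| <= nrm z.
Proof. by rewrite nrmE -sqrtr_sqr ler_wsqrtr// lerDl sqr_ge0. Qed.
Lemma im_le_nrm z : `|cIm z| <= nrm z.
Proof. by rewrite nrmE -sqrtr_sqr ler_wsqrtr// lerDr sqr_ge0. Qed.
Lemma nrm_le_reim z : nrm z <= `|cRe z| + `|cIm z|.
Proof.
have {1}-> : z = cR (cRe z) + cR (cIm z) * cI R.
  by rewrite -complexE'; case: z.
by apply: le_trans (nrmD _ _) _; rewrite nrmM nrm_cI mulr1 !nrm_cR.
Qed.

Lemma cvgCP (T : Type) (F : set_system T) {FF : Filter F} (u : T -> C) (l : C) :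
  (u x @[x --> F] --> l) <-> forall e : R, 0 < e -> \forall x \near F, nrm (u x - l) < e.
Proof.
split=> [/cvgrPdist_lt cu e e0|cu].
  have e0' : 0 < (cR e : C) by rewrite ltcR.
  have := cu _ e0'; apply: filterS => x; rewrite distrC normE.
  by rewrite ltcR.
apply/cvgrPdist_lt => e e0.
have er : e = cR (cRe e) by rewrite /cR /cRe RRe_real// gtr0_real.
have e0' : 0 < cRe e by move: e0; rewrite er ltcR.
have := cu _ e0'; apply: filterS => x; rewrite distrC normE er ltcR.
by [].
Qed.

Lemma cvgC_le (T : Type) (F : set_system T) {FF : Filter F} (u : T -> C) (l : C)
    (v : T -> R) :
  (\forall x \near F, nrm (u x - l) <= v x) -> v x @[x --> F] --> (0 : R) ->
  u x @[x --> F] --> l.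
Proof.
move=> uv v0; apply/cvgCP => e e0.
move/cvgrPdist_lt : v0 => /(_ _ e0).
apply: filterS2 uv => x ux; rewrite sub0r normrN => vx.
by apply: le_lt_trans ux _; apply: le_lt_trans vx; rewrite ler_norm.
Qed.

Lemma cvg_cRe (T : Type) (F : set_system T) {FF : Filter F} (u : T -> C) (l : C) :
  u x @[x --> F] --> l -> cRe (u x) @[x --> F] --> cRe l.
Proof.
move=> /cvgCP cu; apply/cvgrPdist_lt => e /cu; apply: filterS => x.
by apply: le_lt_trans; rewrite -cReB nrm_distC re_le_nrm.
Qed.
Lemma cvg_cIm (T : Type) (F : set_system T) {FF : Filter F} (u : T -> C) (l : C) :
  u x @[x --> F] --> l -> cIm (u x) @[x --> F] --> cIm l.
Proof.
move=> /cvgCP cu; apply/cvgrPdist_lt => e /cu; apply: filterS => x.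
by apply: le_lt_trans; rewrite -cImB nrm_distC im_le_nrm.
Qed.
Lemma cvg_nrm (T : Type) (F : set_system T) {FF : Filter F} (u : T -> C) (l : C) :
  u x @[x --> F] --> l -> nrm (u x) @[x --> F] --> nrm l.
Proof.
move=> /cvgCP cu; apply/cvgrPdist_lt => e /cu; apply: filterS => x.
apply: le_lt_trans; rewrite ler_norml lerNl opprB nrm_triB /=.
by rewrite nrm_distC nrm_triB.
Qed.
Lemma cvg_cR (T : Type) (F : set_system T) {FF : Filter F} (u : T -> R) (l : R) :
  u x @[x --> F] --> l -> (cR (u x) : C) @[x --> F] --> (cR l : C).
Proof.
move=> /cvgrPdist_lt cu; apply/cvgCP => e /cu; apply: filterS => x.
by rewrite -cRB nrm_cR distrC.
Qed.
Lemma cvg_reim (T : Type) (F : set_system T) {FF : Filter F} (u : T -> C) (l : C) :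
  cRe (u x) @[x --> F] --> cRe l -> cIm (u x) @[x --> F] --> cIm l ->
  u x @[x --> F] --> l.
Proof.
move=> re im.
apply: (@cvgC_le _ _ _ _ _ (fun x => `|cRe (u x) - cRe l| + `|cIm (u x) - cIm l|)).
  by apply: nearW => x; rewrite -cReB -cImB nrm_le_reim.
rewrite -[X in _ --> X](addr0 (0 : R)).
apply: cvgD; apply/norm_cvg0P/subr_cvg0; [exact: re|exact: im].
Qed.

Lemma cvgC_lim (u : nat -> C) (l : C) : u @ \oo --> l -> lim (u @ \oo) = l.
Proof. by move/cvg_lim; apply; exact: norm_hausdorff. Qed.

Lemma cvgC_unique (T : Type) (F : set_system T) {FF : ProperFilter F} (u : T -> C) (l l' : C) :
  u x @[x --> F] --> l -> u x @[x --> F] --> l' -> l = l'.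
Proof. by apply: cvg_unique; exact: norm_hausdorff. Qed.

End ComplexBasics.

(** * Exponential *)

Section RealTrig.
Variable R : realType.
Implicit Types x y : R.

Lemma norm_sin_le x : `|sin x| <= `|x|.
Proof.
wlog x0 : x / 0 <= x => [H|].
  have [x0|/ltW x0] := leP 0 x; first exact: H.
  by rewrite -(normrN x) -(normrN (sin x)) -sinN H// oppr_ge0.
have dsin y : y \in `]0, x[%R -> is_derive y 1 sin (cos y).
  by move=> _; exact: is_derive_sin.
have [|c _] := MVT_segment x0 dsin.
  by apply: continuous_subspaceT => y; exact: continuous_sin.
by rewrite sin0 !subr0 => ->; rewrite normrM ler_piMl// cos_max.
Qed.

Lemma norm_cosB1_le x : `|cos x - 1| <= x ^+ 2 / 2.
Proof.
have -> : cos x - 1 = - (2 * sin (x / 2) ^+ 2).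
  have {1}-> : x = (x / 2) *+ 2 by rewrite mulr2n; lra.
  by rewrite cos_mulr2n sin2cos2; ring.
rewrite normrN normrM normrX (ger0_norm (ler0n _ _)).
have := norm_sin_le (x / 2); rewrite normrM (@ger0_norm _ (2^-1)) ?invr_ge0// => h.
have : `|sin (x / 2)| ^+ 2 <= (`|x| / 2) ^+ 2 by rewrite lerXn2r ?nnegrE// ?divr_ge0.
rewrite expr_div_n (@real_normK _ x) ?num_real//; lra.
Qed.

Lemma norm_sinBid_le x : `|sin x - x| <= `|x| * x ^+ 2 / 2.
Proof.
wlog x0 : x / 0 <= x => [H|].
  have [x0|/ltW x0] := leP 0 x; first exact: H.
  have : `|sin (- x) - (- x)| <= `|- x| * (- x) ^+ 2 / 2 by rewrite H// oppr_ge0.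
  by rewrite sinN -opprD !normrN sqrrN.
have df y : y \in `]0, x[%R -> is_derive y 1 (fun y => sin y - y) (cos y - 1).
  by move=> _; apply: is_deriveB.
have [|c cx] := MVT_segment x0 df.
  by apply: continuous_subspaceT => y; apply: cvgB => //; exact: continuous_sin.
rewrite sin0 !subr0 => ->; rewrite normrM mulrC -mulrA ler_wpM2l//.
apply: le_trans (norm_cosB1_le _) _; rewrite ler_wpM2r ?invr_ge0//.
move: cx; rewrite in_itv /= => /andP[c0 cx].
by rewrite lerXn2r// nnegrE.
Qed.

Lemma expR_sub1_bounds x : `|x| <= 1 / 2 -> x <= expR x - 1 <= x + 2 * x ^+ 2.
Proof.
rewrite ler_norml => /andP[xl xu].
have h1 := expR_ge1Dx x; apply/andP; split; first lra.
have x1 : 0 < 1 - x by lra.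
have h2 : expR x <= (1 - x)^-1.
  by rewrite -[x in expR x]opprK expRN lef_pV2 ?posrE ?expR_gt0//; exact: expR_ge1Dx.
have x2 : 0 <= x ^+ 2 by exact: sqr_ge0.
have h3 : (1 - x)^-1 <= 1 + x + 2 * x ^+ 2.
  by rewrite -[_^-1]mul1r ler_pdivrMr//; nra.
lra.
Qed.

End RealTrig.

Section ComplexExp.
Variable R : realType.
Local Notation C := (C R).
Implicit Types z w : C.

Lemma cRe_cexp z : cRe (cexp z) = expR (cRe z) * cos (cIm z). Proof. by []. Qed.
Lemma cIm_cexp z : cIm (cexp z) = expR (cRe z) * sin (cIm z). Proof. by []. Qed.

Lemma cexp0 : cexp 0 = 1 :> C.
Proof. by apply: complex_ext; rewrite ?cRe_cexp ?cIm_cexp /= expR0 ?cos0 ?sin0 mul1r. Qed.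

Lemma cexpD z w : cexp (z + w) = cexp z * cexp w.
Proof.
apply: complex_ext; rewrite ?cReM ?cImM ?cRe_cexp ?cIm_cexp cReD cImD expRD ?cosD ?sinD;
ring.
Qed.

Lemma nrm_cexp z : nrm (cexp z) = expR (cRe z).
Proof.
rewrite nrmE cRe_cexp cIm_cexp !exprMn -mulrDr cos2Dsin2 mulr1 sqrtr_sqr.
by rewrite ger0_norm// expR_ge0.
Qed.

Lemma cexp_neq0 z : cexp z != 0.
Proof. by rewrite -nrm_eq0 nrm_cexp expR_eq0. Qed.

Lemma cexpN z : cexp (- z) = (cexp z)^-1.
Proof.
apply: (@mulfI _ (cexp z)); first exact: cexp_neq0.
by rewrite -cexpD subrr cexp0 divff// cexp_neq0.
Qed.

Lemma cexpB z w : cexp (z - w) = cexp z / cexp w.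
Proof. by rewrite cexpD cexpN. Qed.

Lemma cexpMn n z : cexp (n%:R * z) = cexp z ^+ n.
Proof.
elim: n => [|n IH]; first by rewrite mul0r cexp0.
by rewrite -natr1 mulrDl mul1r cexpD IH exprSr.
Qed.

Lemma cexpMz (k : int) z : cexp (k%:~R * z) = cexp z ^ k.
Proof.
case: k => n; first by rewrite -pmulrn cexpMn.
by rewrite NegzE mulrNz mulNr cexpN -pmulrn cexpMn.
Qed.

Lemma cexp_sum (I : Type) (r : seq I) (P : pred I) (F : I -> C) :
  cexp (\sum_(i <- r | P i) F i) = \prod_(i <- r | P i) cexp (F i).
Proof. by apply: (big_morph (@cexp R)) => [x y|]; rewrite ?cexpD ?cexp0. Qed.

Lemma cexp_cR (x : R) : cexp (cR x) = cR (expR x).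
Proof.
by apply: complex_ext; rewrite ?cRe_cexp ?cIm_cexp /= ?cos0 ?sin0 ?mulr1 ?mulr0.
Qed.

Lemma nrm_cexp_le z : nrm (cexp z) <= expR (nrm z).
Proof. by rewrite nrm_cexp ler_expR (le_trans (ler_norm _) (re_le_nrm _)). Qed.

(** Second-order control at 0 stands in for the power series: it produces the O(N^-2) of the Gauss
    ratios, the limit (1 + z/n)^n and the quadratic smallness of [ccos z - 1]. *)
Lemma cexp_taylor1 z : nrm z <= 1 / 2 -> nrm (cexp z - 1 - z) <= 4 * nrm z ^+ 2.
Proof.
move=> z1; rewrite nrm_sqr.
have /(le_trans (re_le_nrm z)) x1 := z1; have /(le_trans (im_le_nrm z)) y1 := z1.
apply: le_trans (nrm_le_reim _) _.
rewrite !cReB !cImB cRe_cexp cIm_cexp cRe1 cIm1 subr0.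
move: (cRe z) (cIm z) x1 y1 => {z z1} x y x1 y1.
have /andP[e1 e2] := expR_sub1_bounds x1.
have c1 := norm_cosB1_le y; have s1 := norm_sinBid_le y; have s2 := norm_sin_le y.
set E := expR x in e1 e2 *.
have h1 : `|E * cos y - 1 - x| <= 2 * x ^+ 2 + 3 / 4 * y ^+ 2.
  have -> : E * cos y - 1 - x = (E - 1 - x) * cos y + (1 + x) * (cos y - 1) by ring.
  apply: le_trans (ler_normD _ _) _; apply: lerD.
    rewrite normrM ger0_norm; last lra.
    by rewrite -[leRHS]mulr1 ler_pM// ?cos_max//; lra.
  rewrite normrM.
  have : `|1 + x| <= 3 / 2.
    by move: x1; rewrite !ler_norml => /andP[??]; apply/andP; split; lra.
  have := normr_ge0 (1 + x); have := normr_ge0 (cos y - 1); have := sqr_ge0 y; nra.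
have h2 : `|E * sin y - y| <= 2 * `|x| * `|y| + `|y| * y ^+ 2 / 2.
  have -> : E * sin y - y = (E - 1) * sin y + (sin y - y) by ring.
  apply: le_trans (ler_normD _ _) _; apply: lerD => //.
  rewrite normrM ler_pM//.
  have x2 : 2 * x ^+ 2 <= `|x|.
    by rewrite -real_normK ?num_real//; have := normr_ge0 x; nra.
  have := ler_norm x; have := ler_norm (- x); rewrite normrN => ? ?.
  by rewrite ler_norml; apply/andP; split; have := sqr_ge0 x; lra.
have x2 : x ^+ 2 = `|x| ^+ 2 by rewrite real_normK ?num_real.
have y2 : y ^+ 2 = `|y| ^+ 2 by rewrite real_normK ?num_real.
move: h1 h2; rewrite x2 y2; have := normr_ge0 x; have := normr_ge0 y.
move: x1 y1; move: (`|x|) (`|y|) => a b a1 b1 b0 a0 h1 h2.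
apply: le_trans (lerD h1 h2) _.
have : 0 <= (a - b) ^+ 2 by exact: sqr_ge0.
have : b * b ^+ 2 <= b ^+ 2 by have := sqr_ge0 b; nra.
have := sqr_ge0 a; have := sqr_ge0 b; nra.
Qed.

Lemma cexpB1_le z : nrm z <= 1 / 2 -> nrm (cexp z - 1) <= 3 * nrm z.
Proof.
move=> z1; have := cexp_taylor1 z1; have := nrmD (cexp z - 1 - z) z.
by rewrite subrK; have := nrm_ge0 z; nra.
Qed.

Lemma nrm_exprB z w (M : R) n : 1 <= M -> nrm z <= M -> nrm w <= M ->
  nrm (z ^+ n - w ^+ n) <= n%:R * M ^+ n * nrm (z - w).
Proof.
move=> M1 zM wM; have M0 : 0 <= M by lra.
elim: n => [|n IH]; first by rewrite !expr0 subrr nrm0 !mul0r.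
have -> : z ^+ n.+1 - w ^+ n.+1 = z * (z ^+ n - w ^+ n) + (z - w) * w ^+ n.
  by rewrite !exprS; ring.
apply: le_trans (nrmD _ _) _; rewrite !nrmM nrmX -natr1 mulrDl mulrDl mul1r.
apply: lerD.
  apply: le_trans (ler_pM (nrm_ge0 _) (nrm_ge0 _) zM IH) _.
  by rewrite exprS; lra.
rewrite mulrC ler_wpM2r ?nrm_ge0//.
have h : nrm w ^+ n <= M ^+ n by rewrite lerXn2r ?nnegrE ?nrm_ge0.
by apply: le_trans h _; rewrite exprS ler_peMl ?exprn_ge0.
Qed.

(** Comparing n-th powers of e^(z/n) and 1 + z/n costs a factor n against an error O(n^-2). The
    bound is uniform on balls, which makes the exponential a uniform limit of polynomials in the
    residue theorem below. *)
Lemma cexp_powerB z n : 2 * nrm z <= n.+1%:R ->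
  nrm (cexp z - (1 + z / n.+1%:R) ^+ n.+1) <= 4 * expR (nrm z) * nrm z ^+ 2 / n.+1%:R.
Proof.
move=> zn; have n0 : 0 < n.+1%:R :> R by [].
have nz : n.+1%:R != 0 :> C by rewrite pnatr_eq0.
have {1}-> : z = n.+1%:R * (z / n.+1%:R) by field.
rewrite cexpMn; set h := z / n.+1%:R.
have hE : nrm h = nrm z / n.+1%:R by rewrite nrmf_div nrm_nat.
apply: le_trans (@nrm_exprB _ _ (expR (nrm h)) n.+1 _ _ _) _.
- by rewrite -expR0 ler_expR nrm_ge0.
- exact: nrm_cexp_le.
- by apply: le_trans (nrmD _ _) _; rewrite nrm1 expR_ge1Dx.
rewrite -expRM_natl hE mulrCA divff ?gt_eqF// mulr1.
have h1 : nrm h <= 1 / 2 by rewrite hE ler_pdivrMr//; lra.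
have /cexp_taylor1 := h1; rewrite hE opprD addrA => h2.
apply: le_trans (ler_wpM2l _ h2) _; first by rewrite mulr_ge0// expR_ge0.
rewrite expr_div_n le_eqVlt; apply/orP; left; apply/eqP; field.
by rewrite gt_eqF// ltr_pwDl.
Qed.

Lemma rpowC_neq0 (x : R) (s : C) : rpowC x s != 0.
Proof. exact: cexp_neq0. Qed.
Lemma rpowCD (x : R) (s t : C) : rpowC x (s + t) = rpowC x s * rpowC x t.
Proof. by rewrite /rpowC mulrDl cexpD. Qed.
Lemma rpowCN (x : R) (s : C) : rpowC x (- s) = (rpowC x s)^-1.
Proof. by rewrite /rpowC mulNr cexpN. Qed.
Lemma nrm_rpowC (x : R) (s : C) : nrm (rpowC x s) = expR (cRe s * ln x).
Proof. by rewrite /rpowC nrm_cexp mulrC cReMR mulrC. Qed.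
Lemma rpowC_nat (x : R) n : 0 < x -> rpowC x n%:R = cR x ^+ n.
Proof. by move=> x0; rewrite /rpowC cexpMn cexp_cR lnK. Qed.
Lemma rpowC1 (x : R) : 0 < x -> rpowC x 1 = cR x.
Proof. by move=> x0; rewrite (rpowC_nat 1). Qed.

End ComplexExp.

(** * The reciprocal Gamma function *)

Section Gamma.
Variable R : realType.
Local Notation C := (C R).
Implicit Types s t z w : C.

Lemma cauchyC_cvg (u : nat -> C) :
  (forall e : R, 0 < e -> exists N, forall M, (N <= M)%N -> nrm (u M - u N) <= e) ->
  exists l : C, u @ \oo --> l.
Proof.
move=> cu.
have cauchyR (v : nat -> R) : (forall p q, `|v p - v q| <= nrm (u p - u q)) ->
    cvgn v.
  move=> vu; apply/cauchy_cvgP/cauchy_exP => e e0.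
  have [|N hN] := cu (e / 2); first by rewrite divr_gt0.
  exists (v N), N => // M /= /hN hM; rewrite /ball /= distrC.
  by apply: le_lt_trans (vu _ _) _; lra.
have cre : cvgn (fun n => cRe (u n)).
  by apply: cauchyR => p q; rewrite -cReB re_le_nrm.
have cim : cvgn (fun n => cIm (u n)).
  by apply: cauchyR => p q; rewrite -cImB im_le_nrm.
exists (Complex (limn (fun n => cRe (u n))) (limn (fun n => cIm (u n)))).
exact: cvg_reim.
Qed.

Lemma prod_rel_bound (x rho : nat -> C) (K : R) (N : nat) : 0 <= K -> (0 < N)%N ->
  (forall M, (N <= M)%N -> x M.+1 = x M * rho M) ->
  (forall M, (N <= M)%N -> nrm (rho M - 1) <= K / M%:R ^+ 2) ->
  forall M, (N <= M)%N -> nrm (x M - x N) <= nrm (x N) * (expR (2 * K / N%:R) - 1).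
Proof.
move=> K0 N0 xr rK M NM.
(* 2K/N - 2K/M telescopes to a majorant of the sum of K/j^2 over N <= j < M, since 1/j^2 <=
   2/(j(j+1)) for j >= 1. *)
pose a M : R := 2 * K / N%:R - 2 * K / M%:R.
suff [_ h] : nrm (x M) <= nrm (x N) * expR (a M) /\
    nrm (x M - x N) <= nrm (x N) * (expR (a M) - 1).
  apply: le_trans h _; rewrite ler_wpM2l ?nrm_ge0// lerB// ler_expR.
  by rewrite lerBlDr lerDl divr_ge0// mulr_ge0.
elim: M NM => [|M IH]; first by rewrite leqn0 => /eqP N0'; rewrite N0' in N0.
rewrite leq_eqVlt => /predU1P[<-|]; first by rewrite /a !subrr expR0 mulr1 subrr nrm0 mulr0.
rewrite ltnS => NM; have [h1 h2] := IH NM.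
have M0 : (0 : R) < M%:R by rewrite ltr0n (leq_trans N0).
have step : expR (a M) * (1 + K / M%:R ^+ 2) <= expR (a M.+1).
  apply: (@le_trans _ _ (expR (a M) * expR (K / M%:R ^+ 2))).
    by rewrite ler_wpM2l ?expR_ge0 ?expR_ge1Dx.
  rewrite -expRD ler_expR /a -addrA lerD2l -subr_ge0.
  have -> : - (2 * K / M.+1%:R) - (- (2 * K / M%:R) + K / M%:R ^+ 2) =
     K * (M%:R - 1) / (M%:R ^+ 2 * (M%:R + 1)).
    by rewrite -natr1; field; rewrite ?gt_eqF//; lra.
  rewrite divr_ge0//; first by rewrite mulr_ge0// subr_ge0 ler1n -(ltr0n R).
have step' : nrm (x N) * expR (a M) * (1 + K / M%:R ^+ 2) <= nrm (x N) * expR (a M.+1).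
  by rewrite -mulrA ler_wpM2l ?nrm_ge0.
have h3 : nrm (x M) * nrm (rho M - 1) <= nrm (x N) * expR (a M) * (K / M%:R ^+ 2).
  by rewrite ler_pM ?nrm_ge0// rK.
have e1 : x M.+1 = x M + x M * (rho M - 1) by rewrite xr//; ring.
split.
  by rewrite e1; apply: le_trans (nrmD _ _) _; rewrite nrmM; lra.
have -> : x M.+1 - x N = (x M - x N) + x M * (rho M - 1) by rewrite e1; ring.
by apply: le_trans (nrmD _ _) _; rewrite nrmM; lra.
Qed.

Definition rgamma_ratio s (N : nat) : C :=
  (1 + s / N.+1%:R) * cexp (- (s * cR (ln (1 + N%:R^-1)))).

Lemma rgamma_approxS s N : (0 < N)%N ->
  rgamma_approx s N.+1 = rgamma_approx s N * rgamma_ratio s N.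
Proof.
move=> N0; rewrite /rgamma_approx /rgamma_ratio big_ord_recr /=.
have N0' : (0 : R) < N%:R by rewrite ltr0n.
have -> : 1 + N%:R^-1 = N.+1%:R / N%:R :> R.
  by rewrite -natr1; field; rewrite gt_eqF.
rewrite ln_div ?posrE// cRB mulrBr cexpN cexpB factS natrM -/(rpowC _ _) -/(rpowC _ _).
field.
have p1 := rpowC_neq0 (N%:R : R) s; have p2 := rpowC_neq0 (N.+1%:R : R) s.
have f0 : N`!%:R != 0 :> C by rewrite pnatr_eq0 -lt0n fact_gt0.
have n0 : 1 + N%:R != 0 :> C by rewrite nat1r pnatr_eq0.
by rewrite p1 p2 f0 n0.
Qed.

Lemma ln1D_inv_bounds (N : nat) : (0 < N)%N ->
  (N.+1%:R^-1 : R) <= ln (1 + N%:R^-1 : R) <= N%:R^-1.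
Proof.
move=> N0; have N0' : (0 : R) < N%:R by rewrite ltr0n.
have NV : 0 < N%:R^-1 :> R by rewrite invr_gt0.
apply/andP; split; last by apply: le_ln1Dx; lra.
have -> : 1 + N%:R^-1 = (1 - N.+1%:R^-1)^-1 :> R.
  by rewrite -natr1; field; rewrite ?gt_eqF//; lra.
have h : N.+1%:R^-1 < 1 :> R by rewrite invf_lt1// ltr1n ltnS.
by rewrite lnV ?posrE ?subr_gt0// lerNr; apply: le_ln1Dx; rewrite ltrN2.
Qed.

Lemma rgamma_ratio_bound (B : R) s (N : nat) : 0 <= B -> nrm s <= B -> (0 < N)%N ->
  2 * B <= N%:R ->
  nrm (rgamma_ratio s N - 1) <= (B + B ^+ 2 + 4 * B ^+ 2 * (1 + B)) / N%:R ^+ 2.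
Proof.
move=> B0 sB N0 BN; have N0' : (0 : R) < N%:R by rewrite ltr0n.
have /andP[l1 l2] := ln1D_inv_bounds N0; set l := ln _ in l1 l2.
pose u : R := N.+1%:R^-1; pose v : R := N%:R^-1.
have u0 : 0 < u by rewrite invr_gt0.
have uv : v - u <= v ^+ 2.
  have -> : v - u = u * v by rewrite /u /v -natr1; field; rewrite ?gt_eqF//; lra.
  by rewrite expr2 ler_wpM2r ?invr_ge0// lef_pV2 ?posrE// ler_nat.
have l0 : 0 < l by exact: lt_le_trans l1.
have v0 : 0 < v by rewrite invr_gt0.
have Bl : B * l <= 1 / 2.
  apply: (@le_trans _ _ (B * v)); first by rewrite ler_wpM2l.
  by rewrite /v ler_pdivrMr//; lra.
have nsl : nrm (- (s * cR l)) <= B * l.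
  by rewrite nrmN nrmM nrm_cR gtr0_norm// ler_wpM2r// ltW.
have := cexp_taylor1 (le_trans nsl Bl); rewrite opprK.
set E := (X in nrm X) => hE.
(* With u = 1/(N+1), l = ln(1 + 1/N) and E the second-order remainder of the exponential, the
   first-order terms combine to s(u - l), and |u - l| <= v - u <= v^2 for v = 1/N. *)
have -> : rgamma_ratio s N - 1 =
    s * cR (u - l) - s ^+ 2 * cR (u * l) + (1 + s * cR u) * E.
  by rewrite /rgamma_ratio -/l /E cRB cRM /u cRV cR_nat; ring.
have hE' : nrm E <= 4 * B ^+ 2 * v ^+ 2.
  apply: le_trans hE _; rewrite -mulrA -exprMn ler_wpM2l//.
  rewrite lerXn2r ?nnegrE ?nrm_ge0 ?mulr_ge0 ?(ltW v0)//.
  by apply: le_trans nsl _; rewrite ler_wpM2l.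
apply: (@le_trans _ _ (B * v ^+ 2 + B ^+ 2 * v ^+ 2 + (1 + B) * (4 * B ^+ 2 * v ^+ 2))); last first.
  by rewrite /v -exprVn; lra.
apply: le_trans (nrmD _ _) _; apply: lerD.
  apply: le_trans (nrmB _ _) _; apply: lerD; rewrite nrmM nrm_cR.
    rewrite ler_pM ?nrm_ge0// ler0_norm ?subr_le0// opprB.
    by apply: le_trans uv; rewrite lerD2r.
  rewrite nrmX ler_pM ?exprn_ge0 ?nrm_ge0//.
    by rewrite lerXn2r ?nnegrE ?nrm_ge0.
  rewrite gtr0_norm ?mulr_gt0// expr2 ler_pM ?(ltW u0) ?(ltW l0)//.
  by rewrite /u /v; apply: le_trans l2.
rewrite nrmM ler_pM ?nrm_ge0//.
apply: le_trans (nrmD _ _) _; rewrite nrm1 lerD2l nrmM nrm_cR gtr0_norm//.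
rewrite -[leRHS]mulr1 ler_pM ?nrm_ge0 ?(ltW u0)//.
by rewrite /u invf_le1// ler1n.
Qed.

(** The factor [x_(N+1)/x_N] is [1 + O(N^-2)] uniformly for [|s| <= B], so [x_M]
    differs from [x_N] by a small multiple of [x_N] itself; a relative error
    keeps its meaning at the zeros of [rgamma]. *)
Lemma rgamma_approx_rel (B : R) : 0 <= B -> exists (K : R) (N0 : nat), [/\ 0 <= K, (0 < N0)%N &
  forall s N M, nrm s <= B -> (N0 <= N)%N -> (N <= M)%N ->
  nrm (rgamma_approx s M - rgamma_approx s N) <=
  nrm (rgamma_approx s N) * (expR (K / N%:R) - 1)].
Proof.
move=> B0; pose K := B + B ^+ 2 + 4 * B ^+ 2 * (1 + B).
have K0 : 0 <= K by rewrite /K; have := sqr_ge0 B; nra.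
exists (2 * K), (Num.bound (2 * B)).+1; split=> //; first by rewrite mulr_ge0.
move=> s N M sB NN NM.
apply: (@prod_rel_bound _ (rgamma_ratio s)) => //.
- exact: leq_trans NN.
- by move=> m Nm; apply: rgamma_approxS; apply: leq_trans Nm; exact: leq_trans NN.
move=> m Nm; apply: rgamma_ratio_bound => //.
  by apply: leq_trans Nm; exact: leq_trans NN.
have h : (Num.bound (2 * B) <= m)%N by apply: leq_trans Nm; exact: ltnW.
apply: (@le_trans _ _ (Num.bound (2 * B))%:R); last by rewrite ler_nat.
by rewrite ltW// archi_boundP// mulr_ge0.
Qed.

Lemma cvg_invn : (n%:R^-1 : R) @[n --> \oo] --> (0 : R).
Proof.
apply/gtr0_cvgV0; last exact: cvgr_idn.
by near=> n; rewrite ltr0n; near: n; exact: nbhs_infty_gt.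
Unshelve. all: by end_near. Qed.

Lemma cvg_expR_inv (K : R) : (expR (K / n%:R) - 1) @[n --> \oo] --> (0 : R).
Proof.
rewrite -[X in _ --> X](subrr (1 : R)); apply: cvgB; last exact: cvg_cst.
rewrite -[X in _ --> X]expR0; apply: continuous_cvg; first exact: continuous_expR.
rewrite -[X in _ --> X](mulr0 K); apply: cvgM; first exact: cvg_cst.
exact: cvg_invn.
Qed.

(** [lim] returns a default value off convergent sequences, so convergence must come before any use
    of the definition of [rgamma]. The relative error bound, together with the bound [D] on all late
    terms, gives the Cauchy property. *)
Lemma rgamma_cvg s : rgamma_approx s @ \oo --> rgamma s.
Proof.
have [K [N0 [K0 N00 h]]] := rgamma_approx_rel (nrm_ge0 s).
suff [l hl] : exists l : C, rgamma_approx s @ \oo --> l.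
  by rewrite /rgamma (cvgC_lim hl).
pose D := nrm (rgamma_approx s N0) * expR (K / N0%:R).
have D0 : 0 <= D by rewrite mulr_ge0 ?nrm_ge0 ?expR_ge0.
have bD N : (N0 <= N)%N -> nrm (rgamma_approx s N) <= D.
  move=> NN; have := h s N0 N (lexx _) (leqnn _) NN.
  have := nrm_triB (rgamma_approx s N) (rgamma_approx s N0); rewrite /D; lra.
apply: cauchyC_cvg => e e0.
have /cvgrPdist_lt /(_ (e / (D + 1))) := cvg_expR_inv K.
have eD : 0 < e / (D + 1) by rewrite divr_gt0//; lra.
move=> /(_ eD) [N1 _ hN1].
exists (maxn N0 N1) => M NM.
apply: le_trans (h s _ _ (lexx _) (leq_maxl _ _) NM) _.
have := hN1 (maxn N0 N1) (leq_maxr _ _); rewrite sub0r normrN => /ltW he.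
have := ler_wpM2l D0 (le_trans (ler_norm _) he).
have := ler_wpM2r (le_trans (normr_ge0 _) he) (bD _ (leq_maxl N0 N1)).
have : D * (e / (D + 1)) <= e by rewrite mulrA ler_pdivrMr; nra.
have := bD _ (leq_maxl N0 N1); have := ler_norm (expR (K / (maxn N0 N1)%:R) - 1).
have : 0 <= expR (K / (maxn N0 N1)%:R) - 1.
  by rewrite subr_ge0 -expR0 ler_expR divr_ge0.
by have := nrm_ge0 (rgamma_approx s (maxn N0 N1)); nra.
Qed.

Arguments rgamma_cvg s : clear implicits.

Lemma rgamma_rel (B : R) : 0 <= B -> exists (K : R) (N0 : nat), [/\ 0 <= K, (0 < N0)%N &
  forall s N, nrm s <= B -> (N0 <= N)%N ->
  nrm (rgamma s - rgamma_approx s N) <=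
  nrm (rgamma_approx s N) * (expR (K / N%:R) - 1)].
Proof.
move=> B0; have [K [N0 [K0 N00 h]]] := rgamma_approx_rel B0.
exists K, N0; split => // s N sB NN.
have cv : nrm (rgamma_approx s M - rgamma_approx s N) @[M --> \oo] -->
    nrm (rgamma s - rgamma_approx s N).
  by apply: cvg_nrm; apply: cvgB; [exact: rgamma_cvg|exact: cvg_cst].
apply: (cvgr_to_le cv).
near=> M; apply: h => //; near: M; exact: nbhs_infty_ge.
Unshelve. all: by end_near. Qed.

Lemma rgamma_tail_small (B : R) : 0 <= B -> forall e : R, 0 < e ->
  exists N0 : nat, forall s N, nrm s <= B -> (N0 <= N)%N ->
  nrm (rgamma s - rgamma_approx s N) <= nrm (rgamma_approx s N) * e.
Proof.
move=> B0 e e0; have [K [N0 [K0 N00 h]]] := rgamma_rel B0.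
have /cvgrPdist_lt /(_ e e0) [N1 _ hN1] := cvg_expR_inv K.
exists (maxn N0 N1) => s N sB NN.
apply: le_trans (h s N sB (leq_trans (leq_maxl _ _) NN)) _.
rewrite ler_wpM2l ?nrm_ge0// ltW//.
have := hN1 N (leq_trans (leq_maxr _ _) NN); rewrite sub0r normrN.
exact: le_lt_trans (ler_norm _).
Qed.

Lemma rgamma_approx_neq0 s N : (forall j : nat, s + j%:R != 0) ->
  rgamma_approx s N != 0.
Proof.
move=> sj; rewrite /rgamma_approx mulf_neq0//.
  by rewrite prodf_seq_neq0; apply/allP => j _; rewrite sj.
by rewrite invr_eq0 mulf_neq0 ?rpowC_neq0// pnatr_eq0 -lt0n fact_gt0.
Qed.

(** A relative error of at most 1/2 cannot bring a nonzero Gauss product to 0. *)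
Lemma rgamma_neq0 s : (forall j : nat, s + j%:R != 0) -> rgamma s != 0.
Proof.
move=> sj; have [N0 h] := rgamma_tail_small (nrm_ge0 s) (ltr0Sn R 0 : 0 < 1).
have [] := rgamma_tail_small (nrm_ge0 s) (e := 1 / 2); first by lra.
move=> N1 /(_ s N1.+1 (lexx _) (leqnSn _)); apply: contraTneq => ->.
rewrite sub0r nrmN -ltNge; have : 0 < nrm (rgamma_approx s N1.+1).
  by rewrite nrm_gt0 rgamma_approx_neq0.
lra.
Qed.

Lemma cvgC_invn : (n%:R^-1 : C) @[n --> \oo] --> (0 : C).
Proof.
have h := cvg_cR cvg_invn.
have -> : (fun n : nat => n%:R^-1 : C) = (fun n => cR n%:R^-1) by apply/funext => n; rewrite cRV cR_nat.
exact: h.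
Qed.

Lemma rgammaS s : rgamma s = s * rgamma (s + 1).
Proof.
have h1 : s * rgamma_approx (s + 1) N @[N --> \oo] --> s * rgamma (s + 1).
  by apply: cvgM; [exact: cvg_cst|exact: rgamma_cvg].
apply: cvgC_unique h1.
(* The Gauss products satisfy the recursion up to the factor (s + 1 + N)/N, which tends to 1. *)
have h2 : rgamma_approx s N * (1 + (s + 1) * N%:R^-1) @[N --> \oo] --> rgamma s.
  rewrite -[X in _ --> X]mulr1; apply: cvgM; first exact: rgamma_cvg.
  rewrite -[X in _ --> X]addr0; apply: cvgD; first exact: cvg_cst.
  rewrite -[X in _ --> X](mulr0 (s + 1)); apply: cvgM; first exact: cvg_cst.
  exact: cvgC_invn.
apply: cvg_trans h2; apply: near_eq_cvg; near=> N.
have N0 : (0 < N)%N by near: N; exact: nbhs_infty_gt.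
have N0' : (0 : R) < N%:R by rewrite ltr0n.
rewrite /rgamma_approx rpowCD rpowC1// cR_nat.
have -> : \prod_(j < N.+1) (s + 1 + j%:R) = \prod_(1 <= j < N.+2) (s + j%:R).
  rewrite big_add1 /= big_mkord; apply: eq_bigr => j _.
  by rewrite -addrA nat1r.
have e : s * \prod_(1 <= j < N.+2) (s + j%:R) =
         (\prod_(j < N.+1) (s + j%:R)) * (s + 1 + N%:R).
  rewrite -(big_mkord xpredT (fun j => s + j%:R)) -addrA nat1r -big_nat_recr//=.
  by rewrite [RHS]big_ltn// addr0.
rewrite mulrA e; field.
have f0 : N`!%:R != 0 :> C by rewrite pnatr_eq0 -lt0n fact_gt0.
by rewrite rpowC_neq0 f0 pnatr_eq0 -lt0n N0.
Unshelve. all: by end_near. Qed.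

Lemma rgammaDn s (n : nat) : rgamma s = \prod_(j < n) (s + j%:R) * rgamma (s + n%:R).
Proof.
elim: n => [|n IH]; first by rewrite big_ord0 mul1r addr0.
by rewrite big_ord_recr /= IH (rgammaS (s + n%:R)) -addrA natr1 mulrA.
Qed.

Lemma rgamma1 : rgamma (1 : C) = 1.
Proof.
apply: cvgC_unique (rgamma_cvg 1) _.
have h2 : (1 + N%:R^-1 : C) @[N --> \oo] --> (1 : C).
  rewrite -[X in _ --> X]addr0; apply: cvgD; first exact: cvg_cst.
  exact: cvgC_invn.
apply: cvg_trans h2; apply: near_eq_cvg; near=> N.
have N0 : (0 < N)%N by near: N; exact: nbhs_infty_gt.
rewrite /rgamma_approx rpowC1 ?ltr0n// cR_nat.
have -> : \prod_(j < N.+1) (1 + j%:R) = (N.+1)`!%:R :> C.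
  rewrite fact_prod natr_prod big_add1 /= big_mkord; apply: eq_bigr => j _.
  by rewrite nat1r.
rewrite factS natrM -nat1r; field.
by rewrite !pnatr_eq0 -!lt0n fact_gt0 N0.
Unshelve. all: by end_near. Qed.

Lemma rgamma_nat n : rgamma n.+1%:R = (n`!%:R)^-1 :> C.
Proof.
have := rgammaDn 1 n; rewrite nat1r rgamma1.
have -> : \prod_(j < n) (1 + j%:R) = n`!%:R :> C.
  rewrite fact_prod natr_prod big_add1 /= big_mkord; apply: eq_bigr => j _.
  by rewrite nat1r.
by move=> /esym e; rewrite -[LHS](mulKf (_ : n`!%:R != 0)) ?e ?mulr1// pnatr_eq0 -lt0n fact_gt0.
Qed.

End Gamma.

(** * Locally uniform regularity of the reciprocal Gamma function *)

Section UniformContinuityOnBalls.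
Variable R : realType.
Local Notation C := (C R).
Implicit Types (s t : C) (f g : C -> C).

(** Uniform continuity on balls is what survives the locally uniform limit
    defining [rgamma]. *)
Definition ucball f := forall B : R, 0 < B ->
  (exists M : R, forall s, nrm s <= B -> nrm (f s) <= M) /\
  forall e : R, 0 < e -> exists2 d : R, 0 < d &
    forall s t, nrm s <= B -> nrm t <= B -> nrm (s - t) < d -> nrm (f s - f t) < e.

Lemma ucball_cst (a : C) : ucball (fun=> a).
Proof.
move=> B B0; split; first by exists (nrm a).
by move=> e e0; exists 1 => // s t _ _ _; rewrite subrr nrm0.
Qed.

Lemma ucball_id : ucball id.
Proof.
move=> B B0; split; first by exists B.
by move=> e e0; exists e.
Qed.

Lemma ucballD f g : ucball f -> ucball g -> ucball (fun s => f s + g s).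
Proof.
move=> uf ug B B0; have [[Mf hMf] hf] := uf B B0; have [[Mg hMg] hg] := ug B B0.
split.
  exists (Mf + Mg) => s sB; apply: le_trans (nrmD _ _) _.
  by rewrite lerD ?hMf ?hMg.
move=> e e0; have e2 : 0 < e / 2 by rewrite divr_gt0.
have [df df0 Hf] := hf _ e2; have [dg dg0 Hg] := hg _ e2.
exists (Num.min df dg); first by rewrite lt_min df0.
move=> s t sB tB; rewrite lt_min => /andP[d1 d2].
have -> : f s + g s - (f t + g t) = (f s - f t) + (g s - g t) by ring.
apply: le_lt_trans (nrmD _ _) _.
by have := Hf s t sB tB d1; have := Hg s t sB tB d2; lra.
Qed.

Lemma ucballM f g : ucball f -> ucball g -> ucball (fun s => f s * g s).
Proof.
move=> uf ug B B0; have [[Mf hMf] hf] := uf B B0; have [[Mg hMg] hg] := ug B B0.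
have Mf0 : 0 <= Mf by apply: le_trans (hMf 0 _); rewrite ?nrm_ge0 ?nrm0 ?ltW.
have Mg0 : 0 <= Mg by apply: le_trans (hMg 0 _); rewrite ?nrm_ge0 ?nrm0 ?ltW.
split.
  exists (Mf * Mg) => s sB.
  by rewrite nrmM ler_pM ?nrm_ge0 ?hMf ?hMg.
move=> e e0; pose a := e / (2 * (Mf + Mg + 1)).
have a0 : 0 < a by rewrite divr_gt0//; lra.
have [df df0 Hf] := hf _ a0; have [dg dg0 Hg] := hg _ a0.
exists (Num.min df dg); first by rewrite lt_min df0.
move=> s t sB tB; rewrite lt_min => /andP[d1 d2].
have -> : f s * g s - f t * g t = f s * (g s - g t) + (f s - f t) * g t by ring.
apply: le_lt_trans (nrmD _ _) _; rewrite !nrmM.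
have h1 : nrm (f s) * nrm (g s - g t) <= Mf * a.
  by rewrite ler_pM ?nrm_ge0 ?hMf// ltW// Hg.
have h2 : nrm (f s - f t) * nrm (g t) <= a * Mg.
  by rewrite ler_pM ?nrm_ge0 ?hMg// ltW// Hf.
have -> : e = a * (2 * (Mf + Mg + 1)) by rewrite /a divfK// gt_eqF//; lra.
nra.
Qed.

Lemma ucball_prod (I : Type) (r : seq I) (P : pred I) (F : I -> C -> C) :
  (forall i, ucball (F i)) -> ucball (fun s => \prod_(i <- r | P i) F i s).
Proof.
move=> uF; elim: r => [|i r IH].
  by under eq_fun do rewrite big_nil; exact: ucball_cst.
under eq_fun do rewrite big_cons.
by case: (P i) => //; apply: ucballM.
Qed.

Lemma ucball_cexp (a : C) : ucball (fun s => cexp (s * a)).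
Proof.
move=> B B0; pose D := expR (B * nrm a).
have D0 : 0 < D by exact: expR_gt0.
have hD s : nrm s <= B -> nrm (cexp (s * a)) <= D.
  move=> sB; apply: le_trans (nrm_cexp_le _) _; rewrite ler_expR nrmM.
  by rewrite ler_wpM2r ?nrm_ge0.
split; first by exists D.
move=> e e0; pose c := 3 * D * (nrm a + 1).
have a0 := nrm_ge0 a.
have c0 : 0 < c by rewrite !mulr_gt0//; lra.
exists (Num.min (1 / (2 * (nrm a + 1))) (e / c)).
  by rewrite lt_min !divr_gt0//; lra.
move=> s t sB tB; rewrite lt_min => /andP[d1 d2].
have h : nrm ((s - t) * a) <= nrm (s - t) * (nrm a + 1).
  by rewrite nrmM ler_wpM2l ?nrm_ge0//; lra.
have h1 : nrm ((s - t) * a) <= 1 / 2.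
  apply: le_trans h _; rewrite -ler_pdivlMr; last lra.
  by apply: le_trans (ltW d1) _; rewrite le_eqVlt; apply/orP; left; apply/eqP; field; lra.
have -> : cexp (s * a) - cexp (t * a) = cexp (t * a) * (cexp ((s - t) * a) - 1).
  by rewrite mulrBr mulr1 -cexpD; congr (cexp _ - _); ring.
rewrite nrmM; apply: (@le_lt_trans _ _ (D * (3 * (nrm (s - t) * (nrm a + 1))))).
  rewrite ler_pM ?nrm_ge0 ?hD//; apply: le_trans (cexpB1_le h1) _.
  by rewrite ler_wpM2l.
move: d2; rewrite ltr_pdivlMr// /c; lra.
Qed.

Lemma ucball_lim (F : nat -> C -> C) f : (forall n, ucball (F n)) ->
  (forall B : R, 0 < B -> forall e : R, 0 < e ->
     exists n, forall s, nrm s <= B -> nrm (f s - F n s) <= e) -> ucball f.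
Proof.
move=> uF lF B B0; split.
  have [n hn] := lF B B0 1 ltr01; have [[M hM] _] := uF n B B0.
  exists (1 + M) => s sB; rewrite -[f s](subrK (F n s)).
  by apply: le_trans (nrmD _ _) _; rewrite lerD ?hn ?hM.
move=> e e0; have e4 : 0 < e / 4 by rewrite divr_gt0.
have [n hn] := lF B B0 _ e4; have [_ /(_ _ e4)[d d0 hd]] := uF n B B0.
exists d => // s t sB tB st.
have -> : f s - f t = (f s - F n s) + (F n s - F n t) - (f t - F n t) by ring.
apply: le_lt_trans (nrmB _ _) _.
have := nrmD (f s - F n s) (F n s - F n t).
by have := hn s sB; have := hn t tB; have := hd s t sB tB st; lra.
Qed.

Lemma ucball_cvg f (T : Type) (F : set_system T) {FF : Filter F} (u : T -> C) l :
  ucball f -> u x @[x --> F] --> l -> f (u x) @[x --> F] --> f l.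
Proof.
move=> uf ul; apply/cvgCP => e e0.
have B0 : 0 < nrm l + 1 by have := nrm_ge0 l; lra.
have [_ /(_ e e0)[d d0 hd]] := uf _ B0.
have d1 : 0 < Num.min d 1 by rewrite lt_min d0 ltr01.
move/cvgCP : ul => /(_ _ d1); apply: filterS => x; rewrite lt_min => /andP[h1 h2].
apply: hd => //; last lra.
have := nrm_triB (u x) l; lra.
Qed.

Lemma ucball_rgamma_approx N : ucball (fun s => rgamma_approx s N).
Proof.
have -> : (fun s => rgamma_approx s N) = fun s : C => (\prod_(j < N.+1) (s + j%:R)) *
    ((N`!%:R)^-1 * cexp (s * - cR (ln N%:R))).
  by apply/funext => s; rewrite /rgamma_approx invfM mulrN cexpN.
apply: ucballM; last by apply: ucballM; [exact: ucball_cst|exact: ucball_cexp].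
apply: (@ucball_prod _ _ _ (fun (j : 'I_N.+1) s => s + j%:R)) => j.
by apply: ucballD; [exact: ucball_id|exact: ucball_cst].
Qed.

(** All late approximants share one bound [D] on a ball, which converts the relative error into a
    uniform absolute one. *)
Lemma ucball_rgamma : ucball (@rgamma R).
Proof.
apply: (ucball_lim ucball_rgamma_approx) => B B0 e e0.
have [N1 h1] := rgamma_tail_small (ltW B0) (ltr0Sn R 0 : 0 < 1).
have [K [N0 [K0 N00 h]]] := rgamma_approx_rel (ltW B0).
have [[M hM] _] := ucball_rgamma_approx (maxn N0 N1) B0.
have M0 : 0 <= M by apply: le_trans (hM 0 _); rewrite ?nrm_ge0 ?nrm0 ?ltW.
pose D := M * expR (K / (maxn N0 N1)%:R).
have D0 : 0 <= D by rewrite mulr_ge0// expR_ge0.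
have bD s N : nrm s <= B -> (maxn N0 N1 <= N)%N -> nrm (rgamma_approx s N) <= D.
  move=> sB NN; have := h s _ _ sB (leq_maxl N0 N1) NN.
  have := nrm_triB (rgamma_approx s N) (rgamma_approx s (maxn N0 N1)).
  have := ler_wpM2r (expR_ge0 (K / (maxn N0 N1)%:R)) (hM s sB); rewrite /D; lra.
have [|N2 h2] := rgamma_tail_small (ltW B0) (e := e / (D + 1)).
  by rewrite divr_gt0//; lra.
exists (maxn N2 (maxn N0 N1)) => s sB.
apply: le_trans (h2 _ _ sB (leq_maxl _ _)) _.
rewrite mulrA ler_pdivrMr; last lra.
by have := bD s _ sB (leq_maxr N2 (maxn N0 N1)); nra.
Qed.

End UniformContinuityOnBalls.

(** * Integrals of complex-valued functions *)

Section ComplexCurves.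
Variable R : realType.
Local Notation C := (C R).
Local Notation mu := (@lebesgue_measure R).
Implicit Types (f g h : R -> C) (a b t : R).

(** Taken componentwise so that the real fundamental theorem of calculus applies to each part of a
    complex-valued curve. *)
Definition is_cder g t (d : C) :=
  is_derive t 1 (fun x => cRe (g x)) (cRe d) /\
  is_derive t 1 (fun x => cIm (g x)) (cIm d).

Lemma is_cder_cst (z : C) t : is_cder (fun=> z) t 0.
Proof. by split; exact: is_derive_cst. Qed.

Lemma is_cder_eq g t (d d' : C) : d = d' -> is_cder g t d -> is_cder g t d'.
Proof. by move=> ->. Qed.

Lemma is_cderD f g t (d e : C) :
  is_cder f t d -> is_cder g t e -> is_cder (fun x => f x + g x) t (d + e).
Proof.
move=> [f1 f2] [g1 g2]; split.
  by under eq_fun do rewrite cReD; rewrite cReD; exact: is_deriveD.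
by under eq_fun do rewrite cImD; rewrite cImD; exact: is_deriveD.
Qed.

Lemma is_cderN f t (d : C) : is_cder f t d -> is_cder (fun x => - f x) t (- d).
Proof.
move=> [f1 f2]; split.
  by under eq_fun do rewrite cReN; rewrite cReN; exact: is_deriveN.
by under eq_fun do rewrite cImN; rewrite cImN; exact: is_deriveN.
Qed.

Lemma is_cderM f g t (d e : C) : is_cder f t d -> is_cder g t e ->
  is_cder (fun x => f x * g x) t (d * g t + f t * e).
Proof.
move=> [f1 f2] [g1 g2]; split.
  under eq_fun do rewrite cReM.
  apply: is_derive_eq; rewrite !cReD !cReM /GRing.scale /=; ring.
under eq_fun do rewrite cImM.
apply: is_derive_eq; rewrite !cImD !cImM /GRing.scale /=; ring.
Qed.

Lemma is_cderZ (z : C) f t (d : C) : is_cder f t d -> is_cder (fun x => z * f x) t (z * d).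
Proof.
move=> df; apply: is_cder_eq (is_cderM (is_cder_cst z t) df).
by rewrite mul0r add0r.
Qed.

Lemma is_cderX f n t (d : C) : is_cder f t d ->
  is_cder (fun x => f x ^+ n.+1) t (n.+1%:R * f t ^+ n * d).
Proof.
move=> df; elim: n => [|n IH].
  by under eq_fun do rewrite expr1; rewrite expr0 !mul1r.
under eq_fun do rewrite exprS.
apply: is_cder_eq (is_cderM df IH).
by rewrite -[in RHS]natr1 exprS; ring.
Qed.

Lemma is_cder_cR (u : R -> R) t (d : R) : is_derive t 1 u d ->
  is_cder (fun x => cR (u x)) t (cR d).
Proof. by split => //; exact: is_derive_cst. Qed.

Lemma is_cder_id t : is_cder (@cR R) t 1.
Proof. by apply: is_cder_cR. Qed.

Lemma is_cder_cexp f t (d : C) : is_cder f t d ->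
  is_cder (fun x => cexp (f x)) t (d * cexp (f t)).
Proof.
move=> [f1 f2].
have e1 := is_derive1_comp (is_derive_expR (cRe (f t))) f1.
have e2 := is_derive1_comp (is_derive_sin (cIm (f t))) f2.
have e3 := is_derive1_comp (is_derive_cos (cIm (f t))) f2.
split.
  apply: (@is_derive_eq _ _ _ (fun x => (expR \o (fun x => cRe (f x))) x *
    (cos \o (fun x => cIm (f x))) x)).
  by rewrite cReM cRe_cexp cIm_cexp /GRing.scale /=; ring.
apply: (@is_derive_eq _ _ _ (fun x => (expR \o (fun x => cRe (f x))) x *
  (sin \o (fun x => cIm (f x))) x)).
by rewrite cImM cRe_cexp cIm_cexp /GRing.scale /=; ring.
Qed.

Lemma is_cder_continuous f t (d : C) : is_cder f t d -> {for t, continuous f}.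
Proof.
move=> [[d1 _] [d2 _]]; apply: cvg_reim.
  exact/(@differentiable_continuous _ _ _ t (fun x => cRe (f x)))/derivable1_diffP.
exact/(@differentiable_continuous _ _ _ t (fun x => cIm (f x)))/derivable1_diffP.
Qed.

Lemma continuous_cRe g : continuous g -> continuous (fun t => cRe (g t)).
Proof. by move=> cg t; apply: cvg_cRe; exact: cg. Qed.
Lemma continuous_cIm g : continuous g -> continuous (fun t => cIm (g t)).
Proof. by move=> cg t; apply: cvg_cIm; exact: cg. Qed.

Lemma ccont_cst (z : C) : continuous (fun _ : R => z).
Proof. by move=> t; exact: cvg_cst. Qed.
Arguments ccont_cst z : clear implicits.
Lemma ccontD f g : continuous f -> continuous g -> continuous (fun t => f t + g t).
Proof. by move=> cf cg t; apply: cvgD; [exact: cf|exact: cg]. Qed.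
Lemma ccontM f g : continuous f -> continuous g -> continuous (fun t => f t * g t).
Proof. by move=> cf cg t; apply: cvgM; [exact: cf|exact: cg]. Qed.
Lemma ccontZ (z : C) f : continuous f -> continuous (fun t => z * f t).
Proof. by move=> cf; exact: (ccontM (ccont_cst z) cf). Qed.
Arguments ccontZ z [f] cf : rename.
Lemma ccontN f : continuous f -> continuous (fun t => - f t).
Proof. by move=> cf t; apply: cvgN; exact: cf. Qed.
Lemma ccontB f g : continuous f -> continuous g -> continuous (fun t => f t - g t).
Proof. by move=> cf cg; exact: (ccontD cf (ccontN cg)). Qed.
Lemma ccontX f n : continuous f -> continuous (fun t => f t ^+ n).
Proof.
move=> cf; elim: n => [|n IH]; first by under eq_fun do rewrite expr0; exact: ccont_cst.
by under eq_fun do rewrite exprS; exact: ccontM.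
Qed.
Lemma ccontV f : (forall t, f t != 0) -> continuous f -> continuous (fun t => (f t)^-1).
Proof. by move=> f0 cf t; apply: cvgV => //; exact: cf. Qed.
Lemma ccont_prod (I : Type) (r : seq I) (P : pred I) (F : I -> R -> C) :
  (forall i, continuous (F i)) -> continuous (fun t => \prod_(i <- r | P i) F i t).
Proof.
move=> cF; elim: r => [|i r IH].
  by under eq_fun do rewrite big_nil; exact: ccont_cst.
under eq_fun do rewrite big_cons.
by case: (P i); [exact: (ccontM (cF i) IH)|exact: IH].
Qed.
Lemma ccont_sum (I : Type) (r : seq I) (P : pred I) (F : I -> R -> C) :
  (forall i, continuous (F i)) -> continuous (fun t => \sum_(i <- r | P i) F i t).
Proof.
move=> cF; elim: r => [|i r IH].
  by under eq_fun do rewrite big_nil; exact: ccont_cst.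
under eq_fun do rewrite big_cons.
by case: (P i); [exact: (ccontD (cF i) IH)|exact: IH].
Qed.
Lemma ccont_ucball (phi : C -> C) f :
  ucball phi -> continuous f -> continuous (fun t => phi (f t)).
Proof. by move=> uphi cf t; apply: ucball_cvg uphi _; exact: cf. Qed.
Lemma ccont_cR (u : R -> R) : continuous u -> continuous (fun t => cR (u t) : C).
Proof. by move=> cu t; apply: cvg_cR; exact: cu. Qed.
Lemma ccont_cexp f : continuous f -> continuous (fun t => cexp (f t)).
Proof.
move=> cf; have := ccont_ucball (ucball_cexp (1 : C)) cf.
by under eq_fun do rewrite mulr1.
Qed.

Definition cint a b g : C :=
  Complex (Rintegral mu `[a, b] (fun t => cRe (g t)))
          (Rintegral mu `[a, b] (fun t => cIm (g t))).

Lemma continuous_integrable_itv (u : R -> R) a b : continuous u ->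
  mu.-integrable `[a, b] (EFin \o u).
Proof.
move=> cu; apply: continuous_compact_integrable; first exact: segment_compact.
exact: continuous_subspaceT.
Qed.
Local Hint Resolve continuous_cRe continuous_cIm continuous_integrable_itv : core.

Lemma cint_FTC f g a b : a < b -> (forall t, is_cder f t (g t)) -> continuous g ->
  cint a b g = f b - f a.
Proof.
move=> ab df cg.
have FTC (F u : R -> R) : (forall t, is_derive t 1 F (u t)) -> continuous u ->
    Rintegral mu `[a, b] u = F b - F a.
  move=> dF cu; rewrite /Rintegral (@continuous_FTC2 _ u F)//.
  - exact: continuous_subspaceT.
  - have cF t : {for t, continuous F}.
      by apply/differentiable_continuous/derivable1_diffP; case: (dF t).
    split; first by move=> x _; case: (dF x).
      by apply: cvg_at_right_filter; exact: cF.
    by apply: cvg_at_left_filter; exact: cF.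
  - by move=> x _; rewrite derive1E; case: (dF x).
have e1 := FTC _ _ (fun t => (df t).1) (continuous_cRe cg).
have e2 := FTC _ _ (fun t => (df t).2) (continuous_cIm cg).
by rewrite /cint e1 e2; apply: complex_ext; rewrite ?cReB ?cImB.
Qed.

Lemma cintD a b f g : continuous f -> continuous g ->
  cint a b (fun t => f t + g t) = cint a b f + cint a b g.
Proof.
move=> cf cg; apply: complex_ext; rewrite ?cReD ?cImD /=.
  by under eq_Rintegral do rewrite cReD; rewrite RintegralD//; auto.
by under eq_Rintegral do rewrite cImD; rewrite RintegralD//; auto.
Qed.

Lemma cintZ a b (z : C) f : continuous f ->
  cint a b (fun t => z * f t) = z * cint a b f.
Proof.
move=> cf.
have cZ (x : R) (u : R -> R) : continuous u -> continuous (fun t => x * u t).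
  by move=> cu t; apply: cvgM; [exact: cvg_cst|exact: cu].
apply: complex_ext; rewrite ?cReM ?cImM /=.
  under eq_Rintegral do rewrite cReM.
  rewrite RintegralB ?RintegralZl//; auto.
under eq_Rintegral do rewrite cImM.
rewrite RintegralD ?RintegralZl//; auto.
Qed.

Lemma cintB a b f g : continuous f -> continuous g ->
  cint a b (fun t => f t - g t) = cint a b f - cint a b g.
Proof.
move=> cf cg.
have -> : (fun t => f t - g t) = (fun t => f t + (-1) * g t).
  by apply/funext => t; rewrite mulN1r.
rewrite (cintD _ _ cf (ccontZ (-1) cg)) (cintZ _ _ (-1) cg).
by rewrite mulN1r.
Qed.

Lemma cint_sum a b (I : Type) (r : seq I) (F : I -> R -> C) :
  (forall i, continuous (F i)) ->
  cint a b (fun t => \sum_(i <- r) F i t) = \sum_(i <- r) cint a b (F i).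
Proof.
move=> cF.
have cS (s : seq I) : continuous (fun t => \sum_(i <- s) F i t) by exact: ccont_sum.
elim: r => [|i r IH].
  under eq_fun do rewrite big_nil.
  by rewrite big_nil; apply: complex_ext; rewrite /= /Rintegral integral0.
under eq_fun do rewrite big_cons.
by rewrite cintD// big_cons IH.
Qed.

(** Real and imaginary integrals are bounded separately, hence the factor 2; it recurs below and is
    harmless. *)
Lemma nrm_cint_le_int a b f (u : R -> R) : continuous f -> continuous u ->
  (forall t, a <= t <= b -> nrm (f t) <= u t) ->
  nrm (cint a b f) <= 2 * Rintegral mu `[a, b] u.
Proof.
move=> cf cu fu.
have H (v : R -> R) : continuous v -> (forall t, `|v t| <= nrm (f t)) ->
    `|Rintegral mu `[a, b] v| <= Rintegral mu `[a, b] u.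
  move=> cv vf; apply: le_trans (le_normr_Rintegral _ _) _ => //; first by auto.
  apply: le_Rintegral => //.
  - by apply: continuous_integrable_itv => t; apply: cvg_norm; exact: cv.
  - by auto.
  - by move=> t /=; rewrite in_itv /= => tab; apply: le_trans (vf t) (fu _ tab).
apply: le_trans (nrm_le_reim _) _; rewrite mulr_natl mulr2n; apply: lerD.
  by apply: H => [|t]; [exact: continuous_cRe|exact: re_le_nrm].
by apply: H => [|t]; [exact: continuous_cIm|exact: im_le_nrm].
Qed.

Lemma nrm_cint_le a b f (M : R) : a <= b -> continuous f ->
  (forall t, a <= t <= b -> nrm (f t) <= M) -> nrm (cint a b f) <= 2 * (M * (b - a)).
Proof.
move=> ab cf fM.
have cM : continuous (fun _ : R => M) by move=> t; exact: cvg_cst.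
apply: le_trans (nrm_cint_le_int cf cM fM) _.
rewrite Rintegral_cst//= lebesgue_measure_itv /= lte_fin.
case: ltP => //= ba; rewrite ?mulr0.
have -> : b - a = 0 by apply/eqP; rewrite subr_eq0 eq_le ba ab.
by rewrite mulr0.
Qed.

End ComplexCurves.

(** * Euler's sine product and the reflection formula *)

Section SineProduct.
Variable R : realType.
Local Notation C := (C R).
Local Notation mu := (@lebesgue_measure R).
Implicit Types (s z w : C) (x : R).

Definition ccos z : C := (cexp (cI R * z) + cexp (- (cI R * z))) / 2.

Let cI2' : cI R * cI R = -1. Proof. by rewrite -expr2 cI2. Qed.
Lemma csin0 : csin 0 = 0 :> C.
Proof. by rewrite /csin mulr0 oppr0 subrr mul0r. Qed.
Lemma ccos0 : ccos 0 = 1.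
Proof. by rewrite /ccos mulr0 oppr0 cexp0 divff. Qed.

Lemma csinDpi z : csin (z + cR pi) = - csin z.
Proof.
have epi : cexp (cI R * cR pi) = -1.
  apply: complex_ext; rewrite ?cRe_cexp ?cIm_cexp cReM cImM cRe_cI cIm_cI /=.
    by rewrite !(mul0r, mul1r, mulr0) subr0 expR0 add0r cospi mul1r.
  by rewrite !(mul0r, mul1r, mulr0) subr0 expR0 add0r sinpi mul1r oppr0.
rewrite /csin mulrDr opprD !cexpD (cexpN (cI R * cR pi)) epi invrN1.
by field; rewrite cI_neq0.
Qed.

Lemma csinDpin z (n : nat) : csin (z + cR pi * n%:R) = (-1) ^+ n * csin z.
Proof.
elim: n => [|n IH]; first by rewrite mulr0 addr0 mul1r.
by rewrite -natr1 mulrDr mulr1 addrA csinDpi IH exprS; ring.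
Qed.

Lemma csinDpiz z (k : int) : csin (z + cR pi * k%:~R) = (-1) ^ k * csin z.
Proof.
case: k => n; first by rewrite -pmulrn csinDpin.
rewrite NegzE -exprnN mulrNz -pmulrn; apply: (@mulfI _ ((-1) ^+ n.+1)).
  by rewrite expf_neq0// oppr_eq0 oner_eq0.
rewrite -csinDpin mulrN addrNK mulrA divff ?mul1r//.
by rewrite expf_neq0// oppr_eq0 oner_eq0.
Qed.

Lemma nrm_ccosB1 z : nrm (ccos z - 1) <= 4 * (expR (nrm z) + 1) * nrm z ^+ 2.
Proof.
have n2 : nrm 2 = 2 :> R by rewrite nrm_nat.
have nI : nrm (cI R * z) = nrm z by rewrite nrmM nrm_cI mul1r.
have z0 := nrm_ge0 z; have e0 := expR_ge0 (nrm z).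
have [h|h] := lerP (nrm z) (1 / 2).
  have -> : ccos z - 1 = ((cexp (cI R * z) - 1 - cI R * z) +
      (cexp (- (cI R * z)) - 1 - - (cI R * z))) / 2 by rewrite /ccos; field.
  rewrite nrmf_div n2 ler_pdivrMr//.
  have h1 := @cexp_taylor1 R (cI R * z); have h2 := @cexp_taylor1 R (- (cI R * z)).
  rewrite nI in h1; rewrite nrmN nI in h2.
  apply: le_trans (nrmD _ _) _; have := h1 h; have := h2 h; have := sqr_ge0 (nrm z).
  nra.
apply: (@le_trans _ _ (expR (nrm z) + 1)); last first.
  have : 1 <= 4 * nrm z ^+ 2 by nra.
  by nra.
apply: le_trans (nrmB _ _) _; rewrite nrm1 lerD2r /ccos nrmf_div n2 ler_pdivrMr//.
apply: le_trans (nrmD _ _) _.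
have := nrm_cexp_le (cI R * z); have := nrm_cexp_le (- (cI R * z)).
by rewrite nrmN nI; lra.
Qed.

Let lin s x : C := 2 * s * cR x.
Let is_cder_lin s x : is_cder (lin s) x (2 * s).
Proof.
apply: is_cder_eq (is_cderZ _ (is_cder_id x)); by rewrite mulr1.
Qed.

Let is_cder_ccos_lin s x :
  is_cder (fun x => ccos (lin s x)) x (- (2 * s) * csin (lin s x)).
Proof.
have h1 := is_cderZ (cI R) (is_cder_lin s x).
have h := is_cderZ (2^-1) (is_cderD (is_cder_cexp h1) (is_cder_cexp (is_cderN h1))).
have -> : (fun x => ccos (lin s x)) = (fun x => 2^-1 *
    (cexp (cI R * lin s x) + cexp (- (cI R * lin s x)))).
  by apply/funext => y; rewrite /ccos mulrC.
apply: is_cder_eq h; rewrite /csin.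
have e : - (2 * s) = (cI R * cI R) * (2 * s) by rewrite cI2'; ring.
by rewrite e; field; rewrite cI_neq0.
Qed.

Let is_cder_csin_lin s x :
  is_cder (fun x => csin (lin s x)) x ((2 * s) * ccos (lin s x)).
Proof.
have h1 := is_cderZ (cI R) (is_cder_lin s x).
have h := is_cderZ ((2 * cI R)^-1) (is_cderD (is_cder_cexp h1)
  (is_cderN (is_cder_cexp (is_cderN h1)))).
have -> : (fun x => csin (lin s x)) = (fun x => (2 * cI R)^-1 *
    (cexp (cI R * lin s x) - cexp (- (cI R * lin s x)))).
  by apply/funext => y; rewrite /csin mulrC.
apply: is_cder_eq h; rewrite /ccos; field.
by rewrite cI_neq0.
Qed.

Let is_cder_cos x : is_cder (fun x => cR (cos x) : C) x (- cR (sin x)).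
Proof. by rewrite -cRN; apply: is_cder_cR. Qed.
Let is_cder_sin x : is_cder (fun x => cR (sin x) : C) x (cR (cos x)).
Proof. exact: is_cder_cR. Qed.

Let ccont_cos : continuous (fun x => cR (cos x) : C).
Proof. exact: ccont_cR (@continuous_cos R). Qed.
Let ccont_ccos_lin s : continuous (fun x => ccos (lin s x)).
Proof. by move=> x; apply: is_cder_continuous (is_cder_ccos_lin s x). Qed.

(** Integrating twice by parts gives [cos_momentSS], a two-step recursion whose
    factors [1 - s^2/k^2] are those of the sine product. *)
Definition cos_moment (n : nat) s : C :=
  cint 0 (pi / 2) (fun x => cR (cos x) ^+ n * ccos (2 * s * cR x)).

Let ccont_integrand n s : continuous (fun x => cR (cos x) ^+ n * ccos (2 * s * cR x)).
Proof. by apply: ccontM; [apply: ccontX; exact: ccont_cos|exact: (ccont_ccos_lin (s:=s))]. Qed.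

Let pihalf_gt0 : (0 : R) < pi / 2. Proof. by rewrite divr_gt0 ?pi_gt0. Qed.

Lemma cos_moment0 s : 2 * s * cos_moment 0 s = csin (cR pi * s).
Proof.
rewrite /cos_moment -cintZ; last exact: ccont_integrand.
have -> : (fun t => 2 * s * (cR (cos t) ^+ 0 * ccos (2 * s * cR t))) =
    (fun t => 2 * s * ccos (lin s t)).
  by apply/funext => t; rewrite expr0 mul1r.
rewrite (cint_FTC pihalf_gt0 (is_cder_csin_lin s)) /lin; last first.
  exact: ccontZ (ccont_ccos_lin (s:=s)).
rewrite cR0 mulr0 csin0 subr0; congr (csin _).
by rewrite cRM cRV cR_nat; field.
Qed.

Lemma cos_momentSS n s :
  (n.+2%:R ^+ 2 - 4 * s ^+ 2) * cos_moment n.+2 s = n.+2%:R * n.+1%:R * cos_moment n s.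
Proof.
pose c x : C := cR (cos x). pose S x : C := cR (sin x).
pose E x := n.+2%:R * (c x ^+ n.+1 * (S x * ccos (lin s x))) -
            2 * s * (c x ^+ n.+2 * csin (lin s x)).
pose F x : C := (n.+2%:R ^+ 2 - 4 * s ^+ 2) * (c x ^+ n.+2 * ccos (lin s x)) -
  n.+2%:R * n.+1%:R * (c x ^+ n * ccos (lin s x)).
have dE x : is_cder E x (F x).
  have h1 := is_cderZ (n.+2%:R) (is_cderM (is_cderX n (is_cder_cos x))
    (is_cderM (is_cder_sin x) (is_cder_ccos_lin s x))).
  have h2 := is_cderZ (2 * s) (is_cderM (is_cderX n.+1 (is_cder_cos x))
     (is_cder_csin_lin s x)).
  apply: is_cder_eq (is_cderD h1 (is_cderN h2)).
  have S2 : S x * S x = 1 - c x * c x.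
    by rewrite /S /c -!cRM -cR1 -cRB -!expr2 sin2cos2.
  rewrite /F -/(c x) -/(S x) [c x ^+ n.+2]exprS [c x ^+ n.+1]exprS.
  rewrite -[n.+2%:R]natr1 -[n.+1%:R]natr1.
  move: (c x) (S x) S2 (ccos _) (csin _) => q r S2 a b; move: (q ^+ n) => p.
  have -> : (n%:R + 1 + 1) ^+ 2 - 4 * s ^+ 2 = (n%:R + 1 + 1) ^+ 2 - (2 * s) ^+ 2 :> C.
    by ring.
  transitivity (- ((n%:R + 1 + 1) * (n%:R + 1) * p * a * (r * r)) +
     (n%:R + 1 + 1) * (q * q * p) * a - (2 * s) ^+ 2 * (q * q * p) * a); first by ring.
  by rewrite S2; ring.
have cF : continuous F.
  by apply: ccontB; apply: ccontZ; exact: ccont_integrand.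
have := cint_FTC pihalf_gt0 dE cF.
have -> : E (pi / 2) - E 0 = 0.
  rewrite /E /c /S cos_pihalf sin0 /lin cR0 mulr0 csin0 !exprS.
  by rewrite !(mul0r, mulr0) !subrr.
rewrite /F cintB; last 2 first.
- by apply: ccontZ; exact: ccont_integrand.
- by apply: ccontZ; exact: ccont_integrand.
rewrite !cintZ; last 2 first.
- exact: ccont_integrand.
- exact: ccont_integrand.
by move/eqP; rewrite subr_eq0 => /eqP.
Qed.

Definition cos_momentR (n : nat) : R := Rintegral mu `[0, pi / 2] (fun x => cos x ^+ n).

Lemma cos_moment_at0 n : cos_moment n 0 = cR (cos_momentR n).
Proof.
have -> : cos_moment n 0 = cint 0 (pi / 2) (fun x => cR (cos x ^+ n)).
  by congr cint; apply/funext => x; rewrite mulr0 mul0r ccos0 mulr1 cRX.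
by apply: complex_ext; rewrite //= /Rintegral integral0.
Qed.

Lemma cos_momentR0 : cos_momentR 0 = pi / 2.
Proof.
rewrite /cos_momentR; under eq_Rintegral do rewrite expr0.
rewrite Rintegral_cst//= lebesgue_measure_itv /= lte_fin pihalf_gt0 /=.
by rewrite subr0 mul1r.
Qed.

Lemma cos_momentRSS n : n.+2%:R * cos_momentR n.+2 = n.+1%:R * cos_momentR n.
Proof.
have := cos_momentSS n 0; rewrite expr0n mulr0 subr0 !cos_moment_at0.
rewrite -!(cR_nat R) -!cRX -!cRM => /cR_inj /eqP.
by rewrite expr2 -!mulrA (inj_eq (mulfI _)) ?pnatr_eq0// => /eqP.
Qed.

Lemma cos_momentR_even_gt0 n : 0 < cos_momentR n.*2.
Proof.
elim: n => [|n IH]; first by rewrite cos_momentR0 pihalf_gt0.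
rewrite doubleS -(pmulr_rgt0 _ (_ : 0 < n.*2.+2%:R :> R)) ?ltr0n//.
by rewrite cos_momentRSS mulr_gt0.
Qed.

(** This trades the factor x^2 of the Taylor bound for sin^2: x^2 cos^(N+2) <= sin^2 cos^N = cos^N -
    cos^(N+2), a difference of two moment integrands. *)
Lemma xcos_le_sin x : 0 <= x <= pi / 2 -> x * cos x <= sin x.
Proof.
move=> /andP[x0 xpi].
have dF y : y \in `]0, x[%R -> is_derive y 1 (fun y => sin y - y * cos y) (y * sin y).
  by move=> _; apply: is_derive_eq; rewrite /GRing.scale /=; ring.
have [|c cx] := MVT_segment x0 dF.
  apply: continuous_subspaceT => y; apply: cvgB; first exact: continuous_sin.
  by apply: cvgM; [exact: cvg_id|exact: continuous_cos].
rewrite sin0 mul0r !subr0 => e; rewrite -subr_ge0 e.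
move: cx; rewrite in_itv /= => /andP[c0 cx]; rewrite !mulr_ge0//.
apply: sin_ge0_pi; rewrite c0 (le_trans cx)// (le_trans xpi)//.
by have := pi_ge0 R; lra.
Qed.

(** cos^(2N) concentrates at 0, where [ccos (2 * s * cR x)] is 1. The rate comes from W_(2N) -
    W_(2N+2) = W_(2N+2)/(2N+1), W being the moments [cos_momentR]. *)
Lemma cos_moment_ratio_cvg s :
  cos_moment N.*2 s / cR (cos_momentR N.*2) @[N --> \oo] --> (1 : C).
Proof.
pose D : R := 4 * (expR (nrm (2 * s) * (pi / 2)) + 1) * nrm (2 * s) ^+ 2.
have D0 : 0 <= D by rewrite !mulr_ge0 ?exprn_ge0 ?nrm_ge0 ?addr_ge0 ?expR_ge0.
have step N : (0 < N)%N ->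
    nrm (cos_moment N.*2 s / cR (cos_momentR N.*2) - 1) <= (2 * D) * N%:R^-1.
  case: N => // N _; set W := cos_momentR _.
  have W0 : 0 < W := cos_momentR_even_gt0 N.+1.
  have -> : cos_moment N.+1.*2 s / cR W - 1 =
      (cos_moment N.+1.*2 s - cos_moment N.+1.*2 0) / cR W.
    by rewrite cos_moment_at0 -/W mulrBl divff// cR_eq0 gt_eqF.
  rewrite nrmf_div nrm_cR gtr0_norm// ler_pdivrMr//.
  rewrite /cos_moment -cintB; try exact: ccont_integrand.
  pose u x := D * (cos x ^+ N.*2 - cos x ^+ N.*2.+2).
  have cosX k : continuous (fun x : R => cos x ^+ k).
    elim: k => [|k IH] x.
      by under eq_fun do rewrite expr0; exact: cvg_cst.
    by under eq_fun do rewrite exprS; apply: cvgM; [exact: continuous_cos|exact: IH].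
  have cu : continuous u.
    move=> x; apply: cvgM; first exact: cvg_cst.
    by apply: cvgB; exact: cosX.
  apply: le_trans (nrm_cint_le_int _ cu _) _.
  - exact: (ccontB (ccont_integrand (n:=N.+1.*2) (s:=s)) (ccont_integrand (n:=N.+1.*2) (s:=0))).
  - move=> x /andP[x0 xpi].
    rewrite mulr0 mul0r ccos0 mulr1 -[X in _ - X]mulr1 -mulrBr nrmM nrmX nrm_cR.
    have c0 : 0 <= cos x by apply: cos_ge0_pihalf; rewrite xpi andbT; lra.
    rewrite ger0_norm// /u doubleS.
    have h1 : nrm (ccos (2 * s * cR x) - 1) <= D * x ^+ 2.
      apply: le_trans (nrm_ccosB1 _) _; rewrite nrmM nrm_cR ger0_norm// exprMn mulrA.
      rewrite ler_wpM2r ?sqr_ge0// /D ler_wpM2r ?sqr_ge0// ler_wpM2l// lerD2r ler_expR.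
      by rewrite ler_wpM2l ?nrm_ge0.
    apply: le_trans (ler_wpM2l (exprn_ge0 _ c0) h1) _.
    rewrite mulrCA ler_wpM2l// !exprS mulrA.
    have -> : cos x ^+ N.*2 - cos x * cos x * cos x ^+ N.*2 =
        sin x ^+ 2 * cos x ^+ N.*2 by rewrite sin2cos2; ring.
    have h2 : (x * cos x) ^+ 2 <= sin x ^+ 2.
      have h3 := xcos_le_sin (_ : 0 <= x <= pi / 2).
      rewrite lerXn2r ?nnegrE ?mulr_ge0//; last by apply: h3; rewrite x0.
      by apply: sin_ge0_pi; rewrite x0 (le_trans xpi)//; have := pi_ge0 R; lra.
    have := ler_wpM2r (exprn_ge0 N.*2 c0) h2; apply: le_trans.
    by rewrite exprMn; lra.
  rewrite /u RintegralZl//; last first.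
    by apply: continuous_integrable_itv => x; apply: cvgB; exact: cosX.
  rewrite RintegralB//; try exact: (continuous_integrable_itv _ _ (cosX _)).
  rewrite -/(cos_momentR N.*2) -/(cos_momentR N.*2.+2) -doubleS -/W.
  have e := cos_momentRSS N.*2; rewrite -doubleS -/W in e.
  have k0 : (0 : R) < N.*2.+1%:R by rewrite ltr0n.
  have -> : cos_momentR N.*2 - W = W / N.*2.+1%:R.
    apply: (@mulfI _ N.*2.+1%:R); first by rewrite gt_eqF.
    by rewrite mulrBr -e doubleS -[N.*2.+2%:R]natr1; field; rewrite gt_eqF// ltr_wpDl.
  have -> : 2 * (D * (W / N.*2.+1%:R)) = 2 * D / N.*2.+1%:R * W by ring.
  rewrite ler_wpM2r ?(ltW W0)//.
  apply: ler_wpM2l; first by rewrite mulr_ge0.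
  rewrite lef_pV2 ?posrE ?ltr0n// ler_nat.
  by rewrite -addnn ltnS leq_addr.
apply: (@cvgC_le _ _ _ _ _ _ (fun N => (2 * D) * N%:R^-1)).
  by near=> N; apply: step; near: N; exact: nbhs_infty_gt.
rewrite -[X in _ --> X](mulr0 (2 * D)); apply: cvgM; first exact: cvg_cst.
exact: cvg_invn.
Unshelve. all: by end_near. Qed.

(** The identity is exact for every [N]: the moment ratio is the tail of the sine product, and one
    step of the recursion splits off one more factor. *)
Lemma csin_product s N :
  csin (cR pi * s) / cR pi =
  s * (\prod_(j < N) (1 - s ^+ 2 / j.+1%:R ^+ 2)) *
  (cos_moment N.*2 s / cR (cos_momentR N.*2)).
Proof.
have pi0 : cR pi != 0 :> C by rewrite cR_eq0 gt_eqF// pi_gt0.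
elim: N => [|N ->].
  rewrite big_ord0 -cos_moment0 cos_momentR0 cRM cRV cR_nat.
  by move: (cR pi) pi0 => p p0; field.
rewrite big_ord_recr /= -!mulrA; congr (_ * (_ * _)).
have W0 := cos_momentR_even_gt0 N; have W1 := cos_momentR_even_gt0 N.+1.
have e1 := cos_momentSS N.*2 s; have e2 := cos_momentRSS N.*2.
rewrite -doubleS in e1 e2.
have e3 : cR N.*2.+1%:R * cR (cos_momentR N.*2) = cR N.*2.+2%:R * cR (cos_momentR N.+1.*2) :> C.
  by rewrite -!cRM -doubleS e2.
rewrite !cR_nat in e3.
have n1 : N.*2.+1%:R != 0 :> C by rewrite pnatr_eq0.
have n2 : N.*2.+2%:R != 0 :> C by rewrite pnatr_eq0.
have n3 : N.+1%:R != 0 :> C by rewrite pnatr_eq0.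
have -> : cos_moment N.*2 s = (N.*2.+2%:R ^+ 2 - 4 * s ^+ 2) * cos_moment N.+1.*2 s
    / (N.*2.+2%:R * N.*2.+1%:R).
  by rewrite doubleS e1 doubleS mulrC mulKf// mulf_neq0.
have -> : cR (cos_momentR N.*2) = N.*2.+2%:R * cR (cos_momentR N.+1.*2) / N.*2.+1%:R :> C.
  by rewrite -e3 mulrC mulKf.
have -> : N.*2.+2%:R = 2 * N.+1%:R :> C by rewrite -doubleS -natrM mul2n.
have w1 : cR (cos_momentR N.+1.*2) != 0 :> C by rewrite cR_eq0 gt_eqF.
by move: n1 n3; rewrite -!natr1 => n1 n3; field; rewrite n1 n3 w1.
Qed.

Lemma rgamma_reflection s : rgamma s * rgamma (1 - s) = csin (cR pi * s) / cR pi.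
Proof.
pose rho N := cos_moment N.*2 s / cR (cos_momentR N.*2) : C.
(* In the product of the two approximants, s + j pairs with j - s for 1 <= j <= N. Left over are s
   and the last factor 1 - s + N, which divided by N is [q N]. *)
pose q N := 1 + (1 - s) * N%:R^-1 : C.
have q1 : q N @[N --> \oo] --> (1 : C).
  rewrite -[X in _ --> X]addr0; apply: cvgD; first exact: cvg_cst.
  rewrite -[X in _ --> X](mulr0 (1 - s)); apply: cvgM; first exact: cvg_cst.
  exact: cvgC_invn.
have h1 : (rgamma_approx s N * rgamma_approx (1 - s) N) * rho N @[N --> \oo] -->
    rgamma s * rgamma (1 - s) * 1.
  apply: cvgM; last exact: cos_moment_ratio_cvg.
  by apply: cvgM; exact: rgamma_cvg.
have h2 : csin (cR pi * s) / cR pi * q N @[N --> \oo] --> csin (cR pi * s) / cR pi * 1.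
  by apply: cvgM; [exact: cvg_cst|exact: q1].
rewrite -[LHS]mulr1 -[RHS]mulr1; apply: cvgC_unique h1 _.
apply: cvg_trans h2; apply: near_eq_cvg; near=> N.
have N0 : (0 < N)%N by near: N; exact: nbhs_infty_gt.
have N0' : (0 : R) < N%:R by rewrite ltr0n.
rewrite (csin_product s N) -/(rho N) /rgamma_approx big_ord_recl /= addr0.
rewrite (big_ord_recr N) /=.
have e : (\prod_(i < N) (s + (bump 0 i)%:R)) * (\prod_(i < N) (1 - s + i%:R)) =
   (\prod_(j < N) (1 - s ^+ 2 / j.+1%:R ^+ 2)) * N`!%:R ^+ 2.
  have -> : N`!%:R ^+ 2 = \prod_(j < N) j.+1%:R ^+ 2 :> C.
    by rewrite prodrXl fact_prod natr_prod big_add1 big_mkord.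
  rewrite -!big_split /=; apply: eq_bigr => j _.
  have n3 : j.+1%:R != 0 :> C by rewrite pnatr_eq0.
  by move: n3; rewrite /bump add1n -!natr1 => n3; field.
have p1 : rpowC N%:R s * rpowC N%:R (1 - s) = N%:R.
  by rewrite -rpowCD addrC subrK rpowC1// cR_nat.
have f0 : N`!%:R != 0 :> C by rewrite pnatr_eq0 -lt0n fact_gt0.
have n0 : N%:R != 0 :> C by rewrite pnatr_eq0 -lt0n.
transitivity (s * ((\prod_(i < N) (s + (bump 0 i)%:R)) * (\prod_(i < N) (1 - s + i%:R)))
   * (1 - s + N%:R) / (N`!%:R ^+ 2 * (rpowC N%:R s * rpowC N%:R (1 - s))) * rho N).
  by rewrite e p1 /q; field; rewrite n0 f0.
by field; rewrite f0 !rpowC_neq0.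
Unshelve. all: by end_near. Qed.

End SineProduct.

(** * Growth of the reciprocal Gamma function on vertical lines *)

Section Growth.
Variable R : realType.
Local Notation C := (C R).
Implicit Types (v w s : C) (x y : R).

Lemma ln1D_ge x : - (1 / 2) <= x -> x - 2 * x ^+ 2 <= ln (1 + x).
Proof.
move=> x1; have x0 : 0 < 1 + x by lra.
have h : ln (1 + x)^-1 <= (1 + x)^-1 - 1.
  have -> : (1 + x)^-1 = 1 + ((1 + x)^-1 - 1) by lra.
  rewrite [X in _ <= X - 1]addrC subrK; apply: le_ln1Dx.
  by rewrite ltrBrDr addNr invr_gt0.
rewrite lnV ?posrE// in h.
have e : (1 + x)^-1 - 1 <= - x + 2 * x ^+ 2.
  rewrite lerBlDr -[_^-1]mul1r ler_pdivrMr//; have := sqr_ge0 x; nra.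
lra.
Qed.

Lemma scaled_ln1D_le (B b x : R) : `|b| <= B -> `|x| <= 1 / 2 ->
  b * ln (1 + x) <= b * x + 2 * B * x ^+ 2.
Proof.
move=> bB; rewrite ler_norml => /andP[x1 x2].
have h1 : ln (1 + x) <= x by apply: le_ln1Dx; lra.
have h2 := ln1D_ge x1.
move: bB; rewrite ler_norml => /andP[b1 b2].
have := sqr_ge0 x; have [b0|b0] := lerP 0 b; nra.
Qed.

Lemma sum_inv_sq_le N : \sum_(j < N) (j.+1%:R ^- 2 : R) <= 2.
Proof.
suff h : \sum_(j < N.+1) (j.+1%:R ^- 2 : R) <= 2 - N.+1%:R^-1.
  rewrite big_ord_recr /= in h; have : 0 <= N.+1%:R^-1 :> R by rewrite invr_ge0.
  have : 0 <= N.+1%:R ^- 2 :> R by rewrite invr_ge0 exprn_ge0.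
  move: h; move: (\sum_(_ < _) _) (N.+1%:R^-1) (N.+1%:R ^- 2) => x y z; lra.
elim: N => [|N IH]; first by rewrite big_ord1 expr1n; lra.
rewrite big_ord_recr /=.
have n0 : (0 : R) < N.+1%:R by rewrite ltr0n.
have : (N.+2%:R ^- 2 : R) <= N.+1%:R^-1 - N.+2%:R^-1.
  have -> : N.+1%:R^-1 - N.+2%:R^-1 = (N.+1%:R * N.+2%:R)^-1 :> R.
    by rewrite -[N.+2%:R]natr1; field; rewrite !gt_eqF//; lra.
  rewrite lef_pV2 ?posrE ?exprn_gt0 ?mulr_gt0// expr2 ler_wpM2r// ler_nat.
  exact: leqnSn.
move: IH; move: (\sum_(_ < _) _) (N.+1%:R^-1) (N.+2%:R^-1) (N.+2%:R ^- 2) => x y z u; lra.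
Qed.

Lemma ln_nrm (z : C) : z != 0 -> ln (nrm z) = ln (nrm z ^+ 2) / 2.
Proof.
by move=> z0; rewrite lnXn ?nrm_gt0// mulr2n; lra.
Qed.

(** One factor of the comparison of [rgamma w] with [nrm w `^ b * rgamma v]:
    the deviation from the exact telescoping power is quadratically small. *)
Lemma growth_factor (B b : R) v w : 0 <= B -> `|b| <= B ->
  cRe v = cRe w + b -> cIm v = - cIm w -> 8 * (B + 1) <= nrm w ->
  v != 0 /\
  ln (nrm w) + b * (ln (nrm (w + 1)) - ln (nrm w)) <=
  ln (nrm v) + (B + B ^+ 2 + (2 * B + B ^+ 2) ^+ 2 + 9 * B) / nrm w ^+ 2.
Proof.
move=> B0 bB rv iv wB.
have r0 : 0 < nrm w by lra.
have r1 : 1 <= nrm w by lra.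
have rr : 0 < nrm w ^+ 2 by rewrite exprn_gt0.
have w0 : w != 0 by rewrite -nrm_gt0.
pose a := cRe w; have ar : `|a| <= nrm w := re_le_nrm w.
pose x1 := (2 * a * b + b ^+ 2) / nrm w ^+ 2.
pose x2 := (2 * a + 1) / nrm w ^+ 2.
have ev : nrm v ^+ 2 = nrm w ^+ 2 * (1 + x1).
  rewrite /x1 mulrDr mulr1 mulrCA divff ?gt_eqF// mulr1 !nrm_sqr rv iv -/a; ring.
have ew : nrm (w + 1) ^+ 2 = nrm w ^+ 2 * (1 + x2).
  rewrite /x2 mulrDr mulr1 mulrCA divff ?gt_eqF// mulr1 !nrm_sqr cReD cImD cRe1 cIm1 -/a.
  ring.
have hx1 : `|x1| * nrm w <= 2 * B + B ^+ 2.
  rewrite /x1 normrM [ `|_^-1|]gtr0_norm ?invr_gt0// expr2 invfM mulrA.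
  rewrite divfK ?gt_eqF// ler_pdivrMr//.
  apply: le_trans (ler_normD _ _) _; rewrite !normrM (ger0_norm (ler0n _ 2)).
  rewrite -expr2.
  have h : `|a| * `|b| <= nrm w * B by rewrite ler_pM.
  have h' : `|b| ^+ 2 <= B ^+ 2 by rewrite lerXn2r// nnegrE.
  have := sqr_ge0 B; nra.
have hx2 : `|x2| * nrm w <= 3.
  rewrite /x2 normrM [ `|_^-1|]gtr0_norm ?invr_gt0// expr2 invfM mulrA.
  rewrite divfK ?gt_eqF// ler_pdivrMr//.
  apply: le_trans (ler_normD _ _) _; rewrite !normrM (ger0_norm (ler0n _ 2)) normr1.
  lra.
have hb : nrm w ^+ 2 * `|x1| <= nrm w * (2 * B + B ^+ 2) by rewrite expr2; nra.
have bx1 : `|x1| <= 1 / 2.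
  rewrite -(ler_pM2r rr) mulrC.
  have h : nrm w ^+ 2 * `|x1| <= 2 * B * nrm w + B ^+ 2.
    rewrite /x1 normrM [ `|_^-1|]gtr0_norm ?invr_gt0// mulrCA divff ?gt_eqF// mulr1.
    apply: le_trans (ler_normD _ _) _; rewrite !normrM (ger0_norm (ler0n _ 2)) -expr2.
    have h : `|a| * `|b| <= nrm w * B by rewrite ler_pM.
    have h' : `|b| ^+ 2 <= B ^+ 2 by rewrite lerXn2r// nnegrE.
    nra.
  apply: le_trans h _; rewrite !expr2; nra.
have bx2 : `|x2| <= 1 / 2.
  have := normr_ge0 x2; nra.
have p1 : 0 < 1 + x1 by move: bx1; rewrite ler_norml => /andP[? ?]; lra.
have p2 : 0 < 1 + x2 by move: bx2; rewrite ler_norml => /andP[? ?]; lra.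
have v0 : v != 0.
  by rewrite -nrm_gt0 -(@pmulr_rgt0 _ (nrm v)) -?expr2 ?ev ?mulr_gt0//;
     rewrite lt_def nrm_ge0 andbT -sqrf_eq0 ev mulf_neq0// gt_eqF.
have w10 : w + 1 != 0.
  by rewrite -nrm_eq0 -sqrf_eq0 ew mulf_neq0// gt_eqF.
split=> //.
rewrite (ln_nrm v0) (ln_nrm w10) (ln_nrm w0) ev ew !lnM ?posrE//.
have l1 : x1 - 2 * x1 ^+ 2 <= ln (1 + x1).
  by apply: ln1D_ge; move: bx1; rewrite ler_norml => /andP[].
have l2 := scaled_ln1D_le bB bx2.
set K := B + B ^+ 2 + _ + _.
suff : - x1 + 2 * x1 ^+ 2 + b * x2 + 2 * B * x2 ^+ 2 <= 2 * (K / nrm w ^+ 2) by lra.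
have e : - x1 + b * x2 = (b - b ^+ 2) / nrm w ^+ 2.
  by rewrite /x1 /x2; field; rewrite gt_eqF.
have q1 : x1 ^+ 2 <= (2 * B + B ^+ 2) ^+ 2 / nrm w ^+ 2.
  rewrite ler_pdivlMr// -exprMn -[leLHS]real_normK ?num_real// normrM (ger0_norm (ltW r0)).
  have h0 : 0 <= `|x1| * nrm w by rewrite mulr_ge0// ltW.
  by rewrite lerXn2r ?nnegrE//; exact: le_trans hx1.
have q2 : x2 ^+ 2 <= 9 / nrm w ^+ 2.
  rewrite ler_pdivlMr// -exprMn -[leLHS]real_normK ?num_real// normrM (ger0_norm (ltW r0)).
  have h0 : 0 <= `|x2| * nrm w by rewrite mulr_ge0// ltW.
  have : (`|x2| * nrm w) ^+ 2 <= 3 ^+ 2 by rewrite lerXn2r ?nnegrE.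
  lra.
have q3 : (b - b ^+ 2) / nrm w ^+ 2 <= (B + B ^+ 2) / nrm w ^+ 2.
  rewrite ler_pM2r ?invr_gt0//; move: bB; rewrite ler_norml => /andP[? ?].
  by have := sqr_ge0 b; have := sqr_ge0 B; lra.
have q4 : 2 * B * x2 ^+ 2 <= 2 * B * (9 / nrm w ^+ 2) by rewrite ler_wpM2l// mulr_ge0.
have r2V : 0 < (nrm w ^+ 2)^-1 by rewrite invr_gt0.
have := sqr_ge0 B; rewrite /K; nra.
Qed.

Lemma growth_partial (B b : R) v w : 0 <= B -> `|b| <= B ->
  cRe v = cRe w + b -> cIm v = - cIm w -> - B <= cRe w ->
  (forall j : nat, 8 * (B + 1) <= nrm (w + j%:R)) ->
  forall N, (\prod_(j < N) nrm (w + j%:R)) * expR (b * ln (nrm (w + N%:R))) <=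
    (\prod_(j < N) nrm (v + j%:R)) * expR (b * ln (nrm w)) *
    expR (2 * (B + 2) ^+ 2 * (B + B ^+ 2 + (2 * B + B ^+ 2) ^+ 2 + 9 * B)).
Proof.
move=> B0 bB rv iv wB wj N; set K := B + _ + _ + _.
have K0 : 0 <= K by rewrite /K; have := sqr_ge0 B; have := sqr_ge0 (2 * B + B ^+ 2); lra.
have h M : (\prod_(j < M) nrm (w + j%:R)) * expR (b * ln (nrm (w + M%:R))) <=
    (\prod_(j < M) nrm (v + j%:R)) * expR (b * ln (nrm w)) *
    expR (\sum_(j < M) K / nrm (w + j%:R) ^+ 2).
  elim: M => [|M IH]; first by rewrite !big_ord0 !mul1r addr0 expR0 mulr1.
  have [||v0 hM] := @growth_factor B b (v + M%:R) (w + M%:R) B0 bB _ _ (wj M).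
  - by rewrite !cReD rv; ring.
  - by rewrite !cImD iv cIm_nat; ring.
  have w0 : 0 < nrm (w + M%:R) by apply: lt_le_trans (wj M); lra.
  have : nrm (w + M%:R) * expR (b * ln (nrm (w + M.+1%:R))) <=
      nrm (v + M%:R) * expR (b * ln (nrm (w + M%:R))) * expR (K / nrm (w + M%:R) ^+ 2).
    rewrite -[X in X * _](lnK (_ : _ \is Num.pos)) ?posrE//.
    rewrite -[X in _ <= X * _ * _](lnK (_ : _ \is Num.pos)) ?posrE ?nrm_gt0//.
    rewrite -!expRD ler_expR -[M.+1%:R]natr1 (addrA w); rewrite -/K in hM.
    by rewrite -addrA in hM *; rewrite -addrA; lra.
  set p := expR _; set q := expR _; set r := expR _.
  rewrite -/q in IH; move=> step.
  rewrite !big_ord_recr /= expRD -/r -!mulrA.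
  have P0 : 0 <= \prod_(j < M) nrm (w + j%:R) by apply: prodr_ge0 => j _; exact: nrm_ge0.
  have := ler_wpM2l P0 step; move/le_trans; apply.
  have := ler_wpM2r (mulr_ge0 (nrm_ge0 (v + M%:R)) (expR_ge0 (K / nrm (w + M%:R) ^+ 2))) IH.
  by rewrite -/r; lra.
apply: le_trans (h N) _; rewrite ler_wpM2l ?mulr_ge0 ?expR_ge0//.
  by apply: prodr_ge0 => j _; exact: nrm_ge0.
rewrite ler_expR -mulr_sumr mulrC ler_wpM2r//.
have sq : \sum_(j < N) (j.+1%:R ^- 2 : R) * (B + 2) ^+ 2 <= 2 * (B + 2) ^+ 2.
  by rewrite -mulr_suml ler_wpM2r ?sqr_ge0// sum_inv_sq_le.
apply: le_trans sq; apply: ler_sum => j _.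
have n1 : 1 <= nrm (w + j%:R) by have := wj j; lra.
have n2 : j%:R - B <= nrm (w + j%:R).
  apply: le_trans (re_le_nrm _); apply: le_trans (ler_norm _).
  by rewrite cReD cRe_nat; lra.
(* From |w + j| >= 1 and |w + j| >= j - B follows j + 1 <= |w + j| + B + 1 <= (B + 2)|w + j|. Thus
   the sum of 1/|w + j|^2 is at most (B + 2)^2 times that of 1/(j+1)^2. *)
have n3 : j.+1%:R <= nrm (w + j%:R) * (B + 2) by rewrite -natr1; nra.
have j0 : (0 : R) < j.+1%:R by rewrite ltr0n.
rewrite mulrC ler_pdivlMr ?exprn_gt0// mulrC ler_pdivrMr ?exprn_gt0//; last by lra.
rewrite mulrC -exprMn lerXn2r// ?nnegrE ?mulr_ge0 ?nrm_ge0//; lra.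
Qed.

(** To be used with w = 1 - s + |k|/2 and v = s + |k|/2, so that b = 2 Re s - 1. The quotient
    occurring in [Gk] then has a pure power bound, because Im v = - Im w makes the exponential
    growth of the two values cancel. *)
Lemma rgamma_growth (B : R) : 0 <= B -> exists2 K : R, 0 < K &
  forall (b : R) v w, `|b| <= B ->
  cRe v = cRe w + b -> cIm v = - cIm w -> - B <= cRe w ->
  (forall j : nat, 8 * (B + 1) <= nrm (w + j%:R)) ->
  nrm (rgamma w) <= K * expR (b * ln (nrm w)) * nrm (rgamma v).
Proof.
move=> B0; eexists; last first.
  move=> b v w bB rv iv wB wj.
  set K0 := expR (2 * (B + 2) ^+ 2 * (B + B ^+ 2 + (2 * B + B ^+ 2) ^+ 2 + 9 * B)).
  (* The factor (|w + N + 1|/N)^b that the comparison of N + 1 factors leaves over; it tends to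
     1. *)
  pose E N := expR (b * (ln (nrm (w + N.+1%:R) * N%:R^-1))).
  have hN N : (0 < N)%N -> nrm (rgamma_approx w N) * E N <=
      K0 * expR (b * ln (nrm w)) * nrm (rgamma_approx v N).
    move=> N0; have N0' : (0 : R) < N%:R by rewrite ltr0n.
    have w0 : 0 < nrm (w + N.+1%:R) by apply: lt_le_trans (wj N.+1); lra.
    have := growth_partial B0 bB rv iv wB wj N.+1; rewrite -/K0 => h.
    rewrite /rgamma_approx !nrmf_div !nrm_prod !nrmM !nrm_rpowC rv nrm_nat.
    have -> : E N = expR (b * ln (nrm (w + N.+1%:R))) * expR (- (b * ln N%:R)).
      by rewrite -expRD /E lnM ?posrE ?invr_gt0// lnV ?posrE//; congr expR; ring.
    have f0 : (0 : R) < N`!%:R by rewrite ltr0n fact_gt0.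
    have D0 : 0 <= expR (- (b * ln N%:R)) / (N`!%:R * expR (cRe w * ln N%:R)).
      by rewrite divr_ge0 ?expR_ge0// mulr_ge0 ?expR_ge0.
    have := ler_wpM2r D0 h.
    set A := \prod_(_ < _) _; set A' := \prod_(_ < _) _.
    have -> : A' / (N`!%:R * expR ((cRe w + b) * ln N%:R)) =
        A' * (expR (- (b * ln N%:R)) / (N`!%:R * expR (cRe w * ln N%:R))).
      rewrite mulrDl expRD expRN; field.
      by rewrite !gt_eqF ?expR_gt0.
    set D := expR (- _) / _ => h2.
    have -> : A / (N`!%:R * expR (cRe w * ln N%:R)) *
      (expR (b * ln (nrm (w + N.+1%:R))) * expR (- (b * ln N%:R))) =
      A * expR (b * ln (nrm (w + N.+1%:R))) * D by rewrite /D; ring.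
    apply: le_trans h2 _; rewrite le_eqVlt; apply/orP; left; apply/eqP; ring.
  have cE : E N @[N --> \oo] --> (1 : R).
    have h : nrm (1 + (w + 1) * N%:R^-1) @[N --> \oo] --> nrm 1.
      apply: cvg_nrm; rewrite -[X in _ --> X]addr0; apply: cvgD; first exact: cvg_cst.
      rewrite -[X in _ --> X](mulr0 (w + 1)); apply: cvgM; first exact: cvg_cst.
      exact: cvgC_invn.
    rewrite nrm1 in h.
    have h1 := cvg_comp _ _ h (continuous_ln ltr01).
    have h2 : b * ln (nrm (1 + (w + 1) * N%:R^-1)) @[N --> \oo] --> b * ln 1.
      by apply: cvgM; [exact: cvg_cst|exact: h1].
    have h3 := cvg_comp _ _ h2 (@continuous_expR R (b * ln 1)).
    rewrite ln1 mulr0 expR0 in h3; apply: cvg_trans h3; apply: near_eq_cvg; near=> N.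
    have N0 : (0 < N)%N by near: N; exact: nbhs_infty_gt.
    have N0' : N%:R != 0 :> C by rewrite pnatr_eq0 -lt0n.
    rewrite /E /=; congr (expR (b * ln _)).
    have -> : 1 + (w + 1) / N%:R = (w + N.+1%:R) / N%:R.
      by rewrite -natr1; field.
    by rewrite nrmf_div nrm_nat.
  have c1 : nrm (rgamma_approx w N) * E N @[N --> \oo] --> nrm (rgamma w) * 1.
    by apply: cvgM; [apply: cvg_nrm; exact: rgamma_cvg|exact: cE].
  have c2 : K0 * expR (b * ln (nrm w)) * nrm (rgamma_approx v N) @[N --> \oo] -->
     K0 * expR (b * ln (nrm w)) * nrm (rgamma v).
    by apply: cvgM; [exact: cvg_cst|apply: cvg_nrm; exact: rgamma_cvg].
  rewrite -[leLHS]mulr1; apply: ler_cvg_to c1 c2 _.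
  by near=> N; apply: hN; near: N; exact: nbhs_infty_gt.
exact: expR_gt0.
Unshelve. all: by end_near. Qed.

End Growth.

(** * Path integrals and the residue theorem *)

Section ComplexLog.
Variable R : realType.
Local Notation C := (C R).
Implicit Types (z w : C) (f g : R -> C) (t : R).

(** Principal logarithm on the complement of the closed negative half-line;
    the half-angle formula for the argument avoids a case distinction. *)
Definition clog w : C :=
  Complex (ln (nrm w)) (2 * atan (cIm w / (nrm w + cRe w))).

Lemma nrmDre_gt0 w : (cIm w != 0) || (0 < cRe w) -> 0 < nrm w + cRe w.
Proof.
case/orP => [y0|x0]; last by have := nrm_ge0 w; lra.
have h : cRe w ^+ 2 < nrm w ^+ 2 by rewrite nrm_sqr ltrDl lt_def sqrf_eq0 y0 sqr_ge0.
have : `|cRe w| < nrm w.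
  by rewrite -(@ltr_pXn2r _ 2)// ?nnegrE ?nrm_ge0// real_normK ?num_real.
by have := ler_norm (- cRe w); rewrite normrN; lra.
Qed.

Lemma is_derive_nrm f t (d : C) : is_cder f t d -> f t != 0 ->
  is_derive t 1 (fun x => nrm (f x))
    ((cRe (f t) * cRe d + cIm (f t) * cIm d) / nrm (f t)).
Proof.
move=> [f1 f2] f0; have n0 : 0 < nrm (f t) by rewrite nrm_gt0.
have p0 : 0 < (fun x => cRe (f x) * cRe (f x) + cIm (f x) * cIm (f x)) t.
  by rewrite -!expr2 -nrm_sqr exprn_gt0.
have dp : is_derive t 1 (fun x => cRe (f x) * cRe (f x) + cIm (f x) * cIm (f x))
   (2 * (cRe (f t) * cRe d + cIm (f t) * cIm d)).
  by apply: is_derive_eq; rewrite /GRing.scale /=; ring.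
have := @is_derive1_comp _ _ _ t _ _ (is_derive1_sqrt p0) dp.
have -> : Num.sqrt \o (fun x => cRe (f x) * cRe (f x) + cIm (f x) * cIm (f x)) =
    (fun x => nrm (f x)).
  by apply/funext => x; rewrite /= nrmE -!expr2.
move=> h; apply: is_derive_eq h _.
rewrite -!expr2 -nrmE; field.
by rewrite gt_eqF.
Qed.

Lemma is_cder_clog f t (d : C) : is_cder f t d ->
  (cIm (f t) != 0) || (0 < cRe (f t)) ->
  is_cder (fun x => clog (f x)) t (d / f t).
Proof.
move=> df h; have q0 := nrmDre_gt0 h.
have f0 : f t != 0.
  apply: contraTneq q0 => ->; rewrite nrm0 add0r /=; by rewrite ltxx.
have n0 : 0 < nrm (f t) by rewrite nrm_gt0.
have dn := is_derive_nrm df f0.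
have [d1 d2] := df.
have er : cRe d = cRe (d / f t) * cRe (f t) - cIm (d / f t) * cIm (f t).
  by rewrite -cReM divfK.
have ei : cIm d = cRe (d / f t) * cIm (f t) + cIm (d / f t) * cRe (f t).
  by rewrite -cImM divfK.
have e1 : cRe (d / f t) = (cRe (f t) * cRe d + cIm (f t) * cIm d) / nrm (f t) ^+ 2.
  apply: (@mulIf _ (nrm (f t) ^+ 2)); first by rewrite expf_neq0// gt_eqF.
  rewrite divfK ?expf_neq0 ?gt_eqF// nrm_sqr.
  by rewrite er ei; ring.
have e2 : cIm (d / f t) = (cRe (f t) * cIm d - cIm (f t) * cRe d) / nrm (f t) ^+ 2.
  apply: (@mulIf _ (nrm (f t) ^+ 2)); first by rewrite expf_neq0// gt_eqF.
  rewrite divfK ?expf_neq0 ?gt_eqF// nrm_sqr.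
  by rewrite er ei; ring.
split.
  have := is_derive1_comp (is_derive1_ln n0) dn => hd.
  apply: is_derive_eq hd _; rewrite e1; field.
  by rewrite gt_eqF.
have dq : is_derive t 1 (fun x => nrm (f x) + cRe (f x))
    ((cRe (f t) * cRe d + cIm (f t) * cIm d) / nrm (f t) + cRe d).
  exact: is_deriveD.
have dv := @is_deriveV R (fun x => nrm (f x) + cRe (f x)) t _ _ (lt0r_neq0 q0) dq.
have dm := is_deriveM d2 dv.
have da := @is_derive1_comp _ _ _ t _ _ (is_derive1_atan _) dm.
have dz := is_deriveZ 2 da.
apply: is_derive_eq dz _.
rewrite /GRing.scale /= e2.
rewrite [X in (1 + X ^+ 2)^-1](_ : _ = cIm (f t) / (nrm (f t) + cRe (f t)))//.
have s2 := nrm_sqr (f t).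
have p1 : (nrm (f t) + cRe (f t)) ^+ 2 + cIm (f t) ^+ 2 =
    2 * nrm (f t) * (nrm (f t) + cRe (f t)).
  have -> : cIm (f t) ^+ 2 = nrm (f t) ^+ 2 - cRe (f t) ^+ 2 by rewrite s2; ring.
  ring.
move: p1 s2 q0 n0; move: (nrm (f t)) (cRe (f t)) (cIm (f t)) (cRe d) (cIm d) => r x y a b.
move=> p1 s2 q0 n0.
have -> : (1 + (y / (r + x)) ^+ 2)^-1 = (r + x) / (2 * r).
  apply: (@mulfI _ (1 + (y / (r + x)) ^+ 2)).
    by rewrite gt_eqF// ltr_pwDl// sqr_ge0.
  rewrite divff ?gt_eqF ?ltr_pwDl ?sqr_ge0//.
  have -> : 1 + (y / (r + x)) ^+ 2 = ((r + x) ^+ 2 + y ^+ 2) / (r + x) ^+ 2.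
    by field; rewrite gt_eqF.
  by rewrite p1; field; rewrite !gt_eqF.
have y2 : y ^+ 2 = r ^+ 2 - x ^+ 2 by rewrite s2; ring.
transitivity ((b * (r + x) - (y * x * a + y ^+ 2 * b) / r - y * a) / (r * (r + x))).
  by field; rewrite !gt_eqF.
rewrite y2; field.
by rewrite !gt_eqF.
Qed.

Lemma atan_inv (x : R) : 0 < x -> atan x + atan x^-1 = pi / 2.
Proof.
move=> x0; have a0 : 0 < atan x by rewrite -(@atan0 R); exact: lt_atan.
have a1 := atan_ltpi2 x.
have c0 : 0 < cos (atan x) by apply: cos_gt0_pihalf; rewrite a1 andbT; lra.
have e : tan (pi / 2 - atan x) = x^-1.
  rewrite /tan sinB cosB sin_pihalf cos_pihalf !mul0r !mul1r subr0 add0r.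
  by rewrite -[in RHS](atanK x) /tan invf_div.
have h : - (pi / 2 : R) < pi / 2 - atan x < pi / 2.
  by move: a0 a1; move: (atan x) (pi / 2) => a p a0 a1; apply/andP; split; lra.
by rewrite -e tanK ?in_itv//= [RHS](_ : _ = atan x + (pi / 2 - atan x))// addrC subrK.
Qed.

(** The jump between the branches log w and log(-w). It occurs once at each end of a vertical line
    passing to the left of a pole, which gives 2 pi i in all. *)
Lemma clog_oppB w : 0 < cIm w -> clog w - clog (- w) = cR pi * cI R.
Proof.
move=> y0; have y0' : cIm w != 0 by rewrite gt_eqF.
have q1 : 0 < nrm w + cRe w by apply: nrmDre_gt0; rewrite y0'.
have q2 : 0 < nrm w - cRe w.
  by rewrite -(nrmN w) -cReN; apply: nrmDre_gt0; rewrite cImN oppr_eq0 y0'.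
rewrite cI_E; apply: complex_ext; rewrite ?cReB ?cImB ?cReM ?cImM /=.
  by rewrite nrmN; ring.
rewrite nrmN cReN cImN mulNr.
have aN x : atan (- x) = - atan x :> R by rewrite atanN.
rewrite aN mulrN opprK -mulrDr.
have -> : cIm w / (nrm w - cRe w) = (cIm w / (nrm w + cRe w))^-1.
  rewrite invf_div; apply: (canRL (mulfK y0')).
  have e : cIm w * cIm w = (nrm w + cRe w) * (nrm w - cRe w) by have := nrm_sqr w; lra.
  by rewrite mulrAC e mulfK// gt_eqF.
by rewrite atan_inv ?divr_gt0//; field.
Qed.

End ComplexLog.

Section Paths.
Variable R : realType.
Local Notation C := (C R).
Implicit Types (g h F : C -> C) (t : R).

(** Curves are differentiable on all of R although only [pstart, pend] is integrated: two-sided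
    derivatives then suffice everywhere. In return, integrands have to be continuous along the whole
    extended lines. *)
Record path := Path {
  pth : R -> C;
  vel : R -> C;
  pstart : R;
  pend : R;
  pstart_lt_pend : pstart < pend;
  pth_cder : forall t, is_cder pth t (vel t);
  vel_cont : continuous vel }.

Lemma pth_cont (c : path) : continuous (pth c).
Proof. by move=> t; apply: is_cder_continuous (pth_cder c t). Qed.

Definition contp (c : path) g := continuous (fun t => g (pth c t)).

Definition pint (c : path) g : C :=
  cint (pstart c) (pend c) (fun t => g (pth c t) * vel c t).

Definition pint_end (c : path) := pth c (pend c).
Definition pint_start (c : path) := pth c (pstart c).

Lemma contp_cont c g : contp c g -> continuous (fun t => g (pth c t) * vel c t).
Proof. by move=> cg; apply: ccontM; [exact: cg|exact: vel_cont]. Qed.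

Lemma pint_FTC c F g : (forall t, is_cder (fun t => F (pth c t)) t (g (pth c t) * vel c t)) ->
  contp c g -> pint c g = F (pint_end c) - F (pint_start c).
Proof.
by move=> dF cg; exact: (cint_FTC (pstart_lt_pend c) dF (contp_cont cg)).
Qed.

Lemma pintD c g h : contp c g -> contp c h ->
  pint c (fun s => g s + h s) = pint c g + pint c h.
Proof.
move=> cg ch; rewrite /pint -(cintD _ _ (contp_cont cg) (contp_cont ch)).
by congr cint; apply/funext => t; rewrite mulrDl.
Qed.

Lemma pintZ c z g : contp c g -> pint c (fun s => z * g s) = z * pint c g.
Proof.
move=> cg; rewrite /pint -cintZ; last exact: contp_cont.
by congr cint; apply/funext => t; rewrite mulrA.
Qed.

Lemma pint_sum c (I : Type) (r : seq I) (G : I -> C -> C) :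
  (forall i, contp c (G i)) ->
  pint c (fun s => \sum_(i <- r) G i s) = \sum_(i <- r) pint c (G i).
Proof.
move=> cG; rewrite /pint -cint_sum; last by move=> i; apply: contp_cont; exact: cG.
by congr cint; apply/funext => t; rewrite mulr_suml.
Qed.

Lemma continuous_nrm_bounded (u : R -> C) (a b : R) : a <= b -> continuous u ->
  exists2 M : R, 0 <= M & forall t, a <= t <= b -> nrm (u t) <= M.
Proof.
move=> ab cu.
have cn : {within `[a, b], continuous (fun t => nrm (u t))}.
  by apply: continuous_subspaceT => t; apply: cvg_nrm; exact: cu.
have [c cab hc] := EVT_max ab cn.
exists (nrm (u c)); first exact: nrm_ge0.
by move=> t tab; apply: hc; rewrite in_itv.
Qed.

Lemma pint_cvg c g (G : nat -> C -> C) : contp c g -> (forall n, contp c (G n)) ->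
  (forall e : R, 0 < e -> \forall n \near \oo, forall t,
     pstart c <= t <= pend c -> nrm (G n (pth c t) - g (pth c t)) <= e) ->
  pint c (G n) @[n --> \oo] --> pint c g.
Proof.
move=> cg cG hG; have ab := pstart_lt_pend c.
have [M M0 hM] := continuous_nrm_bounded (ltW ab) (@vel_cont c).
apply/cvgCP => e e0.
pose d := e / (2 * (M + 1) * (pend c - pstart c) + 1).
have D0 : 0 < 2 * (M + 1) * (pend c - pstart c) + 1.
  have : 0 <= (M + 1) * (pend c - pstart c) by rewrite mulr_ge0//; lra.
  lra.
have d0 : 0 < d by rewrite divr_gt0.
have := hG d d0; apply: filterS => n hn.
rewrite /pint -(cintB _ _ (contp_cont (cG n)) (contp_cont cg)).
have hb : forall t, pstart c <= t <= pend c ->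
    nrm (G n (pth c t) * vel c t - g (pth c t) * vel c t) <= d * (M + 1).
  move=> t tab; rewrite -mulrBl nrmM ler_pM ?nrm_ge0 ?hn//.
  by have := hM t tab; lra.
apply: le_lt_trans (nrm_cint_le (ltW ab) _ hb) _.
  exact: (ccontB (contp_cont (cG n)) (contp_cont cg)).
have -> : e = d * (2 * (M + 1) * (pend c - pstart c) + 1) by rewrite /d divfK// gt_eqF.
by lra.
Qed.

End Paths.

Section PolynomialCurves.
Variable R : realType.
Local Notation C := (C R).

Lemma cvgC_sum (T : Type) (F : set_system T) {FF : Filter F} (I : Type) (r : seq I)
    (B : pred I) (u : I -> T -> C) (l : I -> C) :
  (forall i, u i x @[x --> F] --> l i) ->
  \sum_(i <- r | B i) u i x @[x --> F] --> \sum_(i <- r | B i) l i.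
Proof.
move=> ul; elim: r => [|i r IH].
  rewrite big_nil; under eq_fun do rewrite big_nil; exact: cvg_cst.
rewrite big_cons; under eq_fun do rewrite big_cons.
by case: (B i); [exact: (cvgD (ul i) IH)|exact: IH].
Qed.

Lemma cvgC_prod (T : Type) (F : set_system T) {FF : Filter F} (I : Type) (r : seq I)
    (B : pred I) (u : I -> T -> C) (l : I -> C) :
  (forall i, u i x @[x --> F] --> l i) ->
  \prod_(i <- r | B i) u i x @[x --> F] --> \prod_(i <- r | B i) l i.
Proof.
move=> ul; elim: r => [|i r IH].
  rewrite big_nil; under eq_fun do rewrite big_nil; exact: cvg_cst.
rewrite big_cons; under eq_fun do rewrite big_cons.
by case: (B i); [exact: (cvgM (ul i) IH)|exact: IH].
Qed.

Lemma is_cder_poly (P : {poly C}) (g : R -> C) t (d : C) : is_cder g t d ->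
  is_cder (fun x => P.[g x]) t ((deriv P).[g t] * d).
Proof.
move=> dg; elim/poly_ind: P => [|P c IH].
  have -> : (fun x => (0 : {poly C}).[g x]) = (fun=> 0).
    by apply/funext => x; rewrite horner0.
  by rewrite deriv0 horner0 mul0r; exact: is_cder_cst.
have -> : (fun x => (P * 'X + c%:P).[g x]) = (fun x => P.[g x] * g x + c).
  by apply/funext => x; rewrite !hornerE.
apply: is_cder_eq (is_cderD (is_cderM IH dg) (is_cder_cst c t)).
by rewrite derivD derivC addr0 derivM derivX mulr1 !hornerE; ring.
Qed.

Lemma poly_primitive (P : {poly C}) : exists Q : {poly C}, (deriv Q) = P.
Proof.
exists (\poly_(i < (size P).+1) (if i is j.+1 then P`_j / j.+1%:R else 0)).
apply/polyP => i; rewrite coef_deriv coef_poly ltnS.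
case: ltnP => h; last by rewrite mul0rn nth_default.
by rewrite -[LHS]mulr_natr divfK// pnatr_eq0.
Qed.

(** Subtracting from [P] its Lagrange interpolant on [S] leaves a polynomial [N] vanishing on [S];
    the quotient of [N] by the root product is the polynomial part. *)
Lemma partial_fractions (P : {poly C}) (S : seq C) : uniq S ->
  exists Q : {poly C}, forall s, s \notin S ->
  P.[s] / \prod_(p <- S) (s - p) =
  Q.[s] + \sum_(p <- S) (P.[p] / \prod_(q <- S | q != p) (p - q)) / (s - p).
Proof.
move=> uS; pose c p := P.[p] / \prod_(q <- S | q != p) (p - q).
pose N := P - \sum_(p <- S) (c p)%:P * \prod_(q <- S | q != p) ('X - q%:P).
have hprod (r : seq C) (B : pred C) s :
    (\prod_(q <- r | B q) ('X - q%:P)).[s] = \prod_(q <- r | B q) (s - q).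
  by rewrite horner_prod; apply: eq_bigr => q _; rewrite !hornerE.
have hN s : N.[s] = P.[s] - \sum_(p <- S) c p * \prod_(q <- S | q != p) (s - q).
  rewrite /N hornerD hornerN horner_sum; congr (_ - _); apply: eq_bigr => p _.
  by rewrite hornerM hornerC hprod.
have nz p : \prod_(q <- S | q != p) (p - q) != 0.
  by rewrite prodf_seq_neq0; apply/allP => q _; apply/implyP; rewrite subr_eq0 eq_sym.
have rN : all (root N) S.
  apply/allP => p pS; apply/eqP; rewrite hN (bigD1_seq p)//=.
  suff -> : \sum_(i <- S | i != p) c i * \prod_(q <- S | q != i) (p - q) = 0.
    by rewrite addr0 /c divfK// subrr.
  apply: big1_seq.
  move=> r /andP[rp rS]; apply/eqP; rewrite mulf_eq0; apply/orP; right.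
  rewrite prodf_seq_eq0; apply/hasP; exists p => //=.
  by rewrite subrr eqxx andbT eq_sym.
have [||Q NQ] := @uniq_roots_prod_XsubC _ N S => //; first by rewrite uniq_rootsE.
exists Q => s sS.
have ns p : p \in S -> s - p != 0.
  by move=> pS; rewrite subr_eq0; apply: contraNneq sS => ->.
have n0 : \prod_(p <- S) (s - p) != 0.
  by rewrite prodf_seq_neq0; apply/allP => p pS; exact: ns.
apply: (mulIf n0); rewrite divfK// mulrDl mulr_suml.
have -> : \sum_(p <- S) c p / (s - p) * \prod_(p <- S) (s - p) =
   \sum_(p <- S) c p * \prod_(q <- S | q != p) (s - q).
  rewrite big_seq [RHS]big_seq; apply: eq_bigr => p pS.
  by rewrite [X in _ / _ * X](bigD1_seq p)//= mulrA divfK// ns.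
have := hN s; rewrite NQ hornerM hprod => ->.
by rewrite subrK.
Qed.

End PolynomialCurves.

(** * Residue theorem for the region between a vertical line and a graph *)

Section RectangularLoop.
Variable R : realType.
Local Notation C := (C R).
Implicit Types (g h : C -> C) (t x y u : R) (p s : C).

Lemma is_cder_graph (f : R -> R) t (d : R) : is_derive t 1 f d ->
  is_cder (fun t => Complex (f t) t : C) t (Complex d 1).
Proof. by split => //=; exact: is_derive_id. Qed.

Lemma ccont_graph (f : R -> R) : continuous f -> continuous (fun t => Complex (f t) 1 : C).
Proof. by move=> cf t; apply: cvg_reim => /=; [exact: cf|exact: cvg_cst]. Qed.

Definition graph_path (f f' : R -> R) (a b : R) (ab : a < b)
    (df : forall t, is_derive t 1 f (f' t)) (cf : continuous f') : path R :=
  @Path R _ _ a b ab (fun t => is_cder_graph (df t)) (ccont_graph cf).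

Lemma is_cder_hline y u : is_cder (fun u => Complex u y : C) u (Complex 1 0).
Proof. by split => /=; [exact: is_derive_id|exact: is_derive_cst]. Qed.

Lemma continuous_cst_C (z : C) : continuous (fun _ : R => z).
Proof. by move=> t; exact: cvg_cst. Qed.

Definition hline (y a b : R) (ab : a < b) : path R :=
  @Path R _ _ a b ab (fun u => is_cder_hline y u) (@continuous_cst_C (Complex 1 0)).

Lemma continuous_cst_R (z : R) : continuous (fun _ : R => z).
Proof. by move=> t; exact: cvg_cst. Qed.

Definition vline (x a b : R) (ab : a < b) : path R :=
  @graph_path (fun=> x) (fun=> 0) a b ab (fun t => is_derive_cst x t 1)
   (@continuous_cst_R 0).

Variables (f f' : R -> R) (sigma s0 T : R).
Variables (df : forall t, is_derive t 1 f (f' t)) (cf : continuous f').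
Variables (T0 : - T < T) (s0_lt : s0 < sigma) (fT : f T = sigma) (fNT : f (- T) = sigma).

Let gam := graph_path T0 df cf.
Let lin := vline s0 T0.
Let top := hline T s0_lt.
Let bot := hline (- T) s0_lt.

(** Counterclockwise boundary of the region between the line Re s = s0 and the graph of [f], cut off
    at heights -T and T. Each edge is parametrised upwards or rightwards, whence the signs. *)
Definition loop g := pint gam g - pint lin g - pint top g + pint bot g.

Definition contl g := [/\ contp gam g, contp lin g, contp top g & contp bot g].

Lemma loopD g h : contl g -> contl h -> loop (fun s => g s + h s) = loop g + loop h.
Proof.
by move=> [g1 g2 g3 g4] [h1 h2 h3 h4]; rewrite /loop !pintD//; ring.
Qed.

Lemma loopZ (z : C) g : contl g -> loop (fun s => z * g s) = z * loop g.
Proof. by move=> [g1 g2 g3 g4]; rewrite /loop !pintZ//; ring. Qed.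

Lemma loop_sum (I : Type) (r : seq I) (G : I -> C -> C) : (forall i, contl (G i)) ->
  loop (fun s => \sum_(i <- r) G i s) = \sum_(i <- r) loop (G i).
Proof.
move=> cG; rewrite /loop !pint_sum; try by move=> i; case: (cG i).
by rewrite -!sumrB -big_split.
Qed.

Lemma contp_sum (c : path R) (I : Type) (r : seq I) (G : I -> C -> C) :
  (forall i, contp c (G i)) -> contp c (fun s => \sum_(i <- r) G i s).
Proof.
by move=> cG; apply: (@ccont_sum R I r xpredT (fun i t => G i (pth c t))); exact: cG.
Qed.

Definition on_loop s :=
  exists t, [\/ s = pth gam t, s = pth lin t, s = pth top t | s = pth bot t].

Lemma contlM g h : contl g -> contl h -> contl (fun s => g s * h s).
Proof.
move=> [g1 g2 g3 g4] [h1 h2 h3 h4].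
split; [exact: (ccontM g1 h1)|exact: (ccontM g2 h2)|exact: (ccontM g3 h3)|exact: (ccontM g4 h4)].
Qed.

Lemma contl_cst (z : C) : contl (fun=> z).
Proof. by split; exact: ccont_cst. Qed.

Lemma loop_cvgM (E : nat -> C -> C) (F rho : C -> C) : (forall n, contl (E n)) ->
  contl F -> contl rho ->
  (forall M : R, forall e : R, 0 < e -> \forall n \near \oo, forall s, nrm s <= M ->
     on_loop s -> nrm (E n s - F s) <= e) ->
  loop (fun s => E n s * rho s) @[n --> \oo] --> loop (fun s => F s * rho s).
Proof.
move=> cE cF0 crho hE.
have H (c : path R) : (forall t, on_loop (pth c t)) -> contp c rho ->
    contp c (fun s => F s * rho s) -> (forall n, contp c (fun s => E n s * rho s)) ->
    pint c (fun s => E n s * rho s) @[n --> \oo] --> pint c (fun s => F s * rho s).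
  move=> hc cr cFr cEr; apply: pint_cvg => // e e0.
  have ab := ltW (pstart_lt_pend c).
  have [M M0 hM] := continuous_nrm_bounded ab (@pth_cont _ c).
  have [D D0 hD] := continuous_nrm_bounded ab cr.
  have D1 : 0 < D + 1 by lra.
  have eD : 0 < e / (D + 1) by rewrite divr_gt0.
  have := hE M _ eD; apply: filterS => n hn t tab.
  rewrite -mulrBl nrmM; apply: le_trans (_ : e / (D + 1) * (D + 1) <= _).
    rewrite ler_pM ?nrm_ge0 ?hn ?hM//.
    by have := hD t tab; lra.
  by rewrite divfK// gt_eqF.
have [r1 r2 r3 r4] := crho.
have [f1 f2 f3 f4] := contlM cF0 crho.
have cER n := contlM (cE n) crho.
have h1 := H gam (fun t => ex_intro _ t (Or41 _ _ _ erefl)) r1 f1.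
have h2 := H lin (fun t => ex_intro _ t (Or42 _ _ _ erefl)) r2 f2.
have h3 := H top (fun t => ex_intro _ t (Or43 _ _ _ erefl)) r3 f3.
have h4 := H bot (fun t => ex_intro _ t (Or44 _ _ _ erefl)) r4 f4.
have {}h1 := h1 (fun n => let: And4 a _ _ _ := cER n in a).
have {}h2 := h2 (fun n => let: And4 _ a _ _ := cER n in a).
have {}h3 := h3 (fun n => let: And4 _ _ a _ := cER n in a).
have {}h4 := h4 (fun n => let: And4 _ _ _ a := cER n in a).
rewrite /loop; exact: (cvgD (cvgB (cvgB h1 h2) h3) h4).
Qed.

Lemma contl_poly (P : {poly C}) : contl (fun s => P.[s]).
Proof.
by split => t; apply: is_cder_continuous; apply: is_cder_poly; exact: pth_cder.
Qed.

Lemma loop_poly (P : {poly C}) : loop (fun s => P.[s]) = 0.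
Proof.
have [Q QP] := poly_primitive P; have [c1 c2 c3 c4] := contl_poly P.
have dQ (c : path R) t : is_cder (fun t => Q.[pth c t]) t (P.[pth c t] * vel c t).
  by rewrite -QP; apply: is_cder_poly; exact: pth_cder.
rewrite /loop !(pint_FTC (F := fun s => Q.[s]))//.
rewrite /pint_end /pint_start /= fT fNT; ring.
Qed.

(** These conditions keep [p] off the infinite extensions of the edges as well. A pole to the left
    of the line Re s = s0 is allowed; its contribution is 0. *)
Definition good_pole p := [/\ - T < cIm p < T, cRe p < f (cIm p) & cRe p != s0].

Lemma good_pole_off p : good_pole p -> forall t,
  [/\ pth gam t != p, pth lin t != p, pth top t != p & pth bot t != p].
Proof.
move=> [/andP[i1 i2] r1 r2] t; split; apply/eqP => e; move: i1 i2 r1 r2; rewrite -e /=.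
- by rewrite ltxx.
- by rewrite eqxx.
- by rewrite ltxx.
- by rewrite ltxx.
Qed.

Lemma contl_pole p : good_pole p -> contl (fun s => (s - p)^-1).
Proof.
move=> gp; have off := good_pole_off gp.
have H (c : path R) : (forall t, pth c t != p) -> contp c (fun s => (s - p)^-1).
  move=> hc; apply: ccontV => [t|]; first by rewrite subr_eq0.
  by apply: ccontB; [exact: pth_cont|exact: ccont_cst].
by split; apply: H => t; case: (off t).
Qed.

(** log(s - p), called [F1], is cut along the ray to the left of [p], which only the line Re s = s0
    can cross. If it does, log(p - s), called [F2], serves as primitive there, and the two jumps at
    the ends of that line remain. *)
Lemma loop_pole p : good_pole p ->
  loop (fun s => (s - p)^-1) = if s0 < cRe p then 2 * cR pi * cI R else 0.
Proof.
move=> gp; have [c1 c2 c3 c4] := contl_pole gp.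
have [/andP[i1 i2] r1 r2] := gp.
pose F1 s := clog (s - p); pose F2 s := clog (p - s).
have dF1 (c : path R) t : (cIm (pth c t - p) != 0) || (0 < cRe (pth c t - p)) ->
    is_cder (fun t => F1 (pth c t)) t ((pth c t - p)^-1 * vel c t).
  move=> h; have d1 := is_cderD (pth_cder c t) (is_cder_cst (- p) t).
  have := is_cder_clog d1 h; apply: is_cder_eq.
  by rewrite addr0 mulrC.
have dF2 (c : path R) t : (cIm (p - pth c t) != 0) || (0 < cRe (p - pth c t)) ->
    is_cder (fun t => F2 (pth c t)) t ((pth c t - p)^-1 * vel c t).
  move=> h; have d1 := is_cderD (is_cder_cst p t) (is_cderN (pth_cder c t)).
  have := is_cder_clog d1 h; apply: is_cder_eq.
  by rewrite add0r -opprB invrN mulrNN mulrC.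
have eg : pint gam (fun s => (s - p)^-1) = F1 (pint_end gam) - F1 (pint_start gam).
  apply: pint_FTC => // t; apply: dF1.
  rewrite cImB cReB /= subr_eq0; case: eqVneq => //= ->.
  by rewrite subr_gt0.
have et : pint top (fun s => (s - p)^-1) = F1 (pint_end top) - F1 (pint_start top).
  apply: pint_FTC => // t; apply: dF1.
  by rewrite cImB /= subr_eq0 gt_eqF.
have eb : pint bot (fun s => (s - p)^-1) = F1 (pint_end bot) - F1 (pint_start bot).
  apply: pint_FTC => // t; apply: dF1.
  by rewrite cImB /= subr_eq0 lt_eqF.
rewrite /loop eg et eb; case: ifPn => [h|]; last first.
  rewrite -leNgt le_eqVlt (negbTE r2) /= => h.
  have -> : pint lin (fun s => (s - p)^-1) = F1 (pint_end lin) - F1 (pint_start lin).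
    apply: pint_FTC => // t; apply: dF1.
    by rewrite cImB cReB /= subr_gt0 h orbT.
  rewrite /pint_end /pint_start /= fT fNT; ring.
have -> : pint lin (fun s => (s - p)^-1) = F2 (pint_end lin) - F2 (pint_start lin).
  apply: pint_FTC => // t; apply: dF2.
  by rewrite cImB cReB /= subr_gt0 h orbT.
have e1 : F1 (pint_end lin) - F2 (pint_end lin) = cR pi * cI R.
  have := @clog_oppB _ (pint_end lin - p); rewrite opprB; apply.
  by rewrite cImB subr_gt0.
have e2 : F2 (pint_start lin) - F1 (pint_start lin) = cR pi * cI R.
  have := @clog_oppB _ (p - pint_start lin); rewrite opprB; apply.
  by rewrite cImB subr_gt0.
transitivity ((F1 (pint_end lin) - F2 (pint_end lin)) +
    (F2 (pint_start lin) - F1 (pint_start lin))).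
  rewrite /pint_end /pint_start /= fT fNT; ring.
by rewrite e1 e2; ring.
Qed.

Lemma loop_eq_off (S : seq C) g h : (forall p, p \in S -> good_pole p) ->
  (forall s, s \notin S -> g s = h s) -> loop g = loop h.
Proof.
move=> gS gh.
have H (c : path R) : (forall t, pth c t \notin S) -> pint c g = pint c h.
  by move=> hc; rewrite /pint; congr cint; apply/funext => t; rewrite gh.
by rewrite /loop !H// => t; apply/negP => /gS /good_pole_off /(_ t) []; rewrite eqxx.
Qed.

Lemma contl_inv_prod (S : seq C) : (forall p, p \in S -> good_pole p) ->
  contl (fun s => (\prod_(p <- S) (s - p))^-1).
Proof.
move=> gS.
have H (c : path R) : (forall p, good_pole p -> contp c (fun s => (s - p)^-1)) ->
    contp c (fun s => (\prod_(p <- S) (s - p))^-1).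
  move=> hc; elim: S gS => [|p S IH] gS.
    by rewrite /contp; under eq_fun do rewrite big_nil; exact: ccont_cst.
  rewrite /contp; under eq_fun do rewrite big_cons invfM.
  apply: ccontM; first by apply: hc; apply: gS; rewrite mem_head.
  by apply: IH => q qS; apply: gS; rewrite in_cons qS orbT.
by split; apply: H => p /contl_pole [].
Qed.

Theorem loop_rational (P : {poly C}) (S : seq C) : uniq S ->
  (forall p, p \in S -> good_pole p) ->
  loop (fun s => P.[s] / \prod_(p <- S) (s - p)) =
  2 * cR pi * cI R *
  \sum_(p <- S | s0 < cRe p) P.[p] / \prod_(q <- S | q != p) (p - q).
Proof.
move=> uS gS; have [Q hQ] := partial_fractions P uS.
rewrite (loop_eq_off gS hQ).
pose G p s : C := if p \in S then
  (P.[p] / \prod_(q <- S | q != p) (p - q)) * (s - p)^-1 else 0.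
have cG p : contl (G p).
  case pS : (p \in S); last first.
    have -> : G p = fun=> 0 by apply/funext => s; rewrite /G pS.
    exact: contl_cst.
  have -> : G p = fun s => (P.[p] / \prod_(q <- S | q != p) (p - q)) * (s - p)^-1.
    by apply/funext => s; rewrite /G pS.
  by apply: contlM; [exact: contl_cst|apply: contl_pole; exact: gS].
have -> : (fun s => Q.[s] + \sum_(p <- S) P.[p] / \prod_(q <- S | q != p) (p - q) / (s - p))
   = (fun s => Q.[s] + \sum_(p <- S) G p s).
  apply/funext => s; congr (_ + _); rewrite big_seq [RHS]big_seq.
  by apply: eq_bigr => p pS; rewrite /G pS.
rewrite loopD; [|exact: contl_poly|]; last first.
  by split; apply: contp_sum => p; case: (cG p).
rewrite loop_poly add0r loop_sum// mulr_sumr [RHS]big_mkcond /=.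
rewrite big_seq [RHS]big_seq; apply: eq_bigr => p pS.
have -> : G p = fun s => (P.[p] / \prod_(q <- S | q != p) (p - q)) * (s - p)^-1.
  by apply/funext => s; rewrite /G pS.
rewrite loopZ; last by apply: contl_pole; exact: gS.
rewrite loop_pole; last exact: gS.
by case: ifP => _; rewrite ?mulr0// mulrC.
Qed.

Theorem loop_exp_rational (a : C) (P : {poly C}) (S : seq C) : uniq S ->
  (forall p, p \in S -> good_pole p) ->
  loop (fun s => cexp (s * a) * (P.[s] / \prod_(p <- S) (s - p))) =
  2 * cR pi * cI R * \sum_(p <- S | s0 < cRe p)
    cexp (p * a) * (P.[p] / \prod_(q <- S | q != p) (p - q)).
Proof.
move=> uS gS.
(* The polynomials (1 + s a/n)^n tend to e^(a s) uniformly on bounded sets, so both sides of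
   [loop_rational], applied to [E n * P], converge. *)
pose E n : {poly C} := (1 + (a / n.+1%:R) *: 'X) ^+ n.+1.
have hE n s : (E n).[s] = (1 + (s * a) / n.+1%:R) ^+ n.+1.
  by rewrite /E horner_exp !hornerE; congr (_ ^+ _); congr (_ + _); ring.
pose rho s := P.[s] / \prod_(p <- S) (s - p).
have crho : contl rho.
  by apply: contlM; [exact: contl_poly|exact: contl_inv_prod].
have cexpl : contl (fun s => cexp (s * a)).
  by split; apply: ccont_cexp; apply: ccontM; [exact: pth_cont|exact: ccont_cst|
    exact: pth_cont|exact: ccont_cst|exact: pth_cont|exact: ccont_cst|
    exact: pth_cont|exact: ccont_cst].
have hb n s : 2 * nrm (s * a) <= n.+1%:R ->
    nrm ((E n).[s] - cexp (s * a)) <= 4 * expR (nrm (s * a)) * nrm (s * a) ^+ 2 / n.+1%:R.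
  by move=> h; rewrite nrm_distC hE; exact: cexp_powerB.
have hu (M e : R) : 0 < e -> \forall n \near \oo, forall s, nrm s <= M ->
    nrm ((E n).[s] - cexp (s * a)) <= e.
  move=> e0; pose B := `|M| * nrm a; pose D := 4 * expR B * B ^+ 2.
  have B0 : 0 <= B by rewrite mulr_ge0 ?nrm_ge0.
  have D0 : 0 <= D by rewrite /D mulr_ge0 ?exprn_ge0// mulr_ge0 ?expR_ge0.
  near=> n => s sM.
  have n0 : (0 : R) < n.+1%:R by rewrite ltr0n.
  have sB : nrm (s * a) <= B.
    by rewrite nrmM ler_wpM2r ?nrm_ge0// (le_trans sM)// ler_norm.
  have n1 : 2 * B <= n.+1%:R.
    apply: le_trans (_ : (n%:R : R) <= _); last by rewrite ler_nat.
    by near: n; exact: nbhs_infty_ger.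
  apply: le_trans (hb n s _) _; first by apply: le_trans n1; rewrite ler_wpM2l.
  apply: (@le_trans _ _ (D / n.+1%:R)).
    rewrite ler_pM2r ?invr_gt0// /D -!mulrA ler_wpM2l// ler_pM ?expR_ge0 ?exprn_ge0 ?nrm_ge0//.
      by rewrite ler_expR.
    by rewrite lerXn2r ?nnegrE ?nrm_ge0.
  rewrite ler_pdivrMr// mulrC -ler_pdivrMr//.
  apply: le_trans (_ : (n%:R : R) <= _); last by rewrite ler_nat.
  by near: n; exact: nbhs_infty_ger.
have cE n : contl (fun s => (E n).[s]) by exact: contl_poly.
have hu' (M e : R) : 0 < e -> \forall n \near \oo, forall s, nrm s <= M -> on_loop s ->
    nrm ((E n).[s] - cexp (s * a)) <= e.
  by move=> /hu - /(_ M); apply: filterS => n h s sM _; exact: h.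
have h1 := loop_cvgM cE cexpl crho hu'.
have h2 : 2 * cR pi * cI R * \sum_(p <- S | s0 < cRe p)
    (E n).[p] * (P.[p] / \prod_(q <- S | q != p) (p - q)) @[n --> \oo] -->
  2 * cR pi * cI R * \sum_(p <- S | s0 < cRe p)
    cexp (p * a) * (P.[p] / \prod_(q <- S | q != p) (p - q)).
  apply: cvgM; first exact: cvg_cst.
  apply: cvgC_sum => p; apply: cvgM; last exact: cvg_cst.
  apply/cvgCP => e e0; have := hu (nrm p) (e / 2) (divr_gt0 e0 (ltr0Sn _ _)).
  apply: filterS => n /(_ p (lexx _)); lra.
have e12 : (fun n => loop (fun s => (E n).[s] * rho s)) =
   (fun n => 2 * cR pi * cI R * \sum_(p <- S | s0 < cRe p)
    (E n).[p] * (P.[p] / \prod_(q <- S | q != p) (p - q))).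
  apply/funext => n; have := loop_rational (E n * P) uS gS.
  have -> : (fun s => (E n * P).[s] / \prod_(p <- S) (s - p)) =
      (fun s => (E n).[s] * rho s) by apply/funext => s; rewrite hornerM mulrA.
  by move=> ->; congr (_ * _); apply: eq_bigr => p _; rewrite hornerM mulrA.
rewrite e12 in h1; exact: cvgC_unique h1 h2.
Unshelve. all: by end_near. Qed.

End RectangularLoop.

(** * Gauss approximants of the integrand *)

Section GkApprox.
Variable R : realType.
Local Notation C := (C R).
Implicit Types (k : int) (s : C).

Definition halfabs k : C := (absz k)%:R / 2.

Lemma GkE k s : Gk k s = cI R ^+ absz k * rpowC (2 * pi) (1 - 2 * s) *
  (rgamma (1 - s + halfabs k) / rgamma (s + halfabs k)).
Proof. by rewrite /Gk /Gamma invrK -/(halfabs k) -!mulrA [rgamma _ * _]mulrC. Qed.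

Definition Gk_approx N k s : C := cI R ^+ absz k * rpowC (2 * pi) (1 - 2 * s) *
  (rgamma_approx (1 - s + halfabs k) N / rgamma_approx (s + halfabs k) N).

Lemma Gk_approx_cvg k s : rgamma (s + halfabs k) != 0 ->
  Gk_approx N k s @[N --> \oo] --> Gk k s.
Proof.
move=> g0; rewrite GkE; apply: cvgM; first exact: cvg_cst.
apply: cvgM; first exact: rgamma_cvg.
by apply: cvgV => //; exact: rgamma_cvg.
Qed.

(** The powers of N in the two Gauss products combine to N^(2s - 1), the contributions of |k|/2
    cancelling. [Gk_rate] collects the coefficient of s in the exponent, from N^(2s) and (2
    pi)^(-2s). *)
Definition Gk_const N k : C := cI R ^+ absz k * rpowC (2 * pi) 1 * (rpowC N%:R 1)^-1.
Definition Gk_rate N : C := 2 * (cR (ln N%:R) - cR (ln (2 * pi))).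

Lemma Gk_approxE N k s : (0 < N)%N -> Gk_approx N k s =
  Gk_const N k * cexp (s * Gk_rate N) * (\prod_(j < N.+1) (1 - s + halfabs k + j%:R) /
   \prod_(j < N.+1) (s + halfabs k + j%:R)).
Proof.
move=> N0; rewrite /Gk_approx /rgamma_approx.
set A := \prod_(_ < _) _; set B := \prod_(_ < _) _.
have f0 : N`!%:R != 0 :> C by rewrite pnatr_eq0 -lt0n fact_gt0.
have -> : rpowC N%:R (1 - s + halfabs k) =
    rpowC N%:R 1 * (rpowC N%:R s)^-1 * rpowC N%:R (halfabs k) by rewrite !rpowCD rpowCN.
have -> : rpowC N%:R (s + halfabs k) = rpowC N%:R s * rpowC N%:R (halfabs k).
  by rewrite rpowCD.
have -> : rpowC (2 * pi) (1 - 2 * s) = rpowC (2 * pi) 1 * cexp (s * (- 2 * cR (ln (2 * pi)))).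
  by rewrite rpowCD /rpowC; congr (_ * cexp _); ring.
have -> : cexp (s * Gk_rate N) = cexp (s * (- 2 * cR (ln (2 * pi)))) * rpowC N%:R s ^+ 2.
  by rewrite expr2 /rpowC -!cexpD /Gk_rate; congr cexp; ring.
have b0 := rpowC_neq0 (N%:R : R) s; have c0 := rpowC_neq0 (N%:R : R) (halfabs k).
have a0 := rpowC_neq0 (N%:R : R) 1; rewrite /Gk_const invf_div.
move: a0 b0 c0; move: (B^-1) => h.
set a := rpowC N%:R 1; set b := rpowC N%:R s; set c := rpowC N%:R (halfabs k).
set d := rpowC _ 1; set e := cexp _; set g := cI R ^+ _.
move: a b c d e g => a b c d e g a0 b0 c0; field.
by rewrite a0 b0 c0 f0.
Qed.

(** The residue of [Gk k] at s = - |k|/2 - kap, where (-1)^kap/kap! is the residue of Gamma at -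
    kap. It is reached as a limit of [Gk_res_approx], the residues of rational functions times
    exponentials. *)
Definition Gk_res k (kap : nat) : C :=
  cI R ^+ absz k * rpowC (2 * pi) (1 + 2 * halfabs k + 2 * kap%:R) *
  ((-1) ^+ kap / kap`!%:R) * rgamma (1 + 2 * halfabs k + kap%:R).

Definition Gk_res_approx N k (kap : nat) : C :=
  Gk_const N k * cexp ((- halfabs k - kap%:R) * Gk_rate N) *
  (\prod_(j < N.+1) (1 - (- halfabs k - kap%:R) + halfabs k + j%:R) /
   \prod_(j < N.+1 | j != kap :> nat) (- halfabs k - kap%:R + halfabs k + j%:R)).

Lemma prod_sub_neq (N kap : nat) : (kap <= N)%N ->
  \prod_(j < N.+1 | j != kap :> nat) (j%:R - kap%:R) =
  (-1) ^+ kap * kap`!%:R * (N - kap)`!%:R :> C.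
Proof.
move=> kN; rewrite -(big_mkord (fun j => j != kap) (fun j => j%:R - kap%:R)).
rewrite big_mkcond /= (@big_cat_nat _ _ _ kap.+1)//= big_nat_recr//= eqxx mulr1.
have -> : \prod_(0 <= i < kap) (if i != kap then i%:R - kap%:R else 1) =
    (-1) ^+ kap * kap`!%:R :> C.
  transitivity (\prod_(0 <= i < kap) (i%:R - kap%:R) : C).
    by apply: eq_big_nat => i /andP[_]; rewrite ltn_neqAle => /andP[->].
  elim: kap {kN} => [|k IH]; first by rewrite big_geq// mul1r.
  rewrite big_nat_recl// exprS factS natrM sub0r.
  under eq_bigr => i _ do rewrite -!natr1 opprD addrACA subrr addr0.
  by rewrite IH; ring.
congr (_ * _).
transitivity (\prod_(kap.+1 <= i < N.+1) (i%:R - kap%:R) : C).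
  by apply: eq_big_nat => i /andP[]; rewrite ltn_neqAle eq_sym => /andP[->].
rewrite -{1}[kap.+1]add0n big_addn subSS fact_prod natr_prod big_add1 /=.
by apply: eq_bigr => i _; rewrite addnS -addSn natrD; ring.
Qed.

Lemma Gk_res_approx_cvg k kap :
  Gk_res_approx N k kap @[N --> \oo] --> Gk_res k kap.
Proof.
(* N(N-1)...(N-kap+1)/N^kap. It accounts for the (N - kap)! left by deleting the vanishing factor,
   in place of the N! of the Gauss product. *)
pose ff N : C := \prod_(i < kap) (1 - i%:R * N%:R^-1).
have cff : ff N @[N --> \oo] --> (1 : C).
  have -> : (1 : C) = \prod_(i < kap) 1 by rewrite big1_eq.
  apply: cvgC_prod => i; rewrite -[X in _ --> X]subr0; apply: cvgB; first exact: cvg_cst.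
  rewrite -[X in _ --> X](mulr0 (i%:R : C)); apply: cvgM; first exact: cvg_cst.
  exact: cvgC_invn.
pose Q : C := cI R ^+ absz k * rpowC (2 * pi) (1 + 2 * halfabs k + 2 * kap%:R) *
  ((-1) ^+ kap / kap`!%:R).
have h : Q * (rgamma_approx (1 + 2 * halfabs k + kap%:R) N * ff N) @[N --> \oo] -->
    Q * (rgamma (1 + 2 * halfabs k + kap%:R) * 1).
  apply: cvgM; first exact: cvg_cst.
  by apply: cvgM; [exact: rgamma_cvg|exact: cff].
rewrite mulr1 in h; apply: cvg_trans h; apply: near_eq_cvg; near=> N.
have N0 : (0 < N)%N by near: N; exact: nbhs_infty_gt.
have kN : (kap <= N)%N by near: N; exact: nbhs_infty_ge.
have N0' : (0 : R) < N%:R by rewrite ltr0n.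
have n0 : N%:R != 0 :> C by rewrite pnatr_eq0 -lt0n.
have f0 m : m`!%:R != 0 :> C by rewrite pnatr_eq0 -lt0n fact_gt0.
have eff : ff N * N%:R ^+ kap * (N - kap)`!%:R = N`!%:R.
  rewrite /ff -[X in _ * N%:R ^+ X](card_ord kap) -prodr_const -big_split /=.
  rewrite -(ffact_fact kN) natrM; congr (_ * _).
  rewrite ffact_prod natr_prod; apply: eq_bigr => i _.
  rewrite natrB; last by apply: leq_trans kN; exact: ltnW.
  by rewrite mulrBl divfK// mul1r.
rewrite /Gk_res_approx.
under [X in _ / X]eq_bigr => j _.
  have -> : - halfabs k - kap%:R + halfabs k + j%:R = j%:R - kap%:R by ring.
  over.
rewrite prod_sub_neq//.
have -> : 1 - (- halfabs k - kap%:R) + halfabs k = 1 + 2 * halfabs k + kap%:R by ring.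
rewrite /rgamma_approx; set A := \prod_(_ < _) _.
have -> : rpowC N%:R (1 + 2 * halfabs k + kap%:R) =
    rpowC N%:R 1 * cexp (halfabs k * (2 * cR (ln N%:R))) * N%:R ^+ kap.
  rewrite !rpowCD rpowC_nat// cR_nat; congr (_ * _ * _).
  by rewrite /rpowC; congr cexp; ring.
have -> : cexp ((- halfabs k - kap%:R) * Gk_rate N) =
    rpowC (2 * pi) (2 * halfabs k + 2 * kap%:R) /
    (cexp (halfabs k * (2 * cR (ln N%:R))) * (N%:R ^+ kap * N%:R ^+ kap)).
  have -> : N%:R ^+ kap = rpowC N%:R kap%:R :> C by rewrite rpowC_nat// cR_nat.
  by rewrite /rpowC -!cexpD -cexpN -cexpD /Gk_rate; congr cexp; ring.
have -> : Q = cI R ^+ absz k * (rpowC (2 * pi) 1 *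
    rpowC (2 * pi) (2 * halfabs k + 2 * kap%:R)) * ((-1) ^+ kap / kap`!%:R).
  by rewrite -rpowCD addrA.
rewrite /Gk_const -eff.
have ff0 : ff N != 0.
  by apply: contraTneq (f0 N) => e; rewrite -eff e !mul0r eqxx.
have nk0 : N%:R ^+ kap != 0 :> C by rewrite expf_neq0.
have sg : (-1) ^+ kap * (-1) ^+ kap = 1 :> C by rewrite -exprMn mulrNN mulr1 expr1n.
have sg0 : (-1) ^+ kap != 0 :> C by rewrite expf_neq0// oppr_eq0 oner_eq0.
have sgV : ((-1) ^+ kap)^-1 = (-1) ^+ kap :> C.
  by apply: (mulfI sg0); rewrite divff// sg.
rewrite -{1}sgV.
move: (ff N) ff0 (N%:R ^+ kap) nk0 ((-1) ^+ kap) sg0 => F F0 G G0 S S0.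
have a0 := rpowC_neq0 (N%:R : R) 1; have b0 := cexp_neq0 (halfabs k * (2 * cR (ln N%:R))).
have c0 := f0 kap; have d0 := f0 (N - kap)%N.
set a := rpowC _ 1 in a0 *; set b := cexp _ in b0 *; set c := kap`!%:R in c0 *.
set d := (N - kap)`!%:R in d0 *.
set u := rpowC _ 1; set v := rpowC _ _; set w := cI R ^+ _.
move: a b c d u v w a0 b0 c0 d0 => a b c d u v w a0 b0 c0 d0.
field.
by rewrite F0 G0 S0 d0 c0 b0 a0.
Unshelve. all: by end_near. Qed.

End GkApprox.

Section UniformLimits.
Variable R : realType.
Local Notation C := (C R).

(** Boundedness of the limit belongs to the notion so that it is stable under products. *)
Definition unif_cvg (D : set C) (E : nat -> C -> C) (F : C -> C) :=
  (exists B : R, forall s, D s -> nrm (F s) <= B) /\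
  forall e : R, 0 < e -> \forall n \near \oo, forall s, D s -> nrm (E n s - F s) <= e.

Lemma unif_cvgM D E1 E2 F1 F2 : unif_cvg D E1 F1 -> unif_cvg D E2 F2 ->
  unif_cvg D (fun n s => E1 n s * E2 n s) (fun s => F1 s * F2 s).
Proof.
move=> [[B1 b1] u1] [[B2 b2] u2].
have b1' s : D s -> nrm (F1 s) <= `|B1| by move=> /b1 h; apply: le_trans h (ler_norm _).
have b2' s : D s -> nrm (F2 s) <= `|B2| by move=> /b2 h; apply: le_trans h (ler_norm _).
split.
  by exists (`|B1| * `|B2|) => s Ds; rewrite nrmM ler_pM ?nrm_ge0 ?b1' ?b2'.
move=> e e0; pose d := Num.min 1 (e / (`|B1| + `|B2| + 1)).
have D0 : 0 < `|B1| + `|B2| + 1 by have := normr_ge0 B1; have := normr_ge0 B2; lra.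
have d0 : 0 < d by rewrite lt_min ltr01 divr_gt0.
have d1 : d <= 1 by rewrite ge_min lexx.
have de : d * (`|B1| + `|B2| + 1) <= e by rewrite -ler_pdivlMr// ge_min lexx orbT.
apply: filterS2 (u1 _ d0) (u2 _ d0) => n h1 h2 s Ds.
have -> : E1 n s * E2 n s - F1 s * F2 s =
   (E1 n s - F1 s) * (E2 n s - F2 s) + F1 s * (E2 n s - F2 s) + (E1 n s - F1 s) * F2 s.
  by ring.
have {}h1 := h1 s Ds; have {}h2 := h2 s Ds.
apply: le_trans (nrmD _ _) _; apply: le_trans (lerD (nrmD _ _) (lexx _)) _.
rewrite !nrmM.
have k1 : nrm (E1 n s - F1 s) * nrm (E2 n s - F2 s) <= d * 1.
  by rewrite ler_pM ?nrm_ge0// (le_trans h2).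
have k2 : nrm (F1 s) * nrm (E2 n s - F2 s) <= `|B1| * d by rewrite ler_pM ?nrm_ge0 ?b1'.
have k3 : nrm (E1 n s - F1 s) * nrm (F2 s) <= d * `|B2| by rewrite ler_pM ?nrm_ge0 ?b2'.
lra.
Qed.

Lemma unif_cvg_cst D (F : C -> C) (B : R) : (forall s, D s -> nrm (F s) <= B) ->
  unif_cvg D (fun=> F) F.
Proof.
move=> b; split; first by exists B.
by move=> e e0; apply: nearW => n s _; rewrite subrr nrm0 ltW.
Qed.

Lemma unif_cvg_prod D (I : Type) (r : seq I) (E : I -> nat -> C -> C) (F : I -> C -> C) :
  (forall i, unif_cvg D (E i) (F i)) ->
  unif_cvg D (fun n s => \prod_(i <- r) E i n s) (fun s => \prod_(i <- r) F i s).
Proof.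
move=> u; elim: r => [|i r IH].
  have -> : (fun (n : nat) s => \prod_(i <- [::]) E i n s) = (fun=> fun=> 1).
    by apply/funext => n; apply/funext => s; rewrite big_nil.
  have -> : (fun s => \prod_(i <- [::]) F i s) = (fun=> 1).
    by apply/funext => s; rewrite big_nil.
  by apply: (@unif_cvg_cst _ _ 1) => s _; rewrite nrm1.
have -> : (fun (n : nat) s => \prod_(j <- i :: r) E j n s) =
    (fun n s => E i n s * \prod_(j <- r) E j n s).
  by apply/funext => n; apply/funext => s; rewrite big_cons.
have -> : (fun s => \prod_(j <- i :: r) F j s) = (fun s => F i s * \prod_(j <- r) F j s).
  by apply/funext => s; rewrite big_cons.
exact: unif_cvgM.
Qed.

Lemma unif_cvg_rgamma D (h : C -> C) (B : R) : (forall s, D s -> nrm (h s) <= B) ->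
  unif_cvg D (fun n s => rgamma_approx (h s) n) (fun s => rgamma (h s)).
Proof.
move=> hB; have hB' s : D s -> nrm (h s) <= `|B| + 1.
  by move=> /hB; have := ler_norm B; lra.
have B0 : 0 < `|B| + 1 by have := normr_ge0 B; lra.
have [[A hA] _] := @ucball_rgamma R _ B0.
split; first by exists A => s Ds; exact: hA (hB' s Ds).
move=> e e0.
have A0 : 0 <= A by apply: le_trans (hA 0 _); rewrite ?nrm_ge0 ?nrm0 ?ltW.
pose d := Num.min (1 / 2) (e / (2 * (A + 1))).
have d0 : 0 < d by rewrite lt_min !divr_gt0//; lra.
have d1 : d <= 1 / 2 by rewrite ge_min lexx.
have de : d * (2 * (A + 1)) <= e.
  by rewrite -ler_pdivlMr ?mulr_gt0//; [rewrite ge_min lexx orbT|lra].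
have [N hN] := rgamma_tail_small (ltW B0) d0.
near=> n => s Ds.
have nN : (N <= n)%N by near: n; exact: nbhs_infty_ge.
have := hN _ _ (hB' s Ds) nN; rewrite nrm_distC => h1.
have h2 : nrm (rgamma_approx (h s) n) <= nrm (rgamma (h s)) + nrm (rgamma_approx (h s) n - rgamma (h s)).
  by have := nrm_triB (rgamma_approx (h s) n) (rgamma (h s)); lra.
have h3 := hA _ (hB' s Ds).
have := nrm_ge0 (rgamma_approx (h s) n); nra.
Unshelve. all: by end_near. Qed.

(** Here the relative form of the error pays off: the quotient tends to 1 uniformly even where
    [rgamma] comes close to its zeros. *)
Lemma unif_cvg_rgamma_ratio (D : set C) (h : C -> C) (B : R) :
  (forall s, D s -> nrm (h s) <= B) ->
  (forall s, D s -> forall j : nat, h s + j%:R != 0) ->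
  unif_cvg D (fun n s => rgamma (h s) / rgamma_approx (h s) n) (fun=> 1).
Proof.
move=> hB hj; have hB' s : D s -> nrm (h s) <= `|B|.
  by move=> /hB /le_trans; apply; exact: ler_norm.
split; first by exists 1 => s _; rewrite nrm1.
move=> e e0; have [N hN] := rgamma_tail_small (normr_ge0 B) e0.
near=> n => s Ds.
have nN : (N <= n)%N by near: n; exact: nbhs_infty_ge.
have a0 : rgamma_approx (h s) n != 0 by apply: rgamma_approx_neq0; exact: hj.
have := hN _ _ (hB' s Ds) nN => h1.
have -> : rgamma (h s) / rgamma_approx (h s) n - 1 =
   (rgamma (h s) - rgamma_approx (h s) n) / rgamma_approx (h s) n.
  by rewrite mulrBl divff.
by rewrite nrmf_div ler_pdivrMr ?nrm_gt0// mulrC.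
Unshelve. all: by end_near. Qed.

End UniformLimits.

Section Integrand.
Variables (R : realType) (n : nat).
Local Notation C := (C R).
Implicit Types (mu : 'I_n -> C) (M : 'I_n -> int) (s : C).

(** The poles descend in unit steps, whereas the contour condition lists points in steps of 1/2;
    pole number [kap] is the point kappa = 2 kap there. *)
Definition apole mu M (l : 'I_n) (kap : nat) : C := mu l - halfabs R (M l) - kap%:R.

Definition Hfun mu M (x : R) s : C := Gmu mu M s * rpowC x (- 2 * s).

Definition Hres mu M (x : R) (l : 'I_n) (kap : nat) : C :=
  (\prod_(q < n | q != l) Gk (M q) (apole mu M l kap - mu q)) *
  Gk_res R (M l) kap * rpowC x (- 2 * apole mu M l kap).

Definition simple_poles mu M := forall l q : 'I_n, l != q ->
  forall i j : nat, apole mu M l i != apole mu M q j.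

Definition Hfun_approx mu M (x : R) N s : C :=
  (\prod_(l < n) Gk_approx N (M l) (s - mu l)) * rpowC x (- 2 * s).

Definition Hres_approx mu M (x : R) N (l : 'I_n) (kap : nat) : C :=
  (\prod_(q < n | q != l) Gk_approx N (M q) (apole mu M l kap - mu q)) *
  Gk_res_approx R N (M l) kap * rpowC x (- 2 * apole mu M l kap).

Lemma shift_apole mu M l (j : nat) s :
  s - mu l + halfabs R (M l) + j%:R = s - apole mu M l j.
Proof. by rewrite /apole; ring. Qed.

Lemma rgamma_denom_neq0 mu M l s : (forall j, s != apole mu M l j) ->
  rgamma (s - mu l + halfabs R (M l)) != 0.
Proof.
by move=> sp; apply: rgamma_neq0 => j; rewrite shift_apole subr_eq0 sp.
Qed.

Lemma apole_inj mu M l : injective (apole mu M l).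
Proof.
move=> i j /addrI /oppr_inj /eqP; rewrite eqr_nat => /eqP; exact.
Qed.

Section Approximant.
Variables (mu : 'I_n -> C) (M : 'I_n -> int) (x : R) (N : nat).
Hypothesis N0 : (0 < N)%N.

Let rate : C := Gk_rate R N.
(** The approximant becomes a constant times one exponential times a rational function, the form of
    [loop_exp_rational]. The exponent [alpha] gathers n Gauss rates and the factor x^(-2s). *)
Let K : C := \prod_(l < n) (Gk_const R N (M l) * cexp (- mu l * rate)).
Let alpha : C := n%:R * rate - 2 * cR (ln x).
Let num s (l : 'I_n) : C := \prod_(j < N.+1) (1 - (s - mu l) + halfabs R (M l) + j%:R).
Let Pn : {poly C} :=
  \prod_(l < n) \prod_(j < N.+1) ((1 + mu l + halfabs R (M l) + j%:R)%:P - 'X).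
Let Sn : seq C :=
  map (fun i : 'I_n * 'I_N.+1 => apole mu M i.1 i.2) (enum {: 'I_n * 'I_N.+1}).

Let PnE s : Pn.[s] = \prod_(l < n) num s l.
Proof.
rewrite /Pn horner_prod; apply: eq_bigr => l _; rewrite horner_prod.
by apply: eq_bigr => j _; rewrite hornerD hornerC hornerN hornerX; ring.
Qed.

Let prefactor s : K * cexp (s * alpha) =
  (\prod_(l < n) (Gk_const R N (M l) * cexp ((s - mu l) * rate))) * rpowC x (- 2 * s).
Proof.
have -> : cexp (s * alpha) = (\prod_(l < n) cexp (s * rate)) * rpowC x (- 2 * s).
  rewrite prodr_const card_ord -cexpMn /rpowC -cexpD; congr cexp.
  by rewrite /alpha; ring.
rewrite mulrA /K -big_split /=; congr (_ * _); apply: eq_bigr => l _.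
by rewrite -mulrA -cexpD; congr (_ * cexp _); ring.
Qed.

Let Hfun_approxE s : Hfun_approx mu M x N s =
  K * (cexp (s * alpha) * (Pn.[s] / \prod_(p <- Sn) (s - p))).
Proof.
rewrite mulrA prefactor /Hfun_approx PnE /Sn big_map big_enum /=.
rewrite -(pair_bigA _ (fun l (j : 'I_N.+1) => s - apole mu M l j)) /=.
rewrite mulrAC; congr (_ * _).
rewrite -prodfV -big_split -big_split /=; apply: eq_bigr => l _; rewrite Gk_approxE//.
by congr (_ * (_ / _)); apply: eq_bigr => j _; rewrite shift_apole.
Qed.

Hypothesis simp : simple_poles mu M.

Let pole_inj : injective (fun i : 'I_n * 'I_N.+1 => apole mu M i.1 i.2).
Proof.
move=> [l i] [q j] /= e; have [lq|/simp /(_ i j)] := eqVneq l q; last by rewrite e eqxx.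
by move: e; rewrite lq => /apole_inj /val_inj ->.
Qed.

Let uniq_approx_poles : uniq Sn.
Proof. by rewrite map_inj_uniq ?enum_uniq//; exact: pole_inj. Qed.

(** Since the poles are pairwise distinct, deleting [p] from [Sn] removes one factor from block [l]
    and none from the other blocks. *)
Let Hres_approxE l (kap : 'I_N.+1) p : p = apole mu M l kap -> Hres_approx mu M x N l kap =
  K * (cexp (p * alpha) * (Pn.[p] / \prod_(q <- Sn | q != p) (p - q))).
Proof.
move=> ep; rewrite mulrA prefactor PnE /Sn big_map big_enum_cond /=.
have -> : \prod_(i : 'I_n * 'I_N.+1 | apole mu M i.1 i.2 != p) (p - apole mu M i.1 i.2) =
   \prod_(q < n) \prod_(j < N.+1 | (q != l) || (j != kap)) (p - apole mu M q j).
  rewrite pair_big_dep /=; apply: eq_bigl => -[q j] /=.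
  by rewrite ep (inj_eq pole_inj (q, j) (l, kap)) xpair_eqE negb_and.
rewrite (bigD1 l)//= [X in _ * (X / _)](bigD1 l)//= [X in _ / X](bigD1 l)//= eqxx /=.
have -> : \prod_(i < n | i != l) \prod_(j < N.+1 | (i != l) || (j != kap)) (p - apole mu M i j)
  = \prod_(i < n | i != l) \prod_(j < N.+1) (p - mu i + halfabs R (M i) + j%:R).
  apply: eq_bigr => q ql; rewrite ql /=; apply: eq_bigr => j _.
  by rewrite shift_apole.
rewrite /Hres_approx -ep.
have pm : p - mu l = - halfabs R (M l) - kap%:R by rewrite ep /apole; ring.
have -> : \prod_(j < N.+1 | j != kap) (p - apole mu M l j) =
   \prod_(j < N.+1 | j != kap :> nat) (- halfabs R (M l) - kap%:R + halfabs R (M l) + j%:R).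
  by apply: eq_bigr => j _; rewrite -pm shift_apole.
have -> : \prod_(q < n | q != l) Gk_approx N (M q) (p - mu q) =
   (\prod_(q < n | q != l) (Gk_const R N (M q) * cexp ((p - mu q) * rate))) *
   ((\prod_(q < n | q != l) num p q) /
    \prod_(q < n | q != l) \prod_(j < N.+1) (p - mu q + halfabs R (M q) + j%:R)).
  rewrite -prodfV -big_split -big_split /=; apply: eq_bigr => q _.
  by rewrite Gk_approxE.
rewrite /Gk_res_approx -/rate -pm /num invfM; ring.
Qed.

Lemma loop_Hfun_approx (f f' : R -> R) (sigma s0 T : R)
    (df : forall t : R, is_derive t 1 f (f' t)) (cf : continuous f')
    (T0 : - T < T) (s0_lt : s0 < sigma) : f T = sigma -> f (- T) = sigma ->
  (forall l j, good_pole f s0 T (apole mu M l j)) ->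
  loop df cf T0 s0_lt (Hfun_approx mu M x N) =
  2 * cR pi * cI R * \sum_(l < n) \sum_(j < N.+1 | s0 < cRe (apole mu M l j))
    Hres_approx mu M x N l j.
Proof.
move=> fT fNT gp.
have gS p : p \in Sn -> good_pole f s0 T p.
  by move=> /mapP[[l j] _ ->]; exact: gp.
have -> : Hfun_approx mu M x N =
    (fun s => K * (cexp (s * alpha) * (Pn.[s] / \prod_(p <- Sn) (s - p)))).
  by apply/funext => s; exact: Hfun_approxE.
rewrite loopZ; last first.
  apply: contlM.
    by split; apply: ccont_cexp; apply: ccontM; [exact: pth_cont|exact: ccont_cst|
      exact: pth_cont|exact: ccont_cst|exact: pth_cont|exact: ccont_cst|
      exact: pth_cont|exact: ccont_cst].
  by apply: contlM; [exact: contl_poly|exact: contl_inv_prod].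
rewrite loop_exp_rational// mulrCA mulr_sumr big_map big_enum_cond /=; congr (_ * _).
rewrite pair_big_dep /=; apply: eq_bigr => -[l j] /= _.
by rewrite (Hres_approxE erefl).
Qed.

End Approximant.
End Integrand.

Section LoopOfIntegrand.
Variables (R : realType) (n : nat).
Local Notation C := (C R).
Variables (f f' : R -> R) (sigma s0 T : R).
Variables (df : forall t : R, is_derive t 1 f (f' t)) (cf : continuous f').
Variables (T0 : - T < T) (s0_lt : s0 < sigma) (fT : f T = sigma) (fNT : f (- T) = sigma).

Local Notation ol := (on_loop df cf T0 s0_lt).
Local Notation contl := (contl df cf T0 s0_lt).
Local Notation loop := (loop df cf T0 s0_lt).

Lemma loop_eq_on (g h : C -> C) : (forall s, ol s -> g s = h s) -> loop g = loop h.
Proof.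
move=> gh.
have H (c : path R) : (forall t, ol (pth c t)) -> pint c g = pint c h.
  by move=> hc; rewrite /pint; congr cint; apply/funext => t; rewrite gh.
have h1 := H _ (fun t => ex_intro _ t (Or41 _ _ _ erefl)).
have h2 := H _ (fun t => ex_intro _ t (Or42 _ _ _ erefl)).
have h3 := H _ (fun t => ex_intro _ t (Or43 _ _ _ erefl)).
have h4 := H _ (fun t => ex_intro _ t (Or44 _ _ _ erefl)).
by rewrite /loop h1 h2 h3 h4.
Qed.

Lemma contl_id : contl (fun s => s).
Proof. by split; exact: pth_cont. Qed.

Lemma contlD g h : contl g -> contl h -> contl (fun s => g s + h s).
Proof.
move=> [g1 g2 g3 g4] [h1 h2 h3 h4].
split; [exact: (ccontD g1 h1)|exact: (ccontD g2 h2)|exact: (ccontD g3 h3)|exact: (ccontD g4 h4)].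
Qed.

Lemma contl_ucball (phi h : C -> C) : ucball phi -> contl h -> contl (fun s => phi (h s)).
Proof.
move=> up [h1 h2 h3 h4].
split; [exact: (ccont_ucball up h1)|exact: (ccont_ucball up h2)|
  exact: (ccont_ucball up h3)|exact: (ccont_ucball up h4)].
Qed.

Lemma contl_inv (g : C -> C) : (forall s, ol s -> g s != 0) -> contl g ->
  contl (fun s => (g s)^-1).
Proof.
move=> g0 [g1 g2 g3 g4]; split.
- by apply: (ccontV _ g1) => t; apply: g0; exists t; exact: Or41.
- by apply: (ccontV _ g2) => t; apply: g0; exists t; exact: Or42.
- by apply: (ccontV _ g3) => t; apply: g0; exists t; exact: Or43.
- by apply: (ccontV _ g4) => t; apply: g0; exists t; exact: Or44.
Qed.

Lemma contl_prod (I : Type) (r : seq I) (F : I -> C -> C) :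
  (forall i, contl (F i)) -> contl (fun s => \prod_(i <- r) F i s).
Proof.
move=> cF; elim: r => [|i r IH].
  have -> : (fun s => \prod_(i <- [::]) F i s) = (fun=> 1).
    by apply/funext => s; rewrite big_nil.
  exact: contl_cst.
have -> : (fun s => \prod_(j <- i :: r) F j s) = (fun s => F i s * \prod_(j <- r) F j s).
  by apply/funext => s; rewrite big_cons.
exact: (contlM (cF i) IH).
Qed.

Lemma contl_affine (a b : C) : contl (fun s => a * s + b).
Proof.
apply: contlD; last exact: contl_cst.
by apply: contlM; [exact: contl_cst|exact: contl_id].
Qed.

Variables (mu : 'I_n -> C) (M : 'I_n -> int) (x : R).
Hypothesis gp : forall l j, good_pole f s0 T (apole mu M l j).

Lemma on_loop_off s : ol s -> forall l j, s != apole mu M l j.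
Proof.
move=> [t ht] l j; have [h1 h2 h3 h4] := good_pole_off df cf T0 s0_lt (gp l j) t.
by case: ht => ->.
Qed.

Let den l s : C := s - mu l + halfabs R (M l).
Let nume l s : C := 1 - (s - mu l) + halfabs R (M l).
(** The approximant is split as [E N * rho], where the fixed [rho] contains the inverses of
    [rgamma (den l s)]. Denominators enter [E N] only through quotients tending to 1, so it
    converges uniformly on bounded parts of the loop. *)
Let E N s : C := \prod_(l < n) (rgamma_approx (nume l s) N *
   (rgamma (den l s) / rgamma_approx (den l s) N)).
Let F s : C := \prod_(l < n) (rgamma (nume l s) * 1).
Let rho s : C := (\prod_(l < n) (cI R ^+ absz (M l) * rpowC (2 * pi) (1 - 2 * (s - mu l)) *
   (rgamma (den l s))^-1)) * rpowC x (- 2 * s).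

Let den_neq0 l s : ol s -> rgamma (den l s) != 0.
Proof. by move=> os; apply: rgamma_denom_neq0; exact: on_loop_off. Qed.

Let contl_den l : contl (den l).
Proof.
have -> : den l = fun s => 1 * s + (- mu l + halfabs R (M l)).
  by apply/funext => s; rewrite /den; ring.
exact: contl_affine.
Qed.

Let contl_nume l : contl (nume l).
Proof.
have -> : nume l = fun s => (-1) * s + (1 + mu l + halfabs R (M l)).
  by apply/funext => s; rewrite /nume; ring.
exact: contl_affine.
Qed.

Let contl_E N : contl (E N).
Proof.
apply: contl_prod => l; apply: contlM.
  exact: (contl_ucball (@ucball_rgamma_approx R N) (contl_nume l)).
apply: contlM; first exact: (contl_ucball (@ucball_rgamma R) (contl_den l)).
apply: contl_inv; last exact: (contl_ucball (@ucball_rgamma_approx R N) (contl_den l)).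
move=> s os; apply: rgamma_approx_neq0 => j.
by rewrite shift_apole subr_eq0 on_loop_off.
Qed.

Let contl_F : contl F.
Proof.
apply: contl_prod => l; apply: contlM; last exact: contl_cst.
exact: (contl_ucball (@ucball_rgamma R) (contl_nume l)).
Qed.

Let contl_rpow (y : R) (a b : C) : contl (fun s => rpowC y (a * s + b)).
Proof. exact: (contl_ucball (ucball_cexp (cR (ln y))) (contl_affine a b)). Qed.

Let contl_rho : contl rho.
Proof.
apply: contlM; last first.
  have -> : (fun s => rpowC x (- 2 * s)) = fun s => rpowC x (- 2 * s + 0).
    by apply/funext => s; rewrite addr0.
  exact: contl_rpow.
apply: contl_prod => l; apply: contlM; last first.
  apply: contl_inv; first exact: den_neq0.
  exact: (contl_ucball (@ucball_rgamma R) (contl_den l)).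
apply: contlM; first exact: contl_cst.
have -> : (fun s => rpowC (2 * pi) (1 - 2 * (s - mu l))) =
    fun s => rpowC (2 * pi) (- 2 * s + (1 + 2 * mu l)).
  by apply/funext => s; congr rpowC; ring.
exact: contl_rpow.
Qed.

Let EF_cvg (B e : R) : 0 < e -> \forall N \near \oo, forall s, nrm s <= B -> ol s ->
  nrm (E N s - F s) <= e.
Proof.
pose D : set C := fun s => nrm s <= B /\ ol s.
have bd l s : D s -> nrm (den l s) <= B + nrm (mu l) + nrm (halfabs R (M l)).
  move=> [sB _]; apply: le_trans (nrmD _ _) _; rewrite lerD2r.
  by apply: le_trans (nrmB _ _) _; rewrite lerD2r.
have bn l s : D s -> nrm (nume l s) <= 1 + (B + nrm (mu l)) + nrm (halfabs R (M l)).
  move=> [sB _]; apply: le_trans (nrmD _ _) _; rewrite lerD2r.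
  apply: le_trans (nrmB _ _) _; rewrite nrm1 lerD2l.
  by apply: le_trans (nrmB _ _) _; rewrite lerD2r.
have [_ h] : unif_cvg D E F.
  apply: unif_cvg_prod => l; apply: unif_cvgM; first exact: unif_cvg_rgamma (bn l).
  apply: (unif_cvg_rgamma_ratio (bd l)) => s [_ os] j.
  by rewrite shift_apole subr_eq0 on_loop_off.
by move=> /h; apply: filterS => N hN s sB os; exact: hN.
Qed.

Let Hfun_rho s : F s * rho s = Hfun mu M x s.
Proof.
rewrite /Hfun /Gmu /rho mulrA /F -big_split /=; congr (_ * _); apply: eq_bigr => l _.
by rewrite GkE -/(nume l s) -/(den l s); ring.
Qed.

Lemma loop_Hfun_cvg : loop (Hfun_approx mu M x N) @[N --> \oo] --> loop (Hfun mu M x).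
Proof.
have h := loop_cvgM contl_E contl_F contl_rho EF_cvg.
have e1 : loop (Hfun mu M x) = loop (fun s => F s * rho s).
  by apply: loop_eq_on => s _; rewrite Hfun_rho.
have e2 : (fun N => loop (Hfun_approx mu M x N)) = (fun N => loop (fun s => E N s * rho s)).
  apply/funext => N; apply: loop_eq_on => s os.
  rewrite /Hfun_approx /rho mulrA /E -big_split /=; congr (_ * _); apply: eq_bigr => l _.
  rewrite /Gk_approx -/(nume l s) -/(den l s).
  have := den_neq0 l os; move: (rgamma (den l s)) => z z0.
  by move: ((rgamma_approx (den l s) N)^-1) => w; field.
by rewrite e1 e2.
Qed.

Lemma halfabs_im (k : int) : cIm (halfabs R k) = 0.
Proof. by rewrite /halfabs -(cR_nat R) -(cR_nat R 2) -cRV -cRM. Qed.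
Lemma halfabs_re (k : int) : cRe (halfabs R k) = (absz k)%:R / 2.
Proof. by rewrite /halfabs -(cR_nat R) -(cR_nat R 2) -cRV -cRM. Qed.
Lemma apole_im l j : cIm (apole mu M l j) = cIm (mu l).
Proof. by rewrite /apole !cImB halfabs_im cIm_nat !subr0. Qed.
Lemma apole_re l j : cRe (apole mu M l j) = cRe (mu l) - (absz (M l))%:R / 2 - j%:R.
Proof. by rewrite /apole !cReB halfabs_re cRe_nat. Qed.

(** Only finitely many poles lie to the right of s0, and [K0] bounds their index. The limit in N
    thus acts on a fixed finite sum of residues. *)
Theorem loop_Hfun (K0 : nat) : simple_poles mu M ->
  (forall l j, (K0 <= j)%N -> cRe (apole mu M l j) <= s0) ->
  loop (Hfun mu M x) = 2 * cR pi * cI R *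
   \sum_(l < n) \sum_(j < K0 | s0 < cRe (apole mu M l j)) Hres mu M x l j.
Proof.
move=> simp hK; apply: cvgC_unique loop_Hfun_cvg _.
have h : 2 * cR pi * cI R * \sum_(l < n) \sum_(j < K0 | s0 < cRe (apole mu M l j))
     Hres_approx mu M x N l j @[N --> \oo] -->
   2 * cR pi * cI R *
   \sum_(l < n) \sum_(j < K0 | s0 < cRe (apole mu M l j)) Hres mu M x l j.
  apply: cvgM; first exact: cvg_cst.
  apply: cvgC_sum => l; apply: cvgC_sum => j.
  rewrite /Hres_approx /Hres; apply: cvgM; last exact: cvg_cst.
  apply: cvgM; last exact: Gk_res_approx_cvg.
  rewrite big_mkcond /=.
  have -> : (fun N => \prod_(q < n | q != l) Gk_approx N (M q) (apole mu M l j - mu q)) =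
     (fun N => \prod_(q < n) if q != l then Gk_approx N (M q) (apole mu M l j - mu q) else 1).
    by apply/funext => N; rewrite big_mkcond.
  apply: cvgC_prod => q; case: ifPn => ql; last exact: cvg_cst.
  apply: Gk_approx_cvg; apply: rgamma_denom_neq0 => i.
  by rewrite eq_sym; exact: simp.
apply: cvg_trans h; apply: near_eq_cvg; near=> N.
have N0 : (0 < N)%N by near: N; exact: nbhs_infty_gt.
have KN : (K0 <= N.+1)%N.
  by apply: leq_trans (leqnSn N); near: N; exact: nbhs_infty_ge.
rewrite loop_Hfun_approx//; congr (_ * _); apply: eq_bigr => l _.
rewrite -(big_mkord (fun j => s0 < cRe (apole mu M l j)) (fun j => Hres_approx mu M x N l j)).
rewrite -(big_mkord (fun j => s0 < cRe (apole mu M l j)) (fun j => Hres_approx mu M x N l j)).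
rewrite [RHS](@big_cat_nat _ _ _ K0)//= [X in _ + X]big_nat_cond [X in _ + X]big1 ?addr0//.
move=> j /andP[/andP[Kj _]]; rewrite ltNge hK//.
Unshelve. all: by end_near. Qed.

End LoopOfIntegrand.

(** * Integrals over the whole line *)

Section FullLine.
Variable R : realType.
Local Notation C := (C R).
Local Notation mu := (@lebesgue_measure R).
Implicit Types (u w : R -> R) (g : R -> C) (t : R).

(** The integrable majorant (1 + |t|)^(-1-d) against which every integrand is measured; for contour
    integrals [d] is the margin that the real part of the vertical ends leaves. *)
Definition omega (d t : R) : R := expR (- (1 + d) * ln (1 + `|t|)).

Let pos1 t : 0 < 1 + `|t|. Proof. by have := normr_ge0 t; lra. Qed.

Lemma omega_gt0 d t : 0 < omega d t. Proof. exact: expR_gt0. Qed.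

Lemma continuous_omega d : continuous (omega d).
Proof.
move=> t; rewrite /omega.
have h1 : ln (1 + `|x|) @[x --> t] --> ln (1 + `|t|).
  have h : 1 + `|x| @[x --> t] --> 1 + `|t|.
    by apply: cvgD; [exact: cvg_cst|exact: norm_continuous].
  exact: (cvg_comp _ _ h (continuous_ln (pos1 t))).
have h2 : - (1 + d) * ln (1 + `|x|) @[x --> t] --> - (1 + d) * ln (1 + `|t|).
  by apply: cvgM; [exact: cvg_cst|exact: h1].
exact: (cvg_comp _ _ h2 (@continuous_expR R _)).
Qed.

Lemma measurable_continuousR u : continuous u -> measurable_fun setT u.
Proof. exact: continuous_measurable_fun. Qed.

Lemma omega_integrable d : 0 < d -> mu.-integrable setT (EFin \o omega d).
Proof.
move=> d0; apply/integrableP; split.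
  by apply/measurable_EFinP; exact: (measurable_continuousR (@continuous_omega d)).
have -> : (\int[mu]_x `|(EFin \o omega d) x|)%E = (\int[mu]_x (omega d x)%:E)%E.
  by apply: eq_integral => t _ /=; rewrite ger0_norm// ltW// omega_gt0.
rewrite ge0_symfun_integralT; last 3 first.
- by move=> t; rewrite ltW// omega_gt0.
- exact: (@continuous_omega d).
- by move=> t; rewrite /omega /= normrN.
pose F t := - (d^-1) * expR (- d * ln (1 + t)).
have dF t : 0 <= t -> is_derive t 1 F (expR (- (1 + d) * ln (1 + t))).
  move=> t0; have p1 : 0 < 1 + t by lra.
  have h1 : is_derive (1 + t) 1 (@ln R) (1 + t)^-1 by exact: is_derive1_ln.
  have h2 : is_derive t 1 (fun t => 1 + t : R) 1 by rewrite -[X in is_derive _ _ _ X]add0r; exact: is_deriveD.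
  have h3 := @is_derive1_comp R (@ln R) (fun t => 1 + t) t _ _ h1 h2.
  have h4 := is_deriveZ (- d) h3.
  have h5 := @is_derive1_comp R (@expR R) _ t _ _ (is_derive_expR _) h4.
  have h6 := is_deriveZ (- d^-1) h5.
  apply: is_derive_eq h6 _; rewrite /GRing.scale /= /= mulr1.
  rewrite /GRing.scale /=.
  have -> : - (1 + d) * ln (1 + t) = - ln (1 + t) - d * ln (1 + t) by ring.
  rewrite expRD expRN lnK ?posrE// -mulNr; move: (expR _) => E.
  by field; rewrite ?gt_eqF.
have F0 : F t @[t --> +oo] --> 0.
  rewrite /F -[X in _ --> X](mulr0 (- d^-1)); apply: cvgM; first exact: cvg_cst.
  have hl : (ln (1 + t) : R) @[t --> (+oo)%R] --> (+oo)%R.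
    apply/cvgryPge => A; near=> t.
    have t1 : expR A <= t by near: t; apply: nbhs_pinfty_ge; rewrite num_real.
    rewrite -(expRK A) ler_ln ?posrE ?expR_gt0//; last by have := expR_gt0 A; lra.
    by rewrite (le_trans t1)// lerDr.
  have hd : (d * ln (1 + t) : R) @[t --> +oo] --> +oo by exact: (gt0_cvgMry d0 hl).
  have := cvg_comp _ _ hd (@cvgr_expR R).
  by under [X in _ -> X @ _ --> _]eq_fun do rewrite mulNr.
have -> : [set x | 0 <= x] = `[0, +oo[%classic :> set R by rewrite set_itvcy.
rewrite (@ge0_continuous_FTC2y _ _ F 0 0).
- by rewrite -EFinB -EFinM ltry.
- by move=> t _; rewrite ltW// omega_gt0.
- apply: continuous_subspaceT; exact: (@continuous_omega d).
- exact: F0.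
- by move=> t t0; have h := dF t (ltW t0); exact: ex_derive.
- have h := dF 0 (lexx 0); apply: cvg_at_right_filter.
  by apply: differentiable_continuous; apply/derivable1_diffP; exact: ex_derive.
- move=> t; rewrite in_itv /= andbT => t0; have h := dF t (ltW t0).
  by rewrite derive1E (@derive_val _ _ _ _ _ _ _ h) /omega ger0_norm// ltW.
Unshelve. all: by end_near. Qed.

Lemma dominated_Rintegral (u_ : nat -> R -> R) u w :
  (forall n, measurable_fun setT (u_ n)) -> measurable_fun setT u ->
  (forall t, u_ n t @[n --> \oo] --> u t) ->
  (forall n t, `|u_ n t| <= w t) -> mu.-integrable setT (EFin \o w) ->
  Rintegral mu setT (u_ n) @[n --> \oo] --> Rintegral mu setT u.
Proof.
move=> mu_ mu0 cu uw iw.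
have h1 : {ae mu, forall x : R, setT x -> (u_ n x)%:E @[n --> \oo] --> (u x)%:E}.
  by apply: aeW => t _; apply: cvg_EFin; [exact: nearW|exact: cu].
have h2 : {ae mu, forall (x : R) n, setT x -> (`|(u_ n x)%:E| <= (EFin \o w) x)%E}.
  by apply: aeW => t n _; rewrite /= lee_fin.
have [iu _ h] := @dominated_convergence _ _ R mu setT measurableT
  (fun n t => (u_ n t)%:E) (fun t => (u t)%:E) (EFin \o w)
  (fun n => (measurable_EFinP _ _).2 (mu_ n)) ((measurable_EFinP _ _).2 mu0) h1 iw h2.
apply: fine_cvg; rewrite fineK; first exact: h.
exact: integrable_fin_num.
Qed.

Local Notation I d := (Rintegral mu setT (omega d)).

Lemma measurable_cRe g : continuous g -> measurable_fun setT (fun t => cRe (g t)).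
Proof. by move=> cg; exact: (measurable_continuousR (continuous_cRe cg)). Qed.

Lemma measurable_cIm g : continuous g -> measurable_fun setT (fun t => cIm (g t)).
Proof. by move=> cg; exact: (measurable_continuousR (continuous_cIm cg)). Qed.

Lemma integrable_Zomega d D : 0 < d -> mu.-integrable setT (EFin \o (fun t => D * omega d t)).
Proof.
move=> d0; have := integrableZl measurableT D (omega_integrable d0).
by apply: eq_integrable => // t _; rewrite /= EFinM.
Qed.

Lemma nrm_cintegral_le g d D : 0 < d -> continuous g ->
  (forall t, nrm (g t) <= D * omega d t) -> nrm (cintegral g) <= 2 * (D * I d).
Proof.
move=> d0 cg gD.
have key (u : R -> R) : measurable_fun setT u -> (forall t, `|u t| <= nrm (g t)) ->
    `|Rintegral mu setT u| <= D * I d.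
  move=> mu_ ug.
  have uD t : `|u t| <= D * omega d t by apply: le_trans (ug t) (gD t).
  have iu : mu.-integrable setT (EFin \o u).
    apply: (le_integrable measurableT _ _ (integrable_Zomega D d0)).
      exact/measurable_EFinP.
    by move=> t _ /=; rewrite lee_fin (le_trans (uD t))// ler_norm.
  apply: le_trans (le_normr_Rintegral measurableT iu) _.
  rewrite -RintegralZl//; last exact: omega_integrable.
  apply: le_Rintegral => //; last exact: integrable_Zomega.
  exact: (integrable_abse iu).
apply: le_trans (nrm_le_reim _) _; rewrite mulr_natl mulr2n; apply: lerD; apply: key.
- exact: measurable_cRe.
- by move=> t; exact: re_le_nrm.
- exact: measurable_cIm.
- by move=> t; exact: im_le_nrm.
Qed.

Lemma cintegral_dominated (g_ : nat -> R -> C) g d D : 0 < d ->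
  (forall n, continuous (g_ n)) -> continuous g ->
  (forall t, g_ n t @[n --> \oo] --> g t) ->
  (forall n t, nrm (g_ n t) <= D * omega d t) ->
  cintegral (g_ n) @[n --> \oo] --> cintegral g.
Proof.
move=> d0 cg_ cg gg gD; apply: cvg_reim.
- apply: (dominated_Rintegral _ _ _ _ (integrable_Zomega D d0)).
  + exact: (fun n => measurable_cRe (cg_ n)).
  + exact: (measurable_cRe cg).
  + exact: (fun t => cvg_cRe (gg t)).
  + by move=> n t; apply: le_trans (re_le_nrm _) (gD n t).
- apply: (dominated_Rintegral _ _ _ _ (integrable_Zomega D d0)).
  + exact: (fun n => measurable_cIm (cg_ n)).
  + exact: (measurable_cIm cg).
  + exact: (fun t => cvg_cIm (gg t)).
  + by move=> n t; apply: le_trans (im_le_nrm _) (gD n t).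
Qed.

Lemma cint_cvg_cintegral g d D : 0 < d -> continuous g ->
  (forall t, nrm (g t) <= D * omega d t) ->
  cint (- n%:R) n%:R g @[n --> \oo] --> cintegral g.
Proof.
move=> d0 cg gD.
have key (u : R -> R) : continuous u -> (forall t, `|u t| <= nrm (g t)) ->
    Rintegral mu `[- n%:R, n%:R] u @[n --> \oo] --> Rintegral mu setT u.
  move=> cu ug.
  have -> : (fun n : nat => Rintegral mu `[- n%:R, n%:R] u) =
            (fun n : nat => Rintegral mu setT (u \_ `[- n%:R, n%:R])).
    by apply/funext => n; rewrite Rintegral_mkcond.
  apply: (dominated_Rintegral _ _ _ _ (integrable_Zomega D d0)).
  - move=> n; apply/(measurable_restrictT _ _).1 => //.
    by apply: measurable_funTS; exact: measurable_continuousR.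
  - exact: measurable_continuousR.
  - move=> t; apply/cvgrPdist_le => e e0; near=> n.
    rewrite patchE ifT ?subrr ?normr0 ?ltW// inE /= in_itv /= -ler_norml.
    by near: n; exact: nbhs_infty_ger.
  - move=> n t; rewrite patchE; case: ifP => _.
      exact: le_trans (ug t) (gD t).
    by rewrite normr0; apply: le_trans (nrm_ge0 (g t)) (gD t).
apply: cvg_reim.
- by apply: (key _ (continuous_cRe cg)) => t; exact: re_le_nrm.
- by apply: (key _ (continuous_cIm cg)) => t; exact: im_le_nrm.
Unshelve. all: by end_near. Qed.

Lemma omega_antitone d s t : 0 <= d -> `|t| <= `|s| -> omega d s <= omega d t.
Proof.
move=> d0 ts; rewrite /omega ler_expR ler_nM2l; last by lra.
by rewrite ler_ln ?posrE ?pos1// lerD2l.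
Qed.

(** A tail estimate is enough for domination: on the remaining compact interval the constant absorbs
    the function, [omega] being bounded below there. *)
Lemma dominated_by_omega g d A T : 0 < d -> continuous g -> 0 <= A ->
  (forall t, T <= `|t| -> nrm (g t) <= A * omega d t) ->
  exists2 D, 0 <= D & forall t, nrm (g t) <= D * omega d t.
Proof.
move=> d0 cg A0 gA.
pose T' := Num.max T 0.
have T'0 : 0 <= T' by rewrite /T' le_max lexx orbT.
have [B B0 hB] := @continuous_nrm_bounded R g (- T') T' ltac:(lra) cg.
exists (Num.max A (B / omega d T')); first by rewrite le_max A0.
move=> t; have o0 := omega_gt0 d t.
have [Tt|tT] := leP T `|t|.
  by apply: le_trans (gA _ Tt) _; rewrite ler_pM2r// le_max lexx.
have tT' : `|t| <= T' by rewrite /T' le_max ltW.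
have h : omega d T' <= omega d t by apply: omega_antitone; [exact: ltW|rewrite (ger0_norm T'0)].
apply: le_trans (hB t _) _; first by rewrite -ler_norml.
apply: (@le_trans _ _ (B / omega d T' * omega d t)); last first.
  by rewrite ler_pM2r// le_max lexx orbT.
rewrite -mulrA ler_peMr// mulrC ler_pdivlMr ?mul1r ?omega_gt0//.
Qed.

End FullLine.

(** * Decay of the integrand and expansion in residues *)

Section IntegrandDecay.
Variable R : realType.
Local Notation C := (C R).
Implicit Types (s : C) (k : int).

Lemma halfabs_ge0 k : 0 <= cRe (halfabs R k).
Proof. by rewrite halfabs_re divr_ge0. Qed.

Lemma Gk_growth (B : R) : 0 <= B -> exists2 K : R, 0 < K &
  forall k s, `|2 * cRe s - 1| <= B -> - B <= 1 - cRe s ->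
  (forall j : nat, 8 * (B + 1) <= nrm (1 - s + halfabs R k + j%:R)) ->
  nrm (Gk k s) <= K * expR ((2 * cRe s - 1) * ln (nrm (1 - s + halfabs R k))).
Proof.
move=> B0; have [K K0 hK] := rgamma_growth B0.
exists (expR (B * `|ln (2 * pi)|) * K); first by rewrite mulr_gt0 ?expR_gt0.
move=> k s sB sB2 sj; have hre := halfabs_ge0 k.
have h := hK (2 * cRe s - 1) (s + halfabs R k) (1 - s + halfabs R k) sB.
rewrite GkE !nrmM nrmX nrm_cI expr1n mul1r nrmV nrm_rpowC.
have h1 : expR (cRe (1 - 2 * s) * ln (2 * pi)) <= expR (B * `|ln (2 * pi)|).
  rewrite ler_expR (le_trans (ler_norm _))// normrM ler_wpM2r//.
  rewrite cReB cRe1 -[2 : C]cR_nat cReMR.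
  by rewrite distrC.
rewrite -!mulrA ler_pM ?expR_ge0 ?mulr_ge0 ?invr_ge0 ?nrm_ge0//.
have [-> | v0] := eqVneq (rgamma (s + halfabs R k)) 0.
  by rewrite nrm0 invr0 mulr0 mulr_ge0 ?expR_ge0 ?ltW.
rewrite ler_pdivrMr ?nrm_gt0//; apply: h => //.
- by rewrite !(cReD,cReB,cRe1); ring.
- by rewrite !(cImD,cImB,cIm1) halfabs_im; ring.
- by rewrite cReD cReB cRe1; lra.
Qed.

Variable n : nat.
Implicit Types (mu : 'I_n -> C) (M : 'I_n -> int).

(** Factor [l] contributes the exponent 2(Re s - Re mu_l) - 1. As the [mu] sum to 0, these add up to
    n(2 Re s - 1), so constants and rate are common to all parameters in the ball. *)
Lemma Hfun_decay M (x Bmu S : R) : 0 <= Bmu -> 0 <= S ->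
  exists A T0 : R, [/\ 0 <= A, 0 < T0 & forall mu s,
   (forall l, nrm (mu l) <= Bmu) -> \sum_(l < n) mu l = 0 ->
   `|cRe s| <= S -> T0 <= `|cIm s| ->
   nrm (Hfun mu M x s) <= A * expR (n%:R * (2 * cRe s - 1) * ln (1 + `|cIm s|))].
Proof.
move=> Bmu0 S0; pose B := 2 * (S + Bmu) + 1.
have B0 : 0 <= B by rewrite /B; lra.
have [K K0 hK] := Gk_growth B0.
pose P (l : 'I_n) := 1 + S + 2 * Bmu + cRe (halfabs R (M l)).
pose Lc (l : 'I_n) := ln (P l) + ln (2 + Bmu).
exists (K ^+ n * expR (B * \sum_(l < n) Lc l) * expR (2 * S * `|ln x|)).
(* From this height on |Im (s - mu_l)| >= 8(B + 1), the distance asked for in [Gk_growth]. *)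
exists (Bmu + 8 * (B + 1)); split; [|lra|].
  by rewrite !mulr_ge0 ?exprn_ge0 ?expR_ge0 ?ltW.
move=> mu s muB smu sS sT; rewrite /Hfun nrmM nrm_rpowC /Gmu nrm_prod.
set u := cRe s in sS *; set t := cIm s in sT *.
have key l : nrm (Gk (M l) (s - mu l)) <=
   K * (expR (B * Lc l) * expR ((2 * (u - cRe (mu l)) - 1) * ln (1 + `|t|))).
  have rmu := le_trans (re_le_nrm (mu l)) (muB l).
  have imu := le_trans (im_le_nrm (mu l)) (muB l).
  move: rmu imu; rewrite !ler_norml => /andP[r1 r2] /andP[i1 i2].
  have [s1 s2] : - S <= u /\ u <= S by move: sS; rewrite ler_norml => /andP.
  have bB : `|2 * cRe (s - mu l) - 1| <= B.
    by rewrite cReB ler_norml -/u /B; apply/andP; split; lra.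
  have him (j : nat) : cIm (1 - (s - mu l) + halfabs R (M l) + j%:R) = cIm (mu l) - t.
    by rewrite !(cImD,cImB,cIm1,cIm_nat) halfabs_im -/t; ring.
  have tB (j : nat) : `|t| - Bmu <= nrm (1 - (s - mu l) + halfabs R (M l) + j%:R).
    apply: le_trans (im_le_nrm _); rewrite him.
    have := lerB_dist t (cIm (mu l)); rewrite distrC.
    have := le_trans (im_le_nrm (mu l)) (muB l); lra.
  have h := hK (M l) (s - mu l) bB; apply: le_trans (h _ _) _.
  - by rewrite cReB -/u /B; lra.
  - by move=> j; apply: le_trans (tB j); lra.
  rewrite ler_pM2l// -expRD ler_expR cReB -/u.
  set w := 1 - (s - mu l) + halfabs R (M l).
  have tw : `|t| - Bmu <= nrm w by have := tB 0; rewrite addr0.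
  have hP : nrm w <= P l * (1 + `|t|).
    apply: le_trans (nrm_le_reim _) _.
    have -> : cIm w = cIm (mu l) - t by rewrite -(him 0) addr0.
    have t0 := normr_ge0 t.
    have hr := halfabs_ge0 (M l).
    have : `|cRe w| <= 1 + S + Bmu + cRe (halfabs R (M l)).
      by rewrite /w !(cReD,cReB,cRe1) -/u ler_norml; apply/andP; split; lra.
    have : `|cIm (mu l) - t| <= Bmu + `|t|.
      by apply: le_trans (ler_normB _ _) _; rewrite lerD2r (le_trans (im_le_nrm _)).
    have : `|t| <= P l * `|t| by apply: ler_peMl => //; rewrite /P; lra.
    rewrite mulrDr mulr1 {2}/P; lra.
  have t0 := normr_ge0 t.
  have w1 : 1 <= nrm w by move: sT; rewrite /B; lra.
  have hQ : 1 + `|t| <= (2 + Bmu) * nrm w.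
    have : 1 + Bmu <= (1 + Bmu) * nrm w by apply: ler_peMr => //; lra.
    rewrite [X in _ <= X -> _]mulrDl [X in _ -> _ <= X]mulrDl; lra.
  have w0 : 0 < nrm w by lra.
  have P0 : 0 < P l by rewrite /P; have := halfabs_ge0 (M l); lra.
  have t1 : 0 < 1 + `|t| by lra.
  have l1 : ln (nrm w) <= ln (P l) + ln (1 + `|t|).
    by rewrite -lnM ?posrE// ler_ln ?posrE// mulr_gt0.
  have l2 : ln (1 + `|t|) <= ln (2 + Bmu) + ln (nrm w).
    by rewrite -lnM ?posrE//; [rewrite ler_ln ?posrE// mulr_gt0//; lra|lra].
  have P1 : 0 <= ln (P l) by rewrite ln_ge0// /P; have := halfabs_ge0 (M l); lra.
  have Q1 : 0 <= ln (2 + Bmu) by rewrite ln_ge0//; lra.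
  have bound : (2 * (u - cRe (mu l)) - 1) * (ln (nrm w) - ln (1 + `|t|)) <= B * Lc l.
    rewrite (le_trans (ler_norm _))// normrM ler_pM//.
      by rewrite -cReB.
    by rewrite /Lc ler_norml; apply/andP; split; lra.
  lra.
have -> : K ^+ n * expR (B * \sum_(l < n) Lc l) * expR (2 * S * `|ln x|) *
    expR (n%:R * (2 * u - 1) * ln (1 + `|t|)) =
   \prod_(l < n) (K * (expR (B * Lc l) * expR ((2 * (u - cRe (mu l)) - 1) * ln (1 + `|t|))))
    * expR (2 * S * `|ln x|).
  rewrite [\prod_(l < n) _]big_split /= [\prod_(l < n) (_ * _)]big_split /= prodr_const card_ord -!expR_sum -mulr_sumr -mulr_suml.
  have -> : \sum_(i < n) (2 * (u - cRe (mu i)) - 1) = n%:R * (2 * u - 1).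
    rewrite sumrB -mulr_sumr sumrB !sumr_const card_ord.
    rewrite -cRe_sum smu; have -> : cRe 0 = 0 by []. 
    by rewrite -[u *+ n]mulr_natl; ring.
  by ring.
rewrite ler_pM ?expR_ge0//.
- by apply: prodr_ge0 => l _; exact: nrm_ge0.
- by apply: ler_prod => l _; rewrite nrm_ge0 key.
rewrite ler_expR (le_trans (ler_norm _))// normrM ler_wpM2r//.
by rewrite mulNr cReN -[2 : C]cR_nat cReMR normrN normrM normr_nat ler_wpM2l.
Qed.

(** On Re s = - (Bmu + 2) each factor is at most a constant times |w|^-4, where w = 1 - s + mu_l +
    |m_l + k|/2. As |w| >= |k|/4 and (2 + Bmu)|w| >= 1 + |t|, half of the exponent gives k^-2 and
    the other half an integrable function of t. *)
Lemma Hfun_decay_large (m : 'I_n -> int) (x Bmu : R) : (0 < n)%N -> 0 <= Bmu ->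
  exists (A : R) (K0 : nat), [/\ 0 <= A, (0 < K0)%N &
   forall mu k, (forall l, nrm (mu l) <= Bmu) -> (K0 <= absz k)%N ->
   (forall l, cRe (mu l) - (absz (m l + k))%:R / 2 < - (Bmu + 2)) /\
   forall t, nrm (Hfun mu (fun l => m l + k) x (Complex (- (Bmu + 2)) t)) <=
     A / (absz k)%:R ^+ 2 * omega 1 t].
Proof.
move=> n0 Bmu0; pose B := 4 * Bmu + 5; have B0 : 0 <= B by rewrite /B; lra.
have [K K_0 hK] := Gk_growth B0.
pose N1 := (\sum_(l < n) absz (m l))%N.
exists (K ^+ n * 16 * (2 + Bmu) ^+ 2 * expR (2 * (Bmu + 2) * ln x)).
(* |k| >= 2 N1 gives |m_l + k| >= |k|/2, and |k| >= 32(B + 1) makes |k|/4 reach the threshold 8(B +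
   1). *)
exists (2 * N1 + Num.truncn (32 * (B + 1)) + 1)%N; split.
- by rewrite !mulr_ge0 ?exprn_ge0 ?expR_ge0 ?ltW//; lra.
- by rewrite addn1.
move=> mu k muB kK.
have kB : 32 * (B + 1) <= (absz k)%:R :> R.
  apply: ltW; apply: lt_le_trans (truncnS_gt _) _; rewrite ler_nat.
  by apply: leq_trans kK; rewrite addn1 ltnS leq_addl.
have hk l : (absz k)%:R / 4 <= cRe (halfabs R (m l + k)).
  rewrite halfabs_re; have : (absz (m l) <= N1)%N by rewrite /N1 (bigD1 l)//= leq_addr.
  move=> ml; have : (absz k <= 2 * absz (m l + k)%R)%N by lia.
  by rewrite -(ler_nat R) natrM; lra.
have bmu l : - Bmu <= cRe (mu l) <= Bmu.
  by rewrite -ler_norml (le_trans (re_le_nrm _)).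
split=> [l|t].
  have := hk l; rewrite halfabs_re; have /andP[_ h] := bmu l; move: h kB.
  rewrite /B; lra.
set s := Complex _ t : C.
have key l : nrm (Gk (m l + k) (s - mu l)) <=
    K * expR (- 4 * ln (nrm (1 - (s - mu l) + halfabs R (m l + k)))) /\
    (absz k)%:R / 4 <= nrm (1 - (s - mu l) + halfabs R (m l + k)).
  have /andP[b1 b2] := bmu l.
  have hj (j : nat) : (absz k)%:R / 4 <= nrm (1 - (s - mu l) + halfabs R (m l + k) + j%:R).
    apply: le_trans (re_le_nrm _); apply: le_trans (ler_norm _).
    rewrite !(cReD,cReN,cRe1,cRe_nat) /=; have := hk l.
    have := ler0n R j; lra.
  have h0 := hj 0; rewrite addr0 in h0; split=> //.
  apply: le_trans (hK _ _ _ _ _) _.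
  - by rewrite cReB /= ler_norml /B; apply/andP; split; lra.
  - by rewrite cReB /= /B; lra.
  - by move=> j; apply: le_trans (hj j); lra.
  rewrite ler_pM2l// ler_expR; apply: ler_wpM2r.
    by rewrite ln_ge0//; lra.
  by rewrite cReB /=; lra.
rewrite /Hfun nrmM nrm_rpowC /Gmu nrm_prod.
have [Q QE] : exists Q, Q = (2 + Bmu) ^+ 2 by eexists.
have [q qE] : exists q : R, q = (absz k)%:R ^+ 2 by eexists.
rewrite -QE -qE.
have -> : cRe (- 2 * s) = 2 * (Bmu + 2).
  by rewrite mulNr cReN -[2 : C]cR_nat cReMR /=; ring.
rewrite -!mulrA [expR _ * _]mulrC !mulrA ler_pM2r ?expR_gt0//.
have k0 : (0 : R) < (absz k)%:R by lra.
set w := fun l : 'I_n => 1 - (s - mu l) + halfabs R (m l + k).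
apply: (@le_trans _ _ (\prod_(l < n) (K * expR (- 4 * ln (nrm (w l)))))).
  by apply: ler_prod => l _; rewrite nrm_ge0; case: (key l).
rewrite big_split /= prodr_const card_ord -!mulrA ler_pM2l ?exprn_gt0//.
(* With the constants taken out, one factor provides the whole decay and the other ones are at most
   1. *)
pose l0 := Ordinal n0; rewrite (bigD1 l0)//=.
apply: (@le_trans _ _ (expR (- 4 * ln (nrm (w l0))) * 1)).
  rewrite ler_pM2l ?expR_gt0//; apply: prodr_ile1 => l _.
  rewrite expR_ge0 /= -[X in _ <= X]expR0 ler_expR; have [_ h] := key l.
  have : 0 <= ln (nrm (w l)) by rewrite ln_ge0//; move: h; rewrite /w; lra.
  lra.
rewrite mulr1; have [_ h] := key l0.
have w0 : 0 < nrm (w l0) by move: h; rewrite /w; lra.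
have tw : 1 + `|t| <= (2 + Bmu) * nrm (w l0).
  have h1 : `|t| - Bmu <= nrm (w l0).
    apply: le_trans (im_le_nrm _).
    have -> : cIm (w l0) = cIm (mu l0) - t.
      by rewrite /w !(cImD,cImN,cIm1) halfabs_im /=; ring.
    have := lerB_dist t (cIm (mu l0)); rewrite distrC.
    have := le_trans (im_le_nrm (mu l0)) (muB l0); lra.
  have h2 : 1 <= nrm (w l0) by move: h; rewrite /w; lra.
  have : 1 + Bmu <= (1 + Bmu) * nrm (w l0) by apply: ler_peMr => //; lra.
  rewrite [X in _ <= X -> _]mulrDl [X in _ -> _ <= X]mulrDl; lra.
have -> : expR (- 4 * ln (nrm (w l0))) = (nrm (w l0) ^+ 2 * nrm (w l0) ^+ 2)^-1.
  rewrite mulNr expRN; congr (_ ^-1).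
  by rewrite -exprD -[LHS]/(expR (4%:R * _)) expRM_natl lnK.
have t0 := normr_ge0 t.
have -> : omega 1 t = ((1 + `|t|) ^+ 2)^-1.
  rewrite /omega mulNr expRN; congr (_ ^-1).
  have -> : (1 + 1 : R) = 2%:R by ring.
  by rewrite expRM_natl lnK// posrE; lra.
have p1 : (absz k)%:R ^+ 2 <= 16 * nrm (w l0) ^+ 2.
  by have : nrm (w l0) >= (absz k)%:R / 4 by []; nra.
rewrite -qE in p1.
have p2 : (1 + `|t|) ^+ 2 <= (2 + Bmu) ^+ 2 * nrm (w l0) ^+ 2.
  by rewrite -exprMn; apply: lerXn2r; rewrite ?nnegrE; [lra|apply: mulr_ge0; lra|exact: tw].
rewrite -QE in p2; have q1 : 0 < q by rewrite qE exprn_gt0.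
have q2 : 0 < (1 + `|t|) ^+ 2 by rewrite exprn_gt0//; lra.
have q3 : 0 < nrm (w l0) ^+ 2 by rewrite exprn_gt0.
have -> : 16 * (Q * (q^-1 * ((1 + `|t|) ^+ 2)^-1)) = (16 / q) * (Q / (1 + `|t|) ^+ 2) by ring.
rewrite invfM ler_pM ?invr_ge0 ?(ltW q3)//.
  by rewrite ler_pdivlMr// mulrC ler_pdivrMr.
by rewrite ler_pdivlMr// mulrC ler_pdivrMr.
Qed.

End IntegrandDecay.

(** * Moving the contour and summing the residues *)

Section ContourIntegrals.
Variables (R : realType) (n : nat).
Local Notation C := (C R).
Implicit Types (mu : 'I_n -> C) (M : 'I_n -> int) (x d sigma : R) (f : R -> R) (g : R -> C).

Definition contour_integrand mu M x f t : C :=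
  Hfun mu M x (Complex (f t) t) * Complex ((f^`()) t) 1.

Lemma jkernelE mu M f x : jkernel mu M f x =
  (2 * cR pi * cI R)^-1 * cintegral (contour_integrand mu M x f).
Proof. by []. Qed.

Lemma ccont_Hfun mu M x g : continuous g -> (forall t l j, g t != apole mu M l j) ->
  continuous (fun t : R => Hfun mu M x (g t)).
Proof.
move=> cg gp.
have caff (a b : C) : continuous (fun t : R => a * g t + b).
  have h := @ccontZ R a g cg; exact: (ccontD h (@ccont_cst R b)).
have -> : (fun t => Hfun mu M x (g t)) = (fun t =>
   (\prod_(l < n) (cI R ^+ absz (M l) * rpowC (2 * pi) (- 2 * g t + (1 + 2 * mu l)) *
    (rgamma (- 1 * g t + (1 + mu l + halfabs R (M l))) *
     (rgamma (1 * g t + (- mu l + halfabs R (M l))))^-1)))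
   * rpowC x (- 2 * g t + 0)).
  apply/funext => t; rewrite /Hfun /Gmu addr0; congr (_ * _); apply: eq_bigr => l _.
  rewrite GkE; congr (_ * rpowC _ _ * (rgamma _ / rgamma _)); ring.
apply: ccontM; last exact: (ccont_ucball (ucball_cexp (cR (ln x))) (caff _ _)).
apply: ccont_prod => l; apply: ccontM.
  apply: ccontM; first exact: ccont_cst.
  exact: (ccont_ucball (ucball_cexp (cR (ln (2 * pi)))) (caff _ _)).
apply: ccontM; first exact: (ccont_ucball (@ucball_rgamma R) (caff _ _)).
apply: ccontV; last exact: (ccont_ucball (@ucball_rgamma R) (caff _ _)).
move=> t; have := @rgamma_denom_neq0 R n mu M l (g t) (gp t l).
by congr (rgamma _ != 0); ring.
Qed.

Lemma ccont_path f : continuous f -> continuous (fun t => Complex (f t) t : C).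
Proof. by move=> cf t; apply: cvg_reim => /=; [exact: cf|exact: cvg_id]. Qed.

Lemma contour_integrand_continuous mu M x f : continuous f -> continuous (f^`()) ->
  (forall t l j, (Complex (f t) t : C) != apole mu M l j) ->
  continuous (contour_integrand mu M x f).
Proof.
move=> cf cf' fp; exact: (ccontM (ccont_Hfun (x := x) (ccont_path cf) fp) (ccont_graph cf')).
Qed.

Lemma derive1_eventually_cst f sigma (T : R) : (forall t, T <= `|t| -> f t = sigma) ->
  forall t, T < `|t| -> f^`() t = 0.
Proof.
move=> fs t Tt; rewrite derive1E -(derive_cst sigma t 1).
apply: near_eq_derive.
have : \forall y \near t, T < `|y|.
  by apply: (@cvgr_gt R _ (nbhs t) _ (fun y : R => `|y|) `|t|); [exact: norm_continuous|].
by apply: filterS => y /ltW /fs.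
Qed.

Lemma contour_decay M x f sigma d (T Bmu : R) : 0 <= Bmu ->
  n%:R * (2 * sigma - 1) = - (1 + d) -> (forall t, T <= `|t| -> f t = sigma) ->
  exists A T1 : R, [/\ 0 <= A, 0 < T1 & forall mu, (forall l, nrm (mu l) <= Bmu) ->
    \sum_(l < n) mu l = 0 ->
    forall t, T1 <= `|t| -> nrm (contour_integrand mu M x f t) <= A * omega d t].
Proof.
move=> B0 sd fs; have [A [T0 [A0 T00 h]]] := @Hfun_decay R n M x Bmu `|sigma| B0 (normr_ge0 _).
exists A, (Num.max T0 (T + 1)); split; [exact: A0|by rewrite lt_max T00|].
move=> mu muB smu t; rewrite ge_max => /andP[t1 t2].
have t3 : T < `|t| by lra.
rewrite /contour_integrand nrmM (derive1_eventually_cst fs t3) fs; last exact: ltW.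
rewrite -[Complex 0 1]cI_E nrm_cI mulr1.
by have := h mu (Complex sigma t) muB smu (lexx _) t1; rewrite /= sd.
Qed.

(** When the [mu] sum to 0, the bound on sigma reads sigma < 1/2 - 1/(2n), that is n(2 sigma - 1) <
    -1: integrability of the power bound along the vertical ends of the contour. *)
Lemma admissible_exponent mu M sigma f : (0 < n)%N -> \sum_(l < n) mu l = 0 ->
  admissible mu M sigma f -> exists2 d : R, 0 < d & n%:R * (2 * sigma - 1) = - (1 + d).
Proof.
move=> n0 smu [sig _ _ _].
have n1 : (1 : R) <= n%:R by rewrite ler1n.
exists (- (n%:R * (2 * sigma - 1)) - 1); last by ring.
have nz : n%:R != 0 :> R by rewrite pnatr_eq0 -lt0n.
rewrite smu mulr0 sub0r in sig; clear smu.
have : n%:R * sigma < n%:R * (1 / 2 + - 1 / (2 * n%:R)) by rewrite ltr_pM2l//; lra.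
have -> : n%:R * (1 / 2 + - 1 / (2 * n%:R)) = (n%:R - 1) / 2 :> R by field.
by lra.
Qed.

Lemma cvg_boundary (u v w y : nat -> C) (lu lv : C) : u @ \oo --> lu -> v @ \oo --> lv ->
  w @ \oo --> (0 : C) -> y @ \oo --> (0 : C) -> u N - v N - w N + y N @[N --> \oo] --> lu - lv.
Proof.
move=> hu hv hw hy; rewrite -[X in _ --> X]addr0 -[X in _ --> X + _]subr0.
by apply: cvgD; [apply: cvgB; [exact: (cvgB hu hv)|exact: hw]|exact: hy].
Qed.

Section FixedParameter.
Variables (mu : 'I_n -> C) (M : 'I_n -> int) (x : R).
Hypothesis smu : \sum_(l < n) mu l = 0.
Let Bmu := \sum_(l < n) nrm (mu l).
Let Bmu0 : 0 <= Bmu. Proof. by apply: sumr_ge0 => l _; exact: nrm_ge0. Qed.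
Let muB l : nrm (mu l) <= Bmu.
Proof. by rewrite /Bmu (bigD1 l)//= lerDl sumr_ge0// => i _; exact: nrm_ge0. Qed.

Lemma contour_dominated f sigma d (T : R) : 0 < d ->
  n%:R * (2 * sigma - 1) = - (1 + d) -> (forall t, T <= `|t| -> f t = sigma) ->
  continuous f -> continuous (f^`()) ->
  (forall t l j, (Complex (f t) t : C) != apole mu M l j) ->
  exists2 D, 0 <= D & forall t, nrm (contour_integrand mu M x f t) <= D * omega d t.
Proof.
move=> d0 sd fs cf cf' fp; have [A [T1 [A0 _ h]]] := contour_decay M x Bmu0 sd fs.
have hc := contour_integrand_continuous (x := x) cf cf' fp.
exact: (dominated_by_omega d0 hc A0 (h mu muB smu)).
Qed.

Lemma omega_le_inv d (N : nat) : 0 <= d -> (0 < N)%N -> omega d N%:R <= N%:R^-1.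
Proof.
move=> d0 N0; have N1 : (0 : R) < N%:R by rewrite ltr0n.
rewrite /omega normr_nat mulNr expRN lef_pV2 ?posrE ?expR_gt0//.
have l0 : 0 <= ln (1 + N%:R : R) by rewrite ln_ge0// lerDl.
apply: (@le_trans _ _ (expR (ln (1 + N%:R)))).
  by rewrite lnK ?posrE; lra.
by rewrite ler_expR; nra.
Qed.

Lemma im_lt_nat : \forall N \near \oo, forall l, `|cIm (mu l)| < N%:R.
Proof.
pose N0 := (\sum_(l < n) Num.truncn `|cIm (mu l)|)%N.
near=> N => l; have NN : (N0 < N)%N by near: N; exact: nbhs_infty_gt.
apply: lt_le_trans (truncnS_gt _) _; rewrite ler_nat.
by apply: leq_trans NN; rewrite ltnS /N0 (bigD1 l)//= leq_addr.
Unshelve. all: by end_near. Qed.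

(** To the left of sigma the exponent only decreases, so the integrand on the edge at height N is
    O(1/N), while the length of the edge is fixed. *)
Lemma hline_integral_cvg0 sigma s0 d (e : nat -> R) : 0 <= d -> s0 < sigma ->
  n%:R * (2 * sigma - 1) = - (1 + d) -> (forall N, `|e N| = N%:R) ->
  cint s0 sigma (fun u => Hfun mu M x (Complex u (e N)) * Complex 1 0) @[N --> \oo] --> 0.
Proof.
move=> d0 s01 sd eN.
have [A [T0 [A0 T00 h]]] := @Hfun_decay R n M x Bmu (`|s0| + `|sigma|) Bmu0 ltac:(by rewrite addr_ge0).
apply: (@cvgC_le R _ _ _ _ _ (fun N : nat => 2 * A * (sigma - s0) * N%:R^-1)); last first.
  rewrite -[X in _ --> X](mulr0 (2 * A * (sigma - s0))).
  by apply: cvgM; [exact: cvg_cst|exact: cvg_invn].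
near=> N.
have N0 : (0 < N)%N by near: N; exact: nbhs_infty_gt.
have NT : T0 <= N%:R by near: N; exact: nbhs_infty_ger.
have ep u l j : (Complex u (e N) : C) != apole mu M l j.
  have h1 : `|cIm (mu l)| < N%:R by move: (l); near: N; exact: im_lt_nat.
  apply/eqP => h2; have := apole_im mu M l j; rewrite -h2 /= => h3.
  by move: h1; rewrite -h3 eN ltxx.
rewrite subr0; apply: le_trans (@nrm_cint_le R _ _ _ (A * N%:R^-1) (ltW s01) _ _) _.
- apply: ccontM; last exact: ccont_cst.
  apply: ccont_Hfun => [t|t l j]; last exact: ep.
  by apply: cvg_reim => /=; [exact: cvg_id|exact: cvg_cst].
- move=> u /andP[u1 u2]; rewrite nrmM.
  have -> : nrm (Complex 1 0 : C) = 1 by rewrite -[Complex 1 0]/(1 : C) nrm1.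
  rewrite mulr1; have := h mu (Complex u (e N)) muB smu; rewrite /= eN => /(_ _ NT) hh.
  apply: le_trans (hh _) _.
    rewrite ler_norml; have := ler_norm s0; have := ler_norm (- s0).
    have := ler_norm sigma; have := ler_norm (- sigma); rewrite !normrN.
    by move: (normr_ge0 s0) (normr_ge0 sigma) => ? ? ? ? ? ?; apply/andP; split; lra.
  rewrite ler_wpM2l//; apply: le_trans (omega_le_inv d0 N0).
  rewrite /omega normr_nat ler_expR -sd ler_wpM2r//.
    by rewrite ln_ge0// lerDl.
  by rewrite ler_wpM2l// lerD2r ler_wpM2l.
- by rewrite le_eqVlt; apply/orP; left; apply/eqP; ring.
Unshelve. all: by end_near. Qed.

Lemma contour_residues f sigma s0 d (T : R) (K0 : nat) : 0 < d ->
  n%:R * (2 * sigma - 1) = - (1 + d) -> (forall t, T <= `|t| -> f t = sigma) ->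
  (forall t, derivable f t 1) -> continuous (f^`()) ->
  (forall l j, cRe (apole mu M l j) < f (cIm (mu l))) ->
  s0 < sigma -> (forall l j, cRe (apole mu M l j) != s0) ->
  simple_poles mu M -> (forall l j, (K0 <= j)%N -> cRe (apole mu M l j) <= s0) ->
  cintegral (contour_integrand mu M x f) - cintegral (contour_integrand mu M x (fun=> s0)) =
   2 * cR pi * cI R *
    \sum_(l < n) \sum_(j < K0 | s0 < cRe (apole mu M l j)) Hres mu M x l j.
Proof.
move=> d0 sd fs df cf' fleft s0s s0p simp hK.
have cf : continuous f by move=> t; apply: differentiable_continuous; exact/derivable1_diffP.
have fp t l j : (Complex (f t) t : C) != apole mu M l j.
  apply/eqP => e; have h1 : cIm (apole mu M l j) = t by rewrite -e.
  have h2 : cRe (apole mu M l j) = f t by rewrite -e.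
  by have := fleft l j; rewrite h2 -(apole_im mu M l j) h1 ltxx.
pose d1 := - (n%:R * (2 * s0 - 1)) - 1.
have d1d : d <= d1.
  have : n%:R * (2 * s0 - 1) <= n%:R * (2 * sigma - 1).
    by rewrite ler_wpM2l// lerD2r ler_wpM2l// ltW.
  by rewrite /d1; lra.
have d10 : 0 < d1 by apply: lt_le_trans d1d.
have c0 : continuous (fun _ : R => s0) by move=> t; exact: cvg_cst.
have c0' : continuous ((fun _ : R => s0)^`()).
  have -> : (fun _ : R => s0)^`() = fun=> 0 by apply/funext => t; exact: derive1_cst.
  by move=> t; exact: cvg_cst.
have sp t l j : (Complex s0 t : C) != apole mu M l j.
  by apply: contraNneq (s0p l j) => <-.
have [D D0 hD] := contour_dominated d0 sd fs cf cf' fp.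
have sd1 : n%:R * (2 * s0 - 1) = - (1 + d1) by rewrite /d1; ring.
have fs0 (t : R) : 0 <= `|t| -> (fun _ : R => s0) t = s0 by [].
have [D1 D10 hD1] := contour_dominated d10 sd1 fs0 c0 c0' sp.
have l1 := cint_cvg_cintegral d0 (contour_integrand_continuous (x := x) cf cf' fp) hD.
have l2 := cint_cvg_cintegral d10 (contour_integrand_continuous (x := x) c0 c0' sp) hD1.
have l3 := @hline_integral_cvg0 sigma s0 d (fun N => N%:R) (ltW d0) s0s sd (fun N => normr_nat _ N).
have l4 := @hline_integral_cvg0 sigma s0 d (fun N => - N%:R) (ltW d0) s0s sd
   (fun N => etrans (normrN _) (normr_nat _ N)).
pose L N := cint (- N%:R) N%:R (contour_integrand mu M x f) -
  cint (- N%:R) N%:R (contour_integrand mu M x (fun=> s0)) -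
  cint s0 sigma (fun u => Hfun mu M x (Complex u N%:R) * Complex 1 0) +
  cint s0 sigma (fun u => Hfun mu M x (Complex u (- N%:R)) * Complex 1 0).
have l5 : L N @[N --> \oo] --> cintegral (contour_integrand mu M x f) -
    cintegral (contour_integrand mu M x (fun=> s0)).
  exact: (cvg_boundary l1 l2 l3 l4).
apply: cvgC_unique l5 _.
apply: (@cvgC_le R _ _ _ _ _ (fun=> 0)); last exact: cvg_cst.
near=> N.
suff -> : L N = 2 * cR pi * cI R *
   \sum_(l < n) \sum_(j < K0 | s0 < cRe (apole mu M l j)) Hres mu M x l j.
  by rewrite subrr nrm0.
have N0 : (0 < N)%N by near: N; exact: nbhs_infty_gt.
have TN : T <= N%:R by near: N; exact: nbhs_infty_ger.
have muN l : `|cIm (mu l)| < N%:R by move: (l); near: N; exact: im_lt_nat.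
have NN : - N%:R < N%:R :> R.
  by apply: (@lt_trans _ _ 0); rewrite ?oppr_lt0 ltr0n.
have df' (t : R) : is_derive t 1 f (f^`() t).
  by apply: DeriveDef; [exact: df|rewrite derive1E].
have fN : f N%:R = sigma by apply: fs; rewrite normr_nat.
have fNN : f (- N%:R) = sigma by apply: fs; rewrite normrN normr_nat.
have gp l j : good_pole f s0 N%:R (apole mu M l j).
  by split; rewrite ?apole_im//; rewrite -ltr_norml.
rewrite -(loop_Hfun df' cf' NN s0s fN fNN x gp simp hK) /loop /L; congr (_ - _ - _ + _).
by rewrite /pint /=; congr cint; apply/funext => t; rewrite /contour_integrand derive1_cst.
Unshelve. all: by end_near. Qed.

(** Far to the left a unit shift of the line divides the integrand by at least
    [2], so the contribution of the moved contour disappears geometrically. *)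
Lemma Gk_shift (k : int) (s : C) : 1 - s + halfabs R k != 0 -> s - 1 + halfabs R k != 0 ->
  Gk k (s - 1) = Gk k s * (cR (2 * pi) ^+ 2 / ((1 - s + halfabs R k) * (s - 1 + halfabs R k))).
Proof.
move=> h1 h2; have pi0 : (0 : R) < 2 * pi by rewrite mulr_gt0// pi_gt0.
rewrite !GkE.
have -> : rgamma (1 - s + halfabs R k) =
    (1 - s + halfabs R k) * rgamma (1 - (s - 1) + halfabs R k).
  by rewrite rgammaS; congr (_ * rgamma _); ring.
have -> : rgamma (s - 1 + halfabs R k) = (s - 1 + halfabs R k) * rgamma (s + halfabs R k).
  by rewrite rgammaS; congr (_ * rgamma _); ring.
have -> : rpowC (2 * pi) (1 - 2 * (s - 1)) = rpowC (2 * pi) (1 - 2 * s) * cR (2 * pi) ^+ 2.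
  by rewrite -rpowC_nat// -rpowCD; congr rpowC; ring.
rewrite !invfM; move: ((rgamma (s + halfabs R k))^-1) (rgamma (_ - (s - 1) + _)) => r1 r2.
move: (rpowC _ _) (cI R ^+ _) (cR _) => a b c.
by field; rewrite h1 h2.
Qed.

Lemma Hfun_shift (s : C) : 0 < x ->
  (forall l, 1 - (s - mu l) + halfabs R (M l) != 0) ->
  (forall l, s - mu l - 1 + halfabs R (M l) != 0) ->
  Hfun mu M x (s - 1) = Hfun mu M x s * (cR x ^+ 2 * \prod_(l < n) (cR (2 * pi) ^+ 2 /
    ((1 - (s - mu l) + halfabs R (M l)) * (s - mu l - 1 + halfabs R (M l))))).
Proof.
move=> x0 h1 h2; rewrite /Hfun /Gmu.
have -> : rpowC x (- 2 * (s - 1)) = rpowC x (- 2 * s) * cR x ^+ 2.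
  by rewrite -rpowC_nat// -rpowCD; congr rpowC; ring.
have -> : \prod_(l < n) Gk (M l) (s - 1 - mu l) = \prod_(l < n) (Gk (M l) (s - mu l) *
   (cR (2 * pi) ^+ 2 / ((1 - (s - mu l) + halfabs R (M l)) * (s - mu l - 1 + halfabs R (M l))))).
  apply: eq_bigr => l _; rewrite -Gk_shift//; congr Gk; ring.
by rewrite big_split /=; ring.
Qed.

Lemma Hfun_shift_le : 0 < x -> (0 < n)%N -> exists S1 : R, forall s, cRe s <= - S1 ->
  nrm (Hfun mu M x (s - 1)) <= 2^-1 * nrm (Hfun mu M x s).
Proof.
(* Once all linear denominators are at least rho >= (2 pi)^2 q, one factor of the shift quotient is
   at most 1/q and the others at most 1; the choice of [q] gives x^2/q <= 1/2. *)
move=> x0 n0; pose q := 2 * (x ^+ 2 + 1).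
have x20 : 0 <= x ^+ 2 by rewrite sqr_ge0.
have q1 : 1 <= q by rewrite /q; lra.
pose rho := (2 * pi) ^+ 2 * q + 1 : R.
have p0 : 0 <= (2 * pi) ^+ 2 :> R by rewrite sqr_ge0.
have rho1 : 1 <= rho.
  by rewrite /rho lerDr mulr_ge0// (le_trans _ q1).
pose H := \sum_(l < n) cRe (halfabs R (M l)).
have hH l : 0 <= cRe (halfabs R (M l)) <= H.
  rewrite halfabs_ge0 /= /H (bigD1 l)//= lerDl; apply: sumr_ge0 => i _; exact: halfabs_ge0.
exists (rho + Bmu + H) => s sS.
have low l : rho <= nrm (1 - (s - mu l) + halfabs R (M l)) /\
             rho <= nrm (s - mu l - 1 + halfabs R (M l)).
  have /andP[a1 a2] := hH l.
  have := le_trans (re_le_nrm (mu l)) (muB l); rewrite ler_norml => /andP[b1 b2].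
  split.
    apply: le_trans (re_le_nrm _); apply: le_trans (ler_norm _).
    by rewrite !(cReD,cReN,cRe1); lra.
  rewrite -nrmN; apply: le_trans (re_le_nrm _); apply: le_trans (ler_norm _).
  by rewrite !(cReD,cReN,cRe1); lra.
have r0 : 0 < rho by lra.
rewrite Hfun_shift//; last 2 first.
- by move=> l; rewrite -nrm_gt0; apply: lt_le_trans r0 _; case: (low l).
- by move=> l; rewrite -nrm_gt0; apply: lt_le_trans r0 _; case: (low l).
rewrite nrmM mulrC ler_wpM2r ?nrm_ge0// nrmM nrmX nrm_cR nrm_prod.
rewrite -normrX (ger0_norm x20).
have fac l : nrm (cR (2 * pi) ^+ 2 /
    ((1 - (s - mu l) + halfabs R (M l)) * (s - mu l - 1 + halfabs R (M l)))) <= q^-1.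
  have [l1 l2] := low l; rewrite nrmf_div nrmX nrm_cR -normrX (ger0_norm p0) nrmM.
  rewrite ler_pdivrMr ?mulr_gt0//; try by apply: lt_le_trans r0 _.
  rewrite ler_pdivlMl; last by lra.
  apply: (@le_trans _ _ (rho * 1)); last by rewrite ler_pM//; lra.
  by rewrite mulr1 /rho mulrC lerDl.
rewrite (bigD1 (Ordinal n0))//=.
apply: (@le_trans _ _ (x ^+ 2 * (q^-1 * 1))).
  rewrite ler_wpM2l// ler_pM ?nrm_ge0 ?prodr_ge0//.
  - by move=> l _; exact: nrm_ge0.
  - apply: prodr_ile1 => l _; rewrite nrm_ge0 /=; apply: le_trans (fac l) _.
    by rewrite invf_le1//; lra.
rewrite mulr1 ler_pdivrMr; last by lra.
by rewrite /q; lra.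
Qed.

Lemma Hfun_shift_iter : 0 < x -> (0 < n)%N -> exists S1 : R, forall s (i : nat), cRe s <= - S1 ->
  nrm (Hfun mu M x (s - i%:R)) <= 2^-1 ^+ i * nrm (Hfun mu M x s).
Proof.
move=> x0 n0; have [S1 h] := Hfun_shift_le x0 n0; exists S1 => s i sS.
elim: i => [|i IH]; first by rewrite subr0 expr0 mul1r.
rewrite -natr1 opprD addrA exprS -mulrA; apply: le_trans (h _ _) _.
  by rewrite cReB cRe_nat; have := ler0n R i; lra.
by rewrite ler_wpM2l ?invr_ge0.
Qed.

Lemma line_avoiding_poles (S : R) : exists2 s0 : R, s0 <= - S &
  forall (l : 'I_n) (z : int), cRe (mu l) - cRe (halfabs R (M l)) - s0 != z%:~R.
Proof.
pose r l := cRe (mu l) - cRe (halfabs R (M l)).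
pose a l := r l - (Num.floor (r l))%:~R.
have a1 l : 0 <= a l < 1.
  have /andP[h1 h2] := floor_itv (r l); move: h2; rewrite intrD1 => h2.
  by rewrite /a; apply/andP; split; lra.
pose A := \big[Num.max/0]_(l < n) a l.
have A1 : 0 <= A < 1.
  rewrite /A; elim/big_ind : _ => //; first by rewrite lexx ltr01.
  by move=> y z /andP[y0 y1] /andP[z0 z1]; rewrite le_max y0 gt_max y1 z1.
have aA l : a l <= A by rewrite /A; apply: le_bigmax_cond.
(* [e] lies strictly between the largest fractional part [A] of the pole abscissas and 1. Only the
   class of s0 modulo 1 matters, hence all lines Re s = s0 - i avoid the poles as well. *)
pose e := (1 + A) / 2; pose K := (Num.truncn `|S|).+2.
have SK : S + 1 <= K%:R.
  have := truncnS_gt `|S|; have := ler_norm S.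
  by rewrite /K -[in X in _ -> _ -> _ <= X]natr1; lra.
have /andP[A0 A1'] := A1.
exists (e - K%:R); first by rewrite /e; lra.
move=> l z; apply/eqP; rewrite -/(r l) => h.
have h2 : a l - e = (z - K%:Z - Num.floor (r l))%:~R.
  by rewrite !rmorphB /= -h /a; ring.
have /andP[a0 _] := a1 l; have aA' := aA l.
have h3 : -1 < a l - e < 0 by rewrite /e; apply/andP; split; lra.
move: h3; rewrite h2 -[X in X < _ < _]/((- 1)%:~R : R) -[X in _ < _ < X]/(0%:~R : R) !ltr_int; lia.
Qed.

Lemma far_line_cvg0 s0 : 0 < x -> (0 < n)%N -> 
  (forall (l : 'I_n) (z : int), cRe (mu l) - cRe (halfabs R (M l)) - s0 != z%:~R) ->
  s0 <= - 1 -> 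
  (forall s (i : nat), cRe s <= s0 ->
    nrm (Hfun mu M x (s - i%:R)) <= 2^-1 ^+ i * nrm (Hfun mu M x s)) ->
  cintegral (contour_integrand mu M x (fun=> s0 - i%:R)) @[i --> \oo] --> (0 : C).
Proof.
move=> x0 n0 s0z s0N hi.
have cc (i : nat) : continuous (contour_integrand mu M x (fun=> s0 - i%:R)).
  apply: contour_integrand_continuous.
  - by move=> t; exact: cvg_cst.
  - have -> : (fun _ : R => s0 - i%:R)^`() = fun=> 0 by apply/funext => t; exact: derive1_cst.
    by move=> t; exact: cvg_cst.
  - move=> t l j; apply/eqP => /(congr1 (@cRe R)); rewrite apole_re /= => h.
    have /negP[] := s0z l (j%:Z - i%:Z); apply/eqP.
    by rewrite halfabs_re rmorphB /=; lra.
pose d1 := - (n%:R * (2 * s0 - 1)) - 1.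
have n1 : (1 : R) <= n%:R by rewrite ler1n.
have d10 : 0 < d1 by rewrite /d1; nra.
have sd1 : n%:R * (2 * s0 - 1) = - (1 + d1) by rewrite /d1; ring.
have fs0 (t : R) : 0 <= `|t| -> (fun _ : R => s0) t = s0 by [].
have [A [T1 [A0 _ h]]] := contour_decay M x Bmu0 sd1 fs0.
have c0 := cc 0; rewrite subr0 in c0.
have [D D0 hD] := dominated_by_omega d10 c0 A0 (h mu muB smu).
apply: (@cvgC_le R _ _ _ _ _
  (fun i : nat => 2 * (D * Rintegral (@lebesgue_measure R) setT (omega d1)) * 2^-1 ^+ i)); last first.
  rewrite -[X in _ --> X](mulr0 (2 * (D * Rintegral (@lebesgue_measure R) setT (omega d1)))).
  apply: cvgM; [exact: cvg_cst|apply: cvg_expr].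
  by rewrite ger0_norm ?invr_ge0// invf_lt1 ?ltr1n.
near=> i; rewrite subr0.
have -> : 2 * (D * Rintegral (@lebesgue_measure R) setT (omega d1)) * 2^-1 ^+ i =
   2 * ((D * 2^-1 ^+ i) * Rintegral (@lebesgue_measure R) setT (omega d1)) by ring.
apply: nrm_cintegral_le d10 (cc i) _ => t.
rewrite mulrAC; apply: (@le_trans _ _ (2^-1 ^+ i * nrm (contour_integrand mu M x (fun=> s0) t))).
  rewrite /contour_integrand !derive1_cst (nrmM (Hfun _ _ _ _)) (nrmM (Hfun _ _ _ _)) mulrA.
  rewrite ler_wpM2r ?nrm_ge0//.
  have -> : (Complex (s0 - i%:R) t : C) = Complex s0 t - i%:R.
    by apply: complex_ext; rewrite ?cReB ?cImB ?cRe_nat ?cIm_nat//= subr0.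
  exact: hi.
rewrite mulrC ler_wpM2r ?exprn_ge0 ?invr_ge0//.
Unshelve. all: by end_near. Qed.

(** With r the abscissa of the rightmost pole of a row, r - s0 is not an integer. So floor(r - s0) +
    1 poles of the row lie to the right of s0, and each unit step to the left passes exactly one
    more. *)
Lemma simple_real_shift (r s0 : R) (i j : nat) : s0 < r -> (forall z : int, r - s0 != z%:~R) ->
  (s0 - i%:R < r - j%:R) = (j < i + (Num.truncn (r - s0)).+1)%N.
Proof.
move=> s0r h; have /truncn_itv /andP[h1 h2] : 0 <= r - s0 by lra.
set q := Num.truncn _ in h1 h2 *.
have h3 : q%:R < r - s0.
  rewrite lt_neqAle h1 andbT eq_sym; exact: (h q).
apply/idP/idP => [H|].
  rewrite -(ltr_nat R) natrD; lra.
rewrite addnS ltnS -(ler_nat R) natrD; lra.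
Qed.

(** Shifting the line by i units exhibits the partial sum with i + c_l terms in row [l], and the
    integral along the shifted line vanishes in the limit. *)
Theorem jkernel_residues f sigma (S : 'I_n -> C) : 0 < x -> (0 < n)%N ->
  admissible mu M sigma f -> simple_poles mu M ->
  (forall l, \sum_(j < N) Hres mu M x l j @[N --> \oo] --> S l) ->
  jkernel mu M f x = \sum_(l < n) S l.
Proof.
move=> x0 n0 adm simp hS; have [d d0 sd] := admissible_exponent n0 smu adm.
have [sig [df cf'] [T fs] fleft] := adm.
have [S1 hS1] := Hfun_shift_iter x0 n0.
pose H := \sum_(l < n) cRe (halfabs R (M l)).
have hH l : 0 <= cRe (halfabs R (M l)) <= H.
  rewrite halfabs_ge0 /= /H (bigD1 l)//= lerDl; apply: sumr_ge0 => i _; exact: halfabs_ge0.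
have H0 : 0 <= H by apply: sumr_ge0 => l _; exact: halfabs_ge0.
have [s0 s0S s0z] := line_avoiding_poles (`|S1| + `|sigma| + Bmu + H + 1).
have [a1 a2] : 0 <= `|S1| /\ 0 <= `|sigma| by [].
have a3 := ler_norm S1; have a4 := ler_norm (- sigma); rewrite normrN in a4.
have s0sig : s0 < sigma.
  by move: s0S Bmu0 H0 a1 a4; clear; move: (`|S1|) (`|sigma|) Bmu H => ? ? ? ? *; lra.
have s01 : s0 <= - 1 /\ s0 <= - S1.
  by move: s0S Bmu0 H0 a1 a2 a3; clear; move: (`|S1|) (`|sigma|) Bmu H => ? ? ? ? *; split; lra.
pose c l := (Num.truncn (cRe (mu l) - cRe (halfabs R (M l)) - s0)).+1.
have s0r l : s0 < cRe (mu l) - cRe (halfabs R (M l)).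
  have /andP[b1 b2] := hH l.
  have := le_trans (re_le_nrm (mu l)) (muB l); rewrite ler_norml => /andP[b3 b4]; lra.
have cond i l j : (s0 - i%:R < cRe (apole mu M l j)) = (j < i + c l)%N.
  by rewrite apole_re -halfabs_re; apply: simple_real_shift => //; exact: s0z.
have key i : cintegral (contour_integrand mu M x f) -
   cintegral (contour_integrand mu M x (fun=> s0 - i%:R)) =
   2 * cR pi * cI R * \sum_(l < n) \sum_(j < i + c l) Hres mu M x l j.
  pose K0 := (i + \sum_(l < n) c l)%N.
  have cK l : (i + c l <= K0)%N by rewrite leq_add2l (bigD1 l)//= leq_addr.
  have i0 := ler0n R i.
  rewrite (@contour_residues f sigma (s0 - i%:R) d T K0 d0 sd fs df cf').
  - congr (_ * _); apply: eq_bigr => l _.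
    rewrite (big_ord_widen K0 (fun j => Hres mu M x l j) (cK l)).
    by apply: eq_bigl => j; rewrite cond.
  - move=> l j; have := fleft l (2 * j)%N; rewrite apole_re natrM.
    by rewrite [2 * _ / 2]mulrC mulKf//.
  - by apply: le_lt_trans s0sig; rewrite gerBl.
  - move=> l j; apply/eqP; rewrite apole_re => h.
    have /negP[] := s0z l (j%:Z - i%:Z); apply/eqP.
    by rewrite halfabs_re rmorphB /=; lra.
  - exact: simp.
  - by move=> l j Kj; rewrite leNgt cond -leqNgt (leq_trans (cK l)).
have l1 : cintegral (contour_integrand mu M x (fun=> s0 - i%:R)) @[i --> \oo] --> (0 : C).
  apply: (far_line_cvg0 x0 n0 s0z s01.1) => s i ss0.
  by apply: hS1; apply: le_trans ss0 s01.2.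
have l2 : \sum_(l < n) \sum_(j < i + c l) Hres mu M x l j @[i --> \oo] --> \sum_(l < n) S l.
  apply: cvgC_sum => l.
  exact: (cvg_comp _ _ (cvg_addnr (c l)) (hS l)).
have l3 : 2 * cR pi * cI R * \sum_(l < n) \sum_(j < i + c l) Hres mu M x l j @[i --> \oo] -->
    2 * cR pi * cI R * \sum_(l < n) S l by apply: cvgM; [exact: cvg_cst|exact: l2].
have l4 : cintegral (contour_integrand mu M x f) -
   cintegral (contour_integrand mu M x (fun=> s0 - i%:R)) @[i --> \oo] -->
   cintegral (contour_integrand mu M x f) - 0.
  apply: (@cvgC_le R _ _ _ _ _ (fun i : nat =>
    nrm (cintegral (contour_integrand mu M x (fun=> s0 - i%:R))))).
    by apply: nearW => i; rewrite subr0 addrAC subrr add0r nrmN.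
  by have := cvg_nrm l1; rewrite nrm0; apply.
have E := funext key; rewrite E in l4.
have := cvgC_unique l4 l3; rewrite subr0 jkernelE => ->.
rewrite mulrA mulVf ?mul1r// !mulf_neq0 ?cI_neq0 ?pnatr_eq0//.
by rewrite cR_eq0 gt_eqF// pi_gt0.
Qed.

End FixedParameter.

End ContourIntegrals.

(** * The residues as products of Bessel terms *)

Section ResidueTerms.
Variable R : realType.
Local Notation C := (C R).
Implicit Types (s z : C) (k : int).

(** By reflection a zero of the sine would be a zero of [rgamma] at z or at 1 - z. *)
Lemma csin_pi_neq0 z : (forall j : int, z != j%:~R) -> csin (cR pi * z) != 0.
Proof.
move=> zj; have pi0 : cR pi != 0 :> C by rewrite cR_eq0 gt_eqF// pi_gt0.
apply/eqP => s0; have := rgamma_reflection z; rewrite s0 mul0r => /eqP.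
rewrite mulf_eq0 => /orP[] /eqP; apply/eqP; apply: rgamma_neq0 => j.
  by have := zj (- j%:Z); rewrite rmorphN /= -subr_eq0 opprK.
have := zj j.+1%:Z.
apply: contra_neq => h; rewrite -pmulrn -natr1.
have -> : z = z + (1 - z + j%:R) by rewrite h addr0.
by ring.
Qed.

(** Reflection moves the denominator [rgamma (s + halfabs R k)] into the numerator, next to a sine.
    One formula serves both signs of k: for negative k, passing from |k| to k changes i^|k| and the
    sine by the same sign (-1)^k. *)
Lemma GkE2 k s : csin (cR pi * (s + k%:~R / 2)) != 0 ->
  Gk k s = cI R ^ k * rpowC (2 * pi) (1 - 2 * s) * (cR pi / csin (cR pi * (s + k%:~R / 2))) *
    rgamma (1 - s - k%:~R / 2) * rgamma (1 - s + k%:~R / 2).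
Proof.
have pi0 : cR pi != 0 :> C by rewrite cR_eq0 gt_eqF// pi_gt0.
move=> s0.
have key (h w c : C) : w != 0 -> w = c * csin (cR pi * (s + h)) ->
    c * c = 1 ->
    rgamma (1 - s + h) / rgamma (s + h) = c * (cR pi / w * rgamma (1 - s - h) * rgamma (1 - s + h)).
  move=> w0 wE cc; have := rgamma_reflection (s + h).
  have -> : 1 - (s + h) = 1 - s - h by ring.
  have -> : csin (cR pi * (s + h)) = c * w by rewrite wE mulrA cc mul1r.
  move=> rE; have c0 : c != 0.
    by apply: contraNneq (oner_neq0 C) => c0; rewrite -cc c0 mul0r.
  have r0 : rgamma (s + h) != 0.
    apply: contraNneq w0 => r0; move: rE; rewrite r0 mul0r => /esym/eqP.
    by rewrite !mulf_eq0 invr_eq0 (negbTE c0) (negbTE pi0) /= orbF.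
  have -> : rgamma (1 - s - h) = c * w / cR pi / rgamma (s + h) by rewrite -rE mulrAC divff ?mul1r.
  have -> : c * (cR pi / w * (c * w / cR pi / rgamma (s + h)) * rgamma (1 - s + h)) =
     c * c * (rgamma (1 - s + h) / rgamma (s + h)).
    move: (rgamma _) (rgamma _) (cR pi) r0 pi0 => r t p r0 p0.
    by field; rewrite r0 p0 w0.
  by rewrite cc mul1r.
case: k s0 => a s0; rewrite GkE /halfabs.
  rewrite (key _ (csin (cR pi * (s + (Posz a)%:~R / 2))) 1)//; last 2 first.
  - by rewrite mul1r.
  - by rewrite mulr1.
  rewrite mul1r /=; move: (rgamma _) (rgamma _) => x y.
  by rewrite -!mulrA.
rewrite (key _ (csin (cR pi * (s + (Negz a)%:~R / 2))) ((-1) ^+ a.+1))//; last 2 first.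
- have -> : s + (absz (Negz a))%:R / 2 = s + (Negz a)%:~R / 2 + a.+1%:R.
    by rewrite NegzE rmorphN /= -pmulrn; field.
  by rewrite [cR pi * (_ + a.+1%:R)]mulrDr csinDpin mulrA -expr2 sqrr_sign mul1r.
- by rewrite -expr2 sqrr_sign.
have -> : (absz (Negz a))%:R / 2 = - ((Negz a)%:~R / 2) :> C.
  by rewrite NegzE rmorphN /= -pmulrn; field.
rewrite opprK.
have -> : cI R ^ Negz a = cI R ^+ absz (Negz a) * (-1) ^+ a.+1.
  rewrite NegzE -exprnN /= -exprVn; have -> : (cI R)^-1 = - cI R by exact: invCi.
  by rewrite -[- cI R]mulN1r exprMn mulrC.
by move: (rgamma _) (rgamma _) => x y; ring.
Qed.

Variable n : nat.
Implicit Types (mu lam : 'I_n -> C) (m M : 'I_n -> int) (l q : 'I_n).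

Definition besselJ_term l lam (L : C) (j : nat) : C :=
  (cI R ^+ n) ^+ j * cexp (n%:R * (- lam l + j%:R) * L) *
  \prod_(q < n) rgamma (lam q - lam l + j%:R + 1).

Lemma besselJE l lam L :
  besselJ l true lam L = lim ((fun N : nat => \sum_(j < N) besselJ_term l lam L j) @ \oo).
Proof.
apply: (congr1 (fun u : nat -> C => lim (u @ \oo))); apply/funext => N; apply: eq_bigr => j _.
(* [Gamma] is the inverse of [rgamma], so dividing by it gives back [rgamma] also at the poles of
   Gamma, where the convention 0^-1 = 0 yields the coefficient 0. *)
by rewrite mul1r /besselJ_term -prodfV; congr (_ * _); apply: eq_bigr => q _; rewrite invrK.
Qed.

(** |d| and d differ by an even integer, so the absolute value in genericity may be replaced by the
    signed difference. *)
Lemma genericE mu m : generic mu m -> forall l q, l != q -> forall j : int,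
  mu l - mu q - (m l - m q)%:~R / 2 != j%:~R.
Proof.
move=> gen l q lq j; have [d0|d0] := leP 0 (m l - m q).
  have := gen l q lq j; apply: contraNneq => <-.
  have -> : (absz (m l - m q))%:R = (m l - m q)%:~R :> C by rewrite pmulrn gez0_abs.
  by apply/eqP; field.
have := gen l q lq (j + (m l - m q)); apply: contraNneq => h.
have -> : (absz (m l - m q))%:R = - (m l - m q)%:~R :> C.
  by rewrite pmulrn ltz0_abs// rmorphN.
have e : (j + (m l - m q))%:~R = j%:~R + (m l - m q)%:~R :> C by rewrite rmorphD.
by apply/eqP; rewrite e -h; field.
Qed.

Lemma generic_shift mu m k : generic mu m -> generic mu (fun l => m l + k).
Proof. by move=> g l q lq j; rewrite opprD addrACA subrr addr0; exact: g. Qed.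

Lemma generic_simple_poles mu M : generic mu M -> simple_poles mu M.
Proof.
move=> g l q lq i j; apply/eqP; rewrite /apole => h.
have negpart (k : int) : exists z : int, (absz k)%:R = k%:~R + 2 * z%:~R :> C.
  case: k => a; first by exists 0; rewrite mulr0 addr0.
  by exists a.+1%:Z; rewrite NegzE rmorphN /= -!pmulrn; ring.
have [zl hl] := negpart (M l); have [zq hq] := negpart (M q).
have /eqP[] := genericE g lq (zl - zq + i%:Z - j%:Z).
rewrite !(rmorphD, rmorphN) /= -!pmulrn.
have -> : mu l = mu q - halfabs R (M q) - j%:R + halfabs R (M l) + i%:R by rewrite -h; ring.
by rewrite /halfabs hl hq; field.
Qed.

(** The two arguments of the sine differ by pi d, which changes it by (-1)^d; (-i)^d = (-1)^d i^d
    carries the same sign. *)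
Lemma Scoef_factor_sign z (d : int) :
  (1 * cI R) ^ d * (csin (cR pi * (z + 1 * d%:~R / 2)))^-1 =
  (- 1 * cI R) ^ d * (csin (cR pi * (z + - 1 * d%:~R / 2)))^-1.
Proof.
have -> : cR pi * (z + 1 * d%:~R / 2) =
   cR pi * (z + - 1 * d%:~R / 2) + cR pi * d%:~R :> C by move: (cR pi) => p; field.
rewrite (csinDpiz (cR pi * (z + - 1 * d%:~R / 2)) d); move: (csin _) => w.
have e1 : (-1) ^ d * (-1) ^ d = 1 :> C by rewrite -expfzMl mulrNN mulr1 exp1rz.
have e2 : ((-1) ^ d)^-1 = (-1) ^ d :> C.
  have s0 : (-1) ^ d != 0 :> C by rewrite expfz_neq0// oppr_eq0 oner_neq0.
  by apply: (mulfI s0); rewrite e1 divff.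
rewrite (expfzMl (- 1 : C)) invfM e2 mul1r; move: (_ ^ d) (_ ^ d) => x y; ring.
Qed.

Lemma Scoef_sign mu m l : Scoef mu m true l = Scoef mu m false l.
Proof. by apply: eq_bigr => q ql; exact: Scoef_factor_sign. Qed.

(** The conditions on [al], [be], [kap] say al - be = m_l + k and min(al, be) = kap. At the pole s =
    mu_l - mu_q - (al + be)/2, so that 1 - s + (m_q + k)/2 and 1 - s - (m_q + k)/2 become the Gamma
    arguments of the Bessel terms number [al] and [be]. *)
Lemma Gk_residue_factor mu m k l q (kap al be : nat) : generic mu m -> q != l ->
  m l + k = al%:Z - be%:Z -> (absz (m l + k)%R + 2 * kap = al + be)%N ->
  Gk (m q + k) (apole mu (fun l => m l + k) l kap - mu q) =
  cR pi * rpowC (2 * pi) (1 - 2 * (apole mu (fun l => m l + k) l kap - mu q)) *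
  ((- 1 * cI R) ^ (m l - m q) * (csin (cR pi * (mu l - mu q + - 1 * (m l - m q)%:~R / 2)))^-1) *
  cI R ^+ (al + be) *
  (rgamma ((mu q + (m q)%:~R / 2) - (mu l + (m l)%:~R / 2) + al%:R + 1) *
   rgamma ((mu q - (m q)%:~R / 2) - (mu l - (m l)%:~R / 2) + be%:R + 1)).
Proof.
move=> gen ql hM hk.
set s := apole _ _ _ _ - mu q.
have hk' : (absz (m l + k)%R)%:R + 2 * kap%:R = al%:R + be%:R :> C.
  by rewrite -natrM -!natrD hk.
have hM' : (m l)%:~R + k%:~R = al%:R - be%:R :> C by rewrite -rmorphD hM rmorphB.
have sE : s = mu l - mu q - (al%:R + be%:R) / 2 by rewrite /s /apole /halfabs -hk'; field.
have kE : k%:~R = al%:R - be%:R - (m l)%:~R :> C by rewrite -hM'; ring.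
have sinE : csin (cR pi * (s + (m q + k)%:~R / 2)) =
   (-1) ^+ be * csin (cR pi * (mu l - mu q + - 1 * (m l - m q)%:~R / 2)).
  have -> : mu l - mu q + - 1 * (m l - m q)%:~R / 2 = s + (m q + k)%:~R / 2 + be%:R.
    by rewrite sE !(rmorphD, rmorphN) /= kE; field.
  by rewrite [cR pi * (_ + be%:R)]mulrDr csinDpin mulrA -expr2 sqrr_sign mul1r.
have sin0 : csin (cR pi * (mu l - mu q + - 1 * (m l - m q)%:~R / 2)) != 0.
  apply: csin_pi_neq0 => j; have := genericE gen (l := l) (q := q).
  by rewrite eq_sym => /(_ ql j); rewrite mulN1r mulNr.
rewrite GkE2; last by rewrite sinE mulf_neq0// signr_eq0.
rewrite sinE invfM invr_sign.
have -> : 1 - s - (m q + k)%:~R / 2 =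
   (mu q - (m q)%:~R / 2) - (mu l - (m l)%:~R / 2) + be%:R + 1.
  by rewrite sE !(rmorphD, rmorphN) /= kE; field.
have -> : 1 - s + (m q + k)%:~R / 2 =
   (mu q + (m q)%:~R / 2) - (mu l + (m l)%:~R / 2) + al%:R + 1.
  by rewrite sE !(rmorphD, rmorphN) /= kE; field.
have -> : cI R ^ (m q + k) = (-1) ^+ be * ((- 1 * cI R) ^ (m l - m q) * cI R ^+ (al + be)).
  have -> : - 1 * cI R = (cI R)^-1 by rewrite mulN1r invCi.
  have -> : (-1) ^+ be = cI R ^ (- (2 * be)%:Z) :> C.
    by rewrite -exprnN exprM cI2 -exprVn invrN1.
  rewrite exprz_inv exprnP -!expfzDr ?cI_neq0//; congr (_ ^ _).
  by lia.
move: (rgamma _) (rgamma _) (csin _)^-1 (rpowC _ _) => a b c d.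
have : (-1) ^+ be * (-1) ^+ be = 1 :> C by rewrite -expr2 sqrr_sign.
set e := _ ^+ be => ee; move: (_ ^ (m l - m q)) (_ ^+ (al + be)) (cR _) => f g h.
have -> : e * (f * g) * d * (h * (e * c)) * b * a = (e * e) * (f * g * d * h * c * b * a) by ring.
by rewrite ee; ring.
Qed.

(** This is the polar factor q = l: kap and kap + |k| are al and be in some order, so it supplies
    1/(al! be!). *)
Lemma Gk_res_factor k (kap al be : nat) : k = al%:Z - be%:Z -> (absz k + 2 * kap = al + be)%N ->
  Gk_res R k kap = rpowC (2 * pi) (1 + 2 * halfabs R k + 2 * kap%:R) * cI R ^+ (al + be) *
    (rgamma (al%:R + 1) * rgamma (be%:R + 1)).
Proof.
move=> kE kk; rewrite /Gk_res !natr1 !rgamma_nat.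
have -> : 1 + 2 * halfabs R k + kap%:R = (absz k + kap).+1%:R.
  by rewrite -[in RHS]natr1 natrD /halfabs; field.
rewrite rgamma_nat -kk exprD exprM cI2.
have : (al`! * be`! = kap`! * (absz k + kap)`!)%N.
  have [ab|ab] := leqP be al.
    have [-> ->] : kap = be /\ (absz k + be)%N = al by split; lia.
    by rewrite mulnC.
  have -> : (absz k + kap)%N = be by lia.
  by have -> : kap = al by lia.
move=> /(congr1 (fun a : nat => a%:R : C)); rewrite !natrM => e.
by rewrite -[(al`!%:R)^-1 * _]invfM e invfM; ring.
Qed.

Lemma Hres_term mu m k l (kap al be : nat) (x phi : R) (b : bool) : generic mu m ->
  0 < x -> \sum_(q < n) mu q = 0 ->
  m l + k = al%:Z - be%:Z -> (absz (m l + k)%R + 2 * kap = al + be)%N ->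
  (2 * cR pi)^-1 * Hres mu (fun l => m l + k) x l kap * cexp (cI R * cR phi) ^ k =
  cR (2 * pi ^+ 2) ^+ n.-1 * (Scoef mu m b l *
    besselJ_term l (fun q => mu q + (m q)%:~R / 2) (log_root n x phi) al *
    besselJ_term l (fun q => mu q - (m q)%:~R / 2) (log_root n x (- phi)) be).
Proof.
move=> gen x0 smu hM hk; set s := apole mu (fun l => m l + k) l kap.
have -> : Scoef mu m b l = Scoef mu m false l by case: b; rewrite ?Scoef_sign.
have n0 : (0 < n)%N by case: n l {gen smu hM hk s} => [[]|].
have pi20 : (0 : R) < 2 * pi by rewrite mulr_gt0// pi_gt0.
have nC : n%:R != 0 :> C by rewrite pnatr_eq0 -lt0n.
have hk' : (absz (m l + k)%R)%:R + 2 * kap%:R = al%:R + be%:R :> C.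
  by rewrite -natrM -!natrD hk.
have kE : k%:~R = al%:R - be%:R - (m l)%:~R :> C.
  have : (m l)%:~R + k%:~R = al%:R - be%:R :> C by rewrite -rmorphD hM rmorphB.
  by move=> <-; ring.
have sE : 2 * s = 2 * mu l - (al%:R + be%:R) by rewrite /s /apole /halfabs -hk'; field.
rewrite /Hres (Gk_res_factor hM hk) (eq_bigr _ (fun q ql => Gk_residue_factor gen ql hM hk)).
rewrite -/s !big_split /= !prodr_const /besselJ_term.
have -> : #|[pred q | q != l]| = n.-1 by have := cardC1 l; rewrite card_ord.
rewrite [in RHS](bigD1 l)//= [X in _ = _ * (_ * _ * (_ * X))](bigD1 l)//=.
rewrite !subrr !add0r -/(Scoef mu m false l).
set G1 := \prod_(i < n | i != l) rgamma _; set G2 := \prod_(i < n | i != l) rgamma _.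
set S := Scoef mu m false l.
(* The powers of 2 pi and x and the phase are compared inside a single exponential. The vanishing
   sum of the [mu] enters here: the sum over i != l equals - mu_l. *)
have E : (2 * cR pi)^-1 * (\prod_(i < n | i != l) rpowC (2 * pi) (1 - 2 * (s - mu i))) *
   rpowC (2 * pi) (1 + 2 * halfabs R (m l + k) + 2 * kap%:R) * rpowC x (- 2 * s) *
   cexp (cI R * cR phi) ^ k =
   cR (2 * pi) ^+ n.-1 *
   (cexp (n%:R * (- (mu l + (m l)%:~R / 2) + al%:R) * log_root n x phi) *
    cexp (n%:R * (- (mu l - (m l)%:~R / 2) + be%:R) * log_root n x (- phi))).
  have -> : (2 * cR pi)^-1 = rpowC (2 * pi) (- (1 : C)) by rewrite rpowCN rpowC1// cRM cR_nat.
  rewrite -rpowC_nat// /rpowC -cexp_sum -cexpMz -!cexpD; congr cexp.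
  rewrite /log_root !complexE'.
  have -> : cR (phi / n%:R) = cR phi / n%:R by rewrite cRM cRV cR_nat.
  have -> : cR (- phi / n%:R) = - cR phi / n%:R by rewrite cRM cRV cR_nat cRN.
  have -> : cR (ln (2 * pi) + ln x / n%:R) = cR (ln (2 * pi)) + cR (ln x) / n%:R.
    by rewrite cRD cRM cRV cR_nat.
  rewrite -mulr_suml.
  have -> : \sum_(i < n | i != l) (1 - 2 * (s - mu i)) = n.-1%:R * (1 - 2 * s) - 2 * mu l.
    have h : \sum_(i < n | i != l) mu i = - mu l.
      by move: smu; rewrite (bigD1 l)//= addrC => /eqP; rewrite addr_eq0 => /eqP.
    have -> : \sum_(i < n | i != l) (1 - 2 * (s - mu i)) =
       \sum_(i < n | i != l) ((1 - 2 * s) + 2 * mu i) by apply: eq_bigr => i _; ring.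
    rewrite big_split /= -mulr_sumr h sumr_const.
    have -> : #|[pred q | q != l]| = n.-1 by have := cardC1 l; rewrite card_ord.
    by rewrite -[_ *+ n.-1]mulr_natl; ring.
  have -> : n.-1%:R = n%:R - 1 :> C by rewrite -subn1 natrB.
  have -> : 2 * halfabs R (m l + k) = al%:R + be%:R - 2 * kap%:R.
    by rewrite -hk' /halfabs; field.
  rewrite kE; move: sE; move: s (cR (ln _)) (cR (ln x)) (cR phi) => t u v w tE.
  have -> : t = mu l - (al%:R + be%:R) / 2.
    have -> : t = 2 * t / 2 by field.
    by rewrite tE; field.
  by field.
have -> : 2 * pi ^+ 2 = 2 * pi * pi :> R by ring.
rewrite (cRM (2 * pi)) exprMn.
have I1 : (cI R ^+ n) ^+ al * (cI R ^+ n) ^+ be = (cI R ^+ (al + be)) ^+ n.-1 * cI R ^+ (al + be).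
  by rewrite -exprD -exprM -exprSr prednK// -exprM mulnC.
have SE : (\prod_(i < n | i != l) (-1 * cI R) ^ (m l - m i)) *
   (\prod_(i < n | i != l)
      (csin (cR pi * (mu l - mu i + -1 * (m l - m i)%:~R / 2)))^-1) = S.
  by rewrite -big_split.
rewrite SE; clearbody S G1 G2.
move: E I1; set E1 := cexp (n%:R * _ * _); set E2 := cexp (n%:R * _ * _).
set P := \prod_(i < n | i != l) rpowC _ _; set Q := rpowC (2 * pi) _; set X := rpowC x _.
set Z := _ ^ k; set a := (2 * cR pi)^-1; set T := cR (2 * pi) ^+ _.
set i1 := (cI R ^+ n) ^+ al; set i2 := (cI R ^+ n) ^+ be; set j1 := _ ^+ n.-1; set j2 := _ ^+ (al + be).
set p := cR pi ^+ n.-1; clearbody E1 E2 P Q X Z a T i1 i2 j1 j2 p => e1 e2.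
rewrite (_ : _ * Z = (a * P * Q * X * Z) * (p * S * (j1 * j2) * (G1 * G2) *
  (rgamma (al%:R + 1) * rgamma (be%:R + 1)))); last by ring.
by rewrite e1 -e2; ring.
Qed.

End ResidueTerms.

(** * Summation over the diagonals *)

Section GeometricSeries.
Variable R : realType.
Local Notation C := (C R).
Implicit Types (u v : nat -> C) (A B : R).

Definition geometric_bound A u := forall j, nrm (u j) <= A * 2^-1 ^+ j.

Lemma half_ge0 j : 0 <= 2^-1 ^+ j :> R.
Proof. by rewrite exprn_ge0 ?invr_ge0. Qed.

Lemma cvg_half (A : R) : A * 2^-1 ^+ j @[j --> \oo] --> (0 : R).
Proof.
rewrite -[X in _ --> X](mulr0 A); apply: cvgM; [exact: cvg_cst|apply: cvg_expr].
by rewrite ger0_norm ?invr_ge0// invf_lt1 ?ltr1n.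
Qed.

Lemma geometric_bound_ratio u J : (forall j, (J <= j)%N -> nrm (u j.+1) <= 2^-1 * nrm (u j)) ->
  exists2 A, 0 <= A & geometric_bound A u.
Proof.
move=> h; pose A := \sum_(i < J.+1) nrm (u i) * 2 ^+ i.
have A0 : 0 <= A by apply: sumr_ge0 => i _; rewrite mulr_ge0 ?nrm_ge0 ?exprn_ge0.
exists A => // j; have small i : (i <= J)%N -> nrm (u i) <= A * 2^-1 ^+ i.
  move=> iJ; rewrite exprVn ler_pdivlMr ?exprn_gt0//.
  rewrite /A (bigD1 (Ordinal (iJ : (i < J.+1)%N)))//= lerDl.
  by apply: sumr_ge0 => k _; rewrite mulr_ge0 ?nrm_ge0 ?exprn_ge0.
have [/small//|/ltnW Jj] := leqP j J.
rewrite -(subnKC Jj); elim: (j - J)%N => [|i IH]; first by rewrite addn0 small.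
rewrite addnS; apply: le_trans (h _ (leq_addr _ _)) _.
by rewrite exprS mulrCA ler_wpM2l ?invr_ge0.
Qed.

Lemma sum_half_le (m n : nat) : \sum_(m <= j < n) 2^-1 ^+ j <= 2 * 2^-1 ^+ m :> R.
Proof.
have [mn|nm] := leqP m n; last first.
  by rewrite big_geq ?(ltnW nm)// mulr_ge0 ?half_ge0.
have : \sum_(m <= j < n) 2^-1 ^+ j = 2 * 2^-1 ^+ m - 2 * 2^-1 ^+ n :> R.
  elim: n mn => [|n IH]; first by rewrite leqn0 => /eqP ->; rewrite big_geq// subrr.
  rewrite leq_eqVlt => /orP[/eqP->|mn]; first by rewrite big_geq// subrr.
  by rewrite big_nat_recr//= IH// !exprS; field.
by move=> ->; rewrite gerBl mulr_ge0 ?half_ge0.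
Qed.

Lemma geometric_cvg A u : 0 <= A -> geometric_bound A u ->
  exists s : C, \sum_(j < N) u j @[N --> \oo] --> s.
Proof.
move=> A0 uA; apply: cauchyC_cvg => e e0.
have /cvgrPdist_lt /(_ _ e0) [N _ hN] := cvg_half (A * 2).
exists N => M NM; have := hN N (leqnn N).
rewrite /= sub0r normrN ger0_norm ?mulr_ge0 ?half_ge0// => /ltW; apply: le_trans.
rewrite -(big_mkord xpredT u) -(big_mkord xpredT u) (big_cat_nat _ NM)//= addrAC subrr add0r.
apply: le_trans (nrm_sum _ _ _) _.
apply: (@le_trans _ _ (\sum_(N <= j < M) A * 2^-1 ^+ j)); first by apply: ler_sum => j _; exact: uA.
by rewrite -mulr_sumr -mulrA ler_wpM2l// sum_half_le.
Qed.

End GeometricSeries.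

Section DiagonalSums.
Variable R : realType.
Local Notation C := (C R).
Implicit Types (u v : nat -> C) (A B : R) (k m : int).

Definition posn k : nat := if k is Posz a then a else 0%N.

Lemma posn_sub k : k = (posn k)%:Z - (posn (- k))%:Z.
Proof. case: k => [[|a]|a] /=; lia. Qed.

Lemma posn_abs k (j : nat) : (absz k + 2 * j = (j + posn k) + (j + posn (- k)))%N.
Proof. by case: k => [[|a]|a] /=; lia. Qed.

Lemma posn_subn (a b : nat) : posn (a%:Z - b%:Z) = (a - b)%N.
Proof. by case E : (a%:Z - b%:Z) => [c|c] /=; lia. Qed.

(** [posn] is the positive part, so the index pairs (j + posn k, j + posn (-k)) run once through all
    pairs with difference k, and j is their minimum. *)
Definition diag_term u v k (j : nat) : C := u (j + posn k)%N * v (j + posn (- k))%N.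

Lemma diag_geometric A B u v k : 0 <= A -> 0 <= B -> geometric_bound A u -> geometric_bound B v ->
  geometric_bound (A * B) (diag_term u v k).
Proof.
move=> A0 B0 uA vB j; rewrite nrmM.
have half1 (i : nat) : 2^-1 ^+ i <= 1 :> R.
  by rewrite exprn_ile1// ?invr_ge0// invf_le1// ler1n.
have h1 : nrm (u (j + posn k)%N) <= A * 2^-1 ^+ j.
  apply: le_trans (uA _) _; rewrite exprD ler_wpM2l//.
  by rewrite -[leRHS]mulr1 ler_wpM2l ?half_ge0.
have h2 : nrm (v (j + posn (- k))%N) <= B.
  by apply: le_trans (vB _) _; rewrite -[leRHS]mulr1 ler_wpM2l.
by rewrite mulrAC; apply: ler_pM; rewrite ?nrm_ge0.
Qed.

(** The first sum covers each pair of the box [a, b < P] exactly once, and every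
    other pair it covers has [a >= P] or [b >= P]. *)
Lemma diagonal_box A B u v m (N Q P : nat) : 0 <= A -> 0 <= B ->
  geometric_bound A u -> geometric_bound B v ->
  (P + absz m <= N.+1)%N -> (P <= Q)%N ->
  nrm (\sum_(i < (2 * N).+1) \sum_(j < Q) diag_term u v (m + (i%:Z - N%:Z)) j -
       (\sum_(a < P) u a) * (\sum_(b < P) v b)) <= 8 * (A * B) * 2^-1 ^+ P.
Proof.
move=> A0 B0 uA vB PN PQ.
(* All occurring indices are below [L], so [inord] in [h] never takes its default value. *)
pose L := (Q + N + absz m).+1.
pose kk (i : 'I_(2 * N).+1) : int := m + (i%:Z - N%:Z).
have kL i : (absz (kk i) <= N + absz m)%N by rewrite /kk; have := ltn_ord i; lia.
have posk k : (posn k <= absz k)%N by case: k.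
pose h (p : 'I_(2 * N).+1 * 'I_Q) : 'I_L * 'I_L :=
  (inord (p.2 + posn (kk p.1)), inord (p.2 + posn (- kk p.1))).
have hb1 (i : 'I_(2 * N).+1) (j : 'I_Q) : (j + posn (kk i) < L)%N.
  by have := kL i; have := posk (kk i); have := ltn_ord j; rewrite /L; lia.
have hb2 (i : 'I_(2 * N).+1) (j : 'I_Q) : (j + posn (- kk i) < L)%N.
  by have := kL i; have := posk (- kk i); have := ltn_ord j; rewrite /L abszN; lia.
pose F (y : 'I_L * 'I_L) : C := u y.1 * v y.2.
have hF (p : 'I_(2 * N).+1 * 'I_Q) : diag_term u v (kk p.1) p.2 = F (h p).
  by rewrite /F /h /diag_term !inordK.
have hinj : injective h.
  move=> [i j] [i' j'] [] /(congr1 val) /= + /(congr1 val) /=.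
  rewrite !inordK// => e1 e2.
  have e3 : kk i = kk i'.
    by rewrite (posn_sub (kk i)) (posn_sub (kk i')); lia.
  have ei : i = i' by apply: val_inj; move: e3; rewrite /kk /=; lia.
  by congr pair => //; apply: val_inj => /=; rewrite ei in e1; lia.
rewrite pair_big /= (eq_bigr (fun p => F (h p))) => [|p _]; last exact: hF.
pose D := (h @: [set: 'I_(2 * N).+1 * 'I_Q])%SET.
pose E := [set y : 'I_L * 'I_L | (y.1 < P)%N && (y.2 < P)%N]%SET.
have -> : \sum_p F (h p) = \sum_(y in D) F y.
  by rewrite big_imset /=; [apply: eq_bigl => p; rewrite inE|move=> p q _ _; exact: hinj].
have ED : E \subset D.
  apply/fintype.subsetP => -[a b]; rewrite inE /= => /andP[aP bP].
  pose k : int := (a : nat)%:Z - (b : nat)%:Z.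
  have iN : (absz (k - m + N%:Z)%R < (2 * N).+1)%N by rewrite /k; lia.
  have jQ : (minn a b < Q)%N by lia.
  apply/imsetP; exists (Ordinal iN, Ordinal jQ) => //.
  have kE : kk (Ordinal iN) = k by rewrite /kk /= /k; lia.
  rewrite /h /= kE /k opprB !posn_subn.
  by congr pair; apply: val_inj; rewrite /= inordK; lia.
rewrite (finset.big_setID E) /= (finset.setIidPr ED).
have -> : \sum_(y in E) F y = (\sum_(a < P) u a) * (\sum_(b < P) v b).
  have PL : (P <= L)%N by rewrite /L; lia.
  rewrite (big_ord_widen L u PL) (big_ord_widen L v PL) big_distrlr /= pair_big /=.
  by apply: eq_bigl => y; rewrite inE.
rewrite addrAC subrr add0r; apply: le_trans (nrm_sum _ _ _) _.
pose g (y : 'I_L * 'I_L) : R := A * 2^-1 ^+ y.1 * (B * 2^-1 ^+ y.2).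
have g0 y : 0 <= g y by rewrite /g !mulr_ge0 ?half_ge0.
have gF y : nrm (F y) <= g y by rewrite /F nrmM ler_pM ?nrm_ge0.
apply: (@le_trans _ _ (\sum_(y : 'I_L * 'I_L | (P <= y.1)%N) g y + \sum_(y : 'I_L * 'I_L | (P <= y.2)%N) g y)).
  rewrite big_mkcond [X in X + _]big_mkcond [X in _ + X]big_mkcond -big_split /=.
  apply: ler_sum => y _; rewrite !inE.
  have := g0 y; have := gF y; have := nrm_ge0 (F y).
  by case: (ltnP y.1 P); case: (ltnP y.2 P) => //=; rewrite ?andbT; case: ifP => _; lra.
have tail (W : R) : 0 <= W -> \sum_(a < L | (P <= a)%N) W * 2^-1 ^+ a <= W * (2 * 2^-1 ^+ P).
  move=> W0; rewrite -mulr_sumr ler_wpM2l//.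
  by have := sum_half_le R P L; rewrite big_geq_mkord.
have full (W : R) : 0 <= W -> \sum_(a < L) W * 2^-1 ^+ a <= W * 2.
  move=> W0; rewrite -mulr_sumr ler_wpM2l//.
  by have := sum_half_le R 0 L; rewrite big_mkord expr0 mulr1.
have pos (W : R) : 0 <= W -> 0 <= \sum_(a < L) W * 2^-1 ^+ a.
  by move=> W0; apply: sumr_ge0 => i _; rewrite mulr_ge0 ?half_ge0.
have pos' (W : R) : 0 <= W -> 0 <= \sum_(a < L | (P <= a)%N) W * 2^-1 ^+ a.
  by move=> W0; apply: sumr_ge0 => i _; rewrite mulr_ge0 ?half_ge0.
have -> : \sum_(y : 'I_L * 'I_L | (P <= y.1)%N) g y =
    (\sum_(a < L | (P <= a)%N) A * 2^-1 ^+ a) * (\sum_(b < L) B * 2^-1 ^+ b).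
  by rewrite big_distrlr /= pair_big /=; apply: eq_bigl => y; rewrite andbT.
have -> : \sum_(y : 'I_L * 'I_L | (P <= y.2)%N) g y =
    (\sum_(a < L) A * 2^-1 ^+ a) * (\sum_(b < L | (P <= b)%N) B * 2^-1 ^+ b).
  by rewrite big_distrlr /= pair_big.
have -> : 8 * (A * B) * 2^-1 ^+ P = A * (2 * 2^-1 ^+ P) * (B * 2) + A * 2 * (B * (2 * 2^-1 ^+ P)) by ring.
by apply: lerD; apply: ler_pM; rewrite ?pos ?pos' ?tail ?full.
Qed.

Lemma diagonal_sum A B u v m (su sv : C) : 0 <= A -> 0 <= B ->
  geometric_bound A u -> geometric_bound B v ->
  \sum_(j < N) u j @[N --> \oo] --> su -> \sum_(j < N) v j @[N --> \oo] --> sv ->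
  forall S : int -> C,
  (forall k, \sum_(j < N) diag_term u v (m + k) j @[N --> \oo] --> S k) ->
  \sum_(i < (2 * N).+1) S (i%:Z - N%:Z) @[N --> \oo] --> su * sv.
Proof.
move=> A0 B0 uA vB hu hv S hS.
have box (N P : nat) : (P + absz m <= N.+1)%N ->
   nrm (\sum_(i < (2 * N).+1) S (i%:Z - N%:Z) -
     (\sum_(a < P) u a) * (\sum_(b < P) v b)) <= 8 * (A * B) * 2^-1 ^+ P.
  move=> PN.
  have h1 : \sum_(i < (2 * N).+1) \sum_(j < Q) diag_term u v (m + (i%:Z - N%:Z)) j -
       (\sum_(a < P) u a) * (\sum_(b < P) v b) @[Q --> \oo] -->
     \sum_(i < (2 * N).+1) S (i%:Z - N%:Z) - (\sum_(a < P) u a) * (\sum_(b < P) v b).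
    by apply: cvgB; [apply: cvgC_sum => i; exact: hS|exact: cvg_cst].
  apply: (cvgr_to_le (cvg_nrm h1)); near=> Q.
  by apply: diagonal_box => //; near: Q; exact: nbhs_infty_ge.
(* The shift by m displaces the window of diagonals |k| <= N, so the box that it covers shrinks by
   |m|. *)
pose P N := (N - absz m)%N.
have huv : (\sum_(a < P N) u a) * (\sum_(b < P N) v b) @[N --> \oo] --> su * sv.
  apply: cvgM; [exact: (cvg_comp _ _ (cvg_subnr (absz m)) hu)|exact: (cvg_comp _ _ (cvg_subnr (absz m)) hv)].
have hd : \sum_(i < (2 * N).+1) S (i%:Z - N%:Z) -
   (\sum_(a < P N) u a) * (\sum_(b < P N) v b) @[N --> \oo] --> (0 : C).
  apply: (@cvgC_le R _ _ _ _ _ (fun N : nat => 8 * (A * B) * 2^-1 ^+ P N)); last first.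
    exact: (cvg_comp _ _ (cvg_subnr (absz m)) (cvg_half (8 * (A * B)))).
  near=> N; rewrite subr0; apply: box.
  have : (absz m <= N)%N by near: N; exact: nbhs_infty_ge.
  by rewrite /P; lia.
rewrite -[X in _ --> X]add0r.
have hs : (\sum_(i < (2 * N).+1) S (i%:Z - N%:Z) -
   (\sum_(a < P N) u a) * (\sum_(b < P N) v b)) + (\sum_(a < P N) u a) * (\sum_(b < P N) v b)
   @[N --> \oo] --> 0 + su * sv by exact: (cvgD hd huv).
by apply: cvg_trans hs; apply: near_eq_cvg; apply: nearW => N /=; rewrite subrK.
Unshelve. all: by end_near. Qed.

End DiagonalSums.

(** * The generic case *)

Section GenericSeries.
Variables (R : realType) (n : nat).
Local Notation C := (C R).
Implicit Types (mu lam : 'I_n -> C) (m : 'I_n -> int) (l q : 'I_n) (k : int) (x phi : R).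

(** By the functional equation of [rgamma], consecutive terms have a quotient of modulus E/|prod
    w_q|. For large j all |w_q| are at least 1 + 2E, so the quotient is at most 1/2. *)
Lemma besselJ_term_geometric l lam (L : C) :
  exists2 A : R, 0 <= A & geometric_bound A (besselJ_term l lam L).
Proof.
pose W := \sum_(q < n) nrm (lam q); pose E := expR (cRe (n%:R * L)).
have E0 : 0 < E by exact: expR_gt0.
have WB q : nrm (lam q) <= W.
  by rewrite /W (bigD1 q)//= lerDl sumr_ge0// => i _; exact: nrm_ge0.
apply: (@geometric_bound_ratio _ _ (Num.truncn (2 * W + 2 * E)).+1) => j jJ.
have jW : 2 * W + 2 * E <= j%:R.
  by apply: ltW; apply: lt_le_trans (truncnS_gt _) _; rewrite ler_nat.
pose w q := lam q - lam l + j%:R + 1.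
have wq q : 1 + 2 * E <= nrm (w q).
  have := nrm_triB (j%:R + 1) (- (lam q - lam l)).
  have -> : j%:R + 1 - - (lam q - lam l) = w q by rewrite /w; ring.
  have -> : nrm (j%:R + 1 : C) = j%:R + 1 by rewrite natr1 nrm_nat -natr1.
  have := nrmB (lam q) (lam l); rewrite nrmN; have := WB q; have := WB l; lra.
have rec : besselJ_term l lam L j.+1 * \prod_(q < n) w q =
    besselJ_term l lam L j * (cI R ^+ n * cexp (n%:R * L)).
  rewrite /besselJ_term.
  have -> : \prod_(q < n) rgamma (lam q - lam l + j%:R + 1) =
      (\prod_(q < n) w q) * \prod_(q < n) rgamma (lam q - lam l + j.+1%:R + 1).
    rewrite -big_split /=; apply: eq_bigr => q _; rewrite rgammaS -/(w q); congr (_ * rgamma _).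
    by rewrite /w -natr1; ring.
  have -> : n%:R * (- lam l + j.+1%:R) * L = n%:R * (- lam l + j%:R) * L + n%:R * L.
    by rewrite -natr1; ring.
  by rewrite cexpD exprSr; ring.
move: rec; move: (besselJ_term l lam L j.+1) (besselJ_term l lam L j) => t1 t0 rec.
have := congr1 (@nrm R) rec; rewrite !nrmM (nrmX (cI R)) nrm_cI expr1n mul1r nrm_cexp -/E => h.
have pw : 2 * E <= nrm (\prod_(q < n) w q).
  rewrite nrm_prod (bigD1 l)//=.
  have h1 : 1 <= \prod_(i < n | i != l) nrm (w i).
    elim/big_ind : _ => [||i _]; [exact: lexx| |by have := wq i; lra].
    by move=> a c a1 c1; rewrite -[leLHS]mulr1 ler_pM.
  apply: (@le_trans _ _ (nrm (w l) * 1)); first by have := wq l; lra.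
  by rewrite ler_wpM2l ?nrm_ge0.
rewrite -(ler_pM2r E0) -[2^-1 * _ * _]mulrA -h.
apply: (@le_trans _ _ (2^-1 * (nrm t1 * (2 * E)))).
  by rewrite le_eqVlt; apply/orP; left; apply/eqP; field.
by rewrite ler_wpM2l ?invr_ge0// ler_wpM2l ?nrm_ge0.
Qed.

Lemma besselJ_cvg l lam (L : C) :
  \sum_(j < N) besselJ_term l lam L j @[N --> \oo] --> besselJ l true lam L.
Proof.
have [A A0 hA] := besselJ_term_geometric l lam L.
by have [s hs] := geometric_cvg A0 hA; rewrite besselJE (cvgC_lim hs).
Qed.

(** The value of the k-th kernel in a form that mentions no contour; any admissible contour may
    therefore be used to estimate it. *)
Definition residue_series mu m x k : C :=
  \sum_(l < n) lim ((fun N : nat => \sum_(j < N) Hres mu (fun l => m l + k) x l j) @ \oo).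

Section Fixed.
Variables (mu : 'I_n -> C) (m : 'I_n -> int) (x : R).
Hypotheses (gen : generic mu m) (x0 : 0 < x) (smu : \sum_(q < n) mu q = 0).

Let Ut phi l := besselJ_term l (fun q => mu q + (m q)%:~R / 2) (log_root n x phi).
Let Vt phi l := besselJ_term l (fun q => mu q - (m q)%:~R / 2) (log_root n x (- phi)).

Lemma Hres_diag b phi l k (j : nat) :
  (2 * cR pi)^-1 * Hres mu (fun l => m l + k) x l j * cexp (cI R * cR phi) ^ k =
  cR (2 * pi ^+ 2) ^+ n.-1 * Scoef mu m b l * diag_term (Ut phi l) (Vt phi l) (m l + k) j.
Proof.
rewrite (@Hres_term _ _ mu m k l j (j + posn (m l + k)) (j + posn (- (m l + k))) x phi b)//.
- by rewrite /diag_term /Ut /Vt; ring.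
- by rewrite {1}(posn_sub (m l + k)); lia.
- exact: posn_abs.
Qed.

Lemma diag_cvg phi l k : exists S : C,
  \sum_(j < N) diag_term (Ut phi l) (Vt phi l) (m l + k) j @[N --> \oo] --> S.
Proof.
have [A A0 hA] := besselJ_term_geometric l (fun q => mu q + (m q)%:~R / 2) (log_root n x phi).
have [B B0 hB] := besselJ_term_geometric l (fun q => mu q - (m q)%:~R / 2) (log_root n x (- phi)).
exact: (geometric_cvg (mulr_ge0 A0 B0) (diag_geometric (m l + k) A0 B0 hA hB)).
Qed.

Let two_pi_neq0 : 2 * cR pi != 0 :> C.
Proof. by rewrite mulf_neq0 ?pnatr_eq0// cR_eq0 gt_eqF// pi_gt0. Qed.

Lemma Hres_sum_cvg b phi l k (S : C) :
  \sum_(j < N) diag_term (Ut phi l) (Vt phi l) (m l + k) j @[N --> \oo] --> S ->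
  \sum_(j < N) Hres mu (fun l => m l + k) x l j @[N --> \oo] -->
  2 * cR pi * (cexp (cI R * cR phi) ^ k)^-1 * (cR (2 * pi ^+ 2) ^+ n.-1 * Scoef mu m b l) * S.
Proof.
move=> hS; set c := 2 * cR pi * _ * _.
have h : c * \sum_(j < N) diag_term (Ut phi l) (Vt phi l) (m l + k) j @[N --> \oo] --> c * S.
  by apply: cvgM; [exact: cvg_cst|exact: hS].
apply: cvg_trans h; apply: near_eq_cvg; apply: nearW => N.
rewrite mulr_sumr; apply: eq_bigr => j _; rewrite /c -mulrA -(Hres_diag b).
have e0 : cexp (cI R * cR phi) ^ k != 0 by rewrite expfz_neq0// cexp_neq0.
move: (Hres _ _ _ _ _) (_ ^ k) e0 (2 * cR pi) two_pi_neq0 => H e e0 p p0.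
by field; rewrite e0 p0.
Qed.

Lemma jkernel_residue_series k sigma f : (0 < n)%N ->
  admissible mu (fun l => m l + k) sigma f ->
  jkernel mu (fun l => m l + k) f x = residue_series mu m x k.
Proof.
move=> n0 adm; apply: (jkernel_residues smu x0 n0 adm).
  exact: generic_simple_poles (generic_shift k gen).
(* [Hres] does not involve the phase, so convergence may be read off at phi = 0. *)
move=> l; have [S hS] := diag_cvg 0 l k.
exact: (cvgP _ (Hres_sum_cvg (b := true) hS)).
Qed.

Lemma residue_series_cvg b phi :
  (2 * cR pi)^-1 * \sum_(i < (2 * N).+1)
    residue_series mu m x (i%:Z - N%:Z) * cexp (cI R * cR phi) ^ (i%:Z - N%:Z)
  @[N --> \oo] --> bessel_rhs mu m b x phi.
Proof.
pose S l k : C := lim ((fun N : nat => \sum_(j < N) diag_term (Ut phi l) (Vt phi l) (m l + k) j) @ \oo).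
have hS l k : \sum_(j < N) diag_term (Ut phi l) (Vt phi l) (m l + k) j @[N --> \oo] --> S l k.
  by have [s hs] := diag_cvg phi l k; rewrite /S (cvgC_lim hs).
have h : cR (2 * pi ^+ 2) ^+ n.-1 * \sum_(l < n) Scoef mu m b l *
    \sum_(i < (2 * N).+1) S l (i%:Z - N%:Z) @[N --> \oo] --> bessel_rhs mu m b x phi.
  apply: cvgM; first exact: cvg_cst.
  apply: cvgC_sum => l; rewrite -mulrA; apply: cvgM; first exact: cvg_cst.
  have [A A0 hA] := besselJ_term_geometric l (fun q => mu q + (m q)%:~R / 2) (log_root n x phi).
  have [B B0 hB] := besselJ_term_geometric l (fun q => mu q - (m q)%:~R / 2) (log_root n x (- phi)).
  exact: (diagonal_sum A0 B0 hA hB (@besselJ_cvg l _ _) (@besselJ_cvg l _ _) (hS l)).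
apply: cvg_trans h; apply: near_eq_cvg; apply: nearW => N.
have -> : \sum_(l < n) Scoef mu m b l * \sum_(i < (2 * N).+1) S l (i%:Z - N%:Z) =
   \sum_(i < (2 * N).+1) \sum_(l < n) Scoef mu m b l * S l (i%:Z - N%:Z).
  by rewrite exchange_big /=; apply: eq_bigr => l _; rewrite mulr_sumr.
rewrite !mulr_sumr; apply: eq_bigr => i _; set k := i%:Z - N%:Z.
rewrite /residue_series mulr_suml !mulr_sumr; apply: eq_bigr => l _.
rewrite (cvgC_lim (Hres_sum_cvg (b := b) (hS l k))).
have e0 : cexp (cI R * cR phi) ^ k != 0 by rewrite expfz_neq0// cexp_neq0.
move: (_ ^ k) e0 (2 * cR pi) two_pi_neq0 => e e0 p p0.
by field; rewrite e0 p0.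
Qed.

End Fixed.

End GenericSeries.

(** * Continuity in the parameter *)

Section ParameterLimit.
Variable R : realType.
Local Notation C := (C R).
Implicit Types (D : set C) (E : nat -> C -> C) (F phi : C -> C).

(** [mu] enters each factor of the integrand only through the constant term of an affine argument.
    Uniform continuity of the outer function then gives uniform convergence on bounded sets. *)
Lemma unif_cvg_ucball D phi (a b : C) (bi : nat -> C) (B : R) : ucball phi ->
  (forall s, D s -> nrm s <= B) -> bi @ \oo --> b ->
  unif_cvg D (fun i s => phi (a * s + bi i)) (fun s => phi (a * s + b)).
Proof.
move=> uphi DB hb; pose B' := nrm a * `|B| + nrm b + 1.
have B'0 : 0 < B' by rewrite /B' ltr_wpDl// addr_ge0 ?mulr_ge0 ?nrm_ge0.
have [[A hA] hu] := uphi _ B'0.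
have DB' s : D s -> nrm (a * s) <= nrm a * `|B|.
  by move=> /DB h; rewrite nrmM ler_wpM2l ?nrm_ge0// (le_trans h)// ler_norm.
have ball1 s : D s -> nrm (a * s + b) <= B'.
  by move=> /DB' h; apply: le_trans (nrmD _ _) _; rewrite /B'; lra.
split; first by exists A => s /ball1 /hA.
move=> e e0; have [d d0 hd] := hu e e0.
have m0 : 0 < Num.min d 1 by rewrite lt_min d0 ltr01.
have /cvgCP /(_ _ m0) := hb; apply: filterS => i; rewrite lt_min => /andP[i1 i2] s Ds.
apply: ltW; apply: hd; [|exact: ball1|].
  have -> : a * s + bi i = a * s + b + (bi i - b) by ring.
  apply: le_trans (nrmD _ _) _; have := DB' _ Ds; have := nrmD (a * s) b.
  by rewrite /B'; lra.
by have -> : a * s + bi i - (a * s + b) = bi i - b by ring.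
Qed.

Lemma unif_cvgV D E F (c : R) : 0 < c -> (forall s, D s -> c <= nrm (F s)) ->
  unif_cvg D E F -> unif_cvg D (fun i s => (E i s)^-1) (fun s => (F s)^-1).
Proof.
move=> c0 Fc [_ u]; split.
  exists c^-1 => s /Fc h; rewrite nrmV lef_pV2 ?posrE//; exact: lt_le_trans h.
move=> e e0; have e1 : 0 < Num.min (c / 2) (e * (c ^+ 2 / 2)).
  by rewrite lt_min divr_gt0//= mulr_gt0// divr_gt0// exprn_gt0.
apply: filterS (u _ e1) => i h s Ds; have := h s Ds; rewrite le_min => /andP[h1 h2].
have h3 := Fc s Ds; have F0 : 0 < nrm (F s) by apply: lt_le_trans h3.
have E1 : c / 2 <= nrm (E i s) by have := nrm_triB (F s) (F s - E i s); rewrite subKr nrm_distC; lra.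
have E0 : 0 < nrm (E i s) by apply: lt_le_trans E1; rewrite divr_gt0.
have -> : (E i s)^-1 - (F s)^-1 = - (E i s - F s) / (E i s * F s).
  by field; rewrite -!nrm_gt0 E0 F0.
rewrite nrmf_div nrmN nrmM ler_pdivrMr ?mulr_gt0//; apply: le_trans h2 _.
rewrite ler_wpM2l ?(ltW e0)//; apply: (@le_trans _ _ (c / 2 * c)).
  by rewrite le_eqVlt; apply/orP; left; apply/eqP; field.
by apply: ler_pM => //; rewrite ?divr_ge0 ?ltW.
Qed.

Lemma unif_cvg_point D E F s : D s -> unif_cvg D E F -> E i s @[i --> \oo] --> F s.
Proof.
move=> Ds [_ u]; apply/cvgCP => e e0; have e2 : 0 < e / 2 by rewrite divr_gt0.
by apply: filterS (u _ e2) => i /(_ s Ds); lra.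
Qed.

Lemma unif_cvg_bounded D E F : unif_cvg D E F ->
  exists B : R, \forall i \near \oo, forall s, D s -> nrm (E i s) <= B.
Proof.
move=> [[B hB] u]; exists (B + 1).
apply: filterS (u 1 ltr01) => i h s Ds; have := hB s Ds; have := h s Ds.
by have := nrm_triB (E i s) (F s); lra.
Qed.

Variable n : nat.
Implicit Types (mu : 'I_n -> C) (M : 'I_n -> int) (x sigma : R) (f : R -> R).

Lemma unif_cvg_Hfun D (mui : nat -> 'I_n -> C) mu M x (B c : R) :
  (forall s, D s -> nrm s <= B) -> (forall l, mui i l @[i --> \oo] --> mu l) -> 0 < c ->
  (forall s l, D s -> c <= nrm (rgamma (s - mu l + halfabs R (M l)))) ->
  unif_cvg D (fun i => Hfun (mui i) M x) (Hfun mu M x).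
Proof.
move=> DB hmu c0 hc.
pose g (w : 'I_n -> C) l s := cI R ^+ absz (M l) * rpowC (2 * pi) (- 2 * s + (1 + 2 * w l)) *
   (rgamma (- 1 * s + (1 + w l + halfabs R (M l))) *
    (rgamma (1 * s + (- w l + halfabs R (M l))))^-1).
have HE w : Hfun w M x = fun s => (\prod_(l < n) g w l s) * rpowC x (- 2 * s + 0).
  apply/funext => s; rewrite /Hfun /Gmu addr0; congr (_ * _); apply: eq_bigr => l _.
  by rewrite GkE /g; congr (_ * rpowC _ _ * (rgamma _ / rgamma _)); ring.
have -> : (fun i => Hfun (mui i) M x) =
   fun i s => (\prod_(l < n) g (mui i) l s) * rpowC x (- 2 * s + 0).
  by apply/funext => i; rewrite HE.
rewrite HE; apply: unif_cvgM; last first.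
  by apply: (unif_cvg_ucball _ (ucball_cexp (cR (ln x))) DB); exact: cvg_cst.
apply: (@unif_cvg_prod _ _ _ _ (fun l i s => g (mui i) l s)) => l.
apply: unif_cvgM; last apply: unif_cvgM.
- apply: unif_cvgM.
    by apply: (@unif_cvg_cst _ _ _ (nrm (cI R ^+ absz (M l)))) => s _.
  apply: (unif_cvg_ucball _ (ucball_cexp (cR (ln (2 * pi)))) DB).
  apply: cvgD; first exact: cvg_cst.
  by apply: cvgM; [exact: cvg_cst|exact: hmu].
- apply: (unif_cvg_ucball _ (@ucball_rgamma R) DB).
  apply: cvgD; last exact: cvg_cst.
  by apply: cvgD; [exact: cvg_cst|exact: hmu].
- apply: (unif_cvgV c0); last first.
    apply: (unif_cvg_ucball _ (@ucball_rgamma R) DB).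
    by apply: cvgD; [apply: cvgN; exact: hmu|exact: cvg_cst].
  move=> s Ds; have := hc s l Ds; congr (_ <= nrm (rgamma _)); ring.
Qed.

(** The lower bound for the denominators holds because their inverses are continuous, hence bounded
    on a compact piece of the contour. *)
Lemma contour_compact mu M f (T : R) : continuous f ->
  (forall t l j, (Complex (f t) t : C) != apole mu M l j) ->
  exists B c : R, 0 < c /\ forall t, `|t| <= T ->
   nrm (Complex (f t) t) <= B /\
   forall l, c <= nrm (rgamma (Complex (f t) t - mu l + halfabs R (M l))).
Proof.
move=> cf fp; pose T' := Num.max T 0.
have T'0 : 0 <= T' by rewrite /T' le_max lexx orbT.
have TT' t : `|t| <= T -> - T' <= t <= T'.
  by move=> h; rewrite -ler_norml /T' le_max h.
have [B _ hB] := @continuous_nrm_bounded R _ (- T') T' ltac:(lra) (ccont_path cf).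
have inv l : exists c : R, 0 < c /\ forall t, `|t| <= T ->
    c <= nrm (rgamma (Complex (f t) t - mu l + halfabs R (M l))).
  have r0 t : rgamma (Complex (f t) t - mu l + halfabs R (M l)) != 0.
    exact: rgamma_denom_neq0.
  have cg : continuous (fun t => (rgamma (Complex (f t) t - mu l + halfabs R (M l)))^-1).
    apply: ccontV; first exact: r0.
    have -> : (fun t => rgamma (Complex (f t) t - mu l + halfabs R (M l))) =
       fun t => rgamma (Complex (f t) t + (- mu l + halfabs R (M l))).
      by apply/funext => t; rewrite addrA.
    apply: (ccont_ucball (@ucball_rgamma R)).
    exact: (ccontD (ccont_path cf) (@ccont_cst R _)).
  have [A A0 hA] := @continuous_nrm_bounded R _ (- T') T' ltac:(lra) cg.
  exists (A + 1)^-1; split; first by rewrite invr_gt0; lra.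
  move=> t /TT' /hA; rewrite nrmV => h.
  rewrite -[leRHS]invrK lef_pV2 ?posrE ?invr_gt0 ?nrm_gt0//; lra.
have [c hc] := choice inv.
exists B, (\big[Num.min/1]_(l < n) c l); split.
  by elim/big_ind : _ => // [u v u0 v0|l _]; [rewrite lt_min u0|case: (hc l)].
move=> t tT; split; first by apply: hB; exact: TT'.
by move=> l; have [_ h] := hc l; apply: le_trans (h t tT); exact: bigmin_le_cond.
Qed.

(** Among the points of one row the rightmost, kappa = 0, is decisive, and its condition is open in
    [mu]. So a contour fixed in advance serves all late members of the sequence. *)
Lemma admissible_near (mui : nat -> 'I_n -> C) mu M sigma f :
  (forall l, mui i l @[i --> \oo] --> mu l) -> (forall i, \sum_(l < n) mui i l = 0) ->
  \sum_(l < n) mu l = 0 -> admissible mu M sigma f ->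
  \forall i \near \oo, admissible (mui i) M sigma f.
Proof.
move=> hmu smui smu [sig [df cf'] fs fleft].
have cf : continuous f by move=> t; apply: differentiable_continuous; exact/derivable1_diffP.
have : \forall i \near \oo, forall l, cRe (mui i l) - (absz (M l))%:R / 2 < f (cIm (mui i l)).
  apply: filter_forall => l; pose h i := f (cIm (mui i l)) - cRe (mui i l) + (absz (M l))%:R / 2.
  have hh : h i @[i --> \oo] --> f (cIm (mu l)) - cRe (mu l) + (absz (M l))%:R / 2.
    apply: cvgD; last exact: cvg_cst.
    apply: cvgB; last exact: cvg_cRe.
    exact: (cvg_comp _ _ (cvg_cIm (hmu l)) (cf _)).
  have h0 : 0 < f (cIm (mu l)) - cRe (mu l) + (absz (M l))%:R / 2.
    by have := fleft l 0%N; rewrite mul0r subr0; lra.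
  near=> i; have : 0 < h i by near: i; exact: (cvgr_gt _ hh 0 h0).
  by rewrite /h; lra.
apply: filterS => i hi; split; [by rewrite smui -smu|by []|by []|].
move=> l kap; apply: le_lt_trans (hi l); rewrite gerBl divr_ge0//.
Unshelve. all: by end_near. Qed.

Lemma admissible_avoids mu M sigma f : admissible mu M sigma f ->
  forall t l j, (Complex (f t) t : C) != apole mu M l j.
Proof.
move=> [_ _ _ fleft] t l j; apply/eqP => e.
have h1 : cIm (apole mu M l j) = t by rewrite -e.
have h2 : cRe (apole mu M l j) = f t by rewrite -e.
have := fleft l (2 * j)%N; rewrite natrM [2 * _ / 2]mulrC mulKf//.
by rewrite -apole_re h2 -(apole_im mu M l j) h1 ltxx.
Qed.

(** Dominated convergence: beyond height [T1] the majorant is the decay estimate, uniform in the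
    ball, and below [T1] it comes from uniform convergence on the compact piece of the contour. *)
Theorem jkernel_cvg (mui : nat -> 'I_n -> C) mu M sigma f x : (0 < n)%N ->
  (forall l, mui i l @[i --> \oo] --> mu l) -> (forall i, \sum_(l < n) mui i l = 0) ->
  \sum_(l < n) mu l = 0 -> admissible mu M sigma f ->
  jkernel (mui i) M f x @[i --> \oo] --> jkernel mu M f x.
Proof.
move=> n0 hmu smui smu adm; have [d d0 sd] := admissible_exponent n0 smu adm.
have [sig [df cf'] [T fs] fleft] := adm.
have cf : continuous f by move=> t; apply: differentiable_continuous; exact/derivable1_diffP.
pose Bmu := \sum_(l < n) nrm (mu l) + 1.
have Bmu0 : 0 <= Bmu by rewrite addr_ge0// sumr_ge0// => l _; exact: nrm_ge0.
have [A [T1 [A0 T10 hA]]] := contour_decay M x Bmu0 sd fs.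
have fp := admissible_avoids adm.
have [B [c [c0 hBc]]] := contour_compact T1 cf fp.
pose D : set C := [set s | exists2 t, `|t| <= T1 & s = Complex (f t) t].
have uD : unif_cvg D (fun i => Hfun (mui i) M x) (Hfun mu M x).
  apply: (@unif_cvg_Hfun _ _ _ _ _ B c) => //.
    by move=> s [t tT ->]; case: (hBc t tT).
  by move=> s l [t tT ->]; case: (hBc t tT).
have pt t : Hfun (mui i) M x (Complex (f t) t) @[i --> \oo] --> Hfun mu M x (Complex (f t) t).
  have [B' [c' [c'0 hBc']]] := contour_compact `|t| cf fp.
  have u1 : unif_cvg [set Complex (f t) t : C] (fun i => Hfun (mui i) M x) (Hfun mu M x).
    apply: (@unif_cvg_Hfun _ _ _ _ _ B' c') => //.
      by move=> s ->; case: (hBc' t (lexx _)).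
    by move=> s l ->; case: (hBc' t (lexx _)).
  exact: (unif_cvg_point (s := Complex (f t) t) erefl u1).
have [B2 hB2] := unif_cvg_bounded uD.
have cF : continuous (fun t => Complex (f^`() t) 1 : C) by exact: ccont_graph.
have [B3 B30 hB3] := @continuous_nrm_bounded R _ (- T1) T1 ltac:(lra) cF.
pose W := A + `|B2| * B3 / omega d T1.
have near_dom : \forall i \near \oo, (forall t, nrm (contour_integrand (mui i) M x f t) <= W * omega d t)
   /\ continuous (contour_integrand (mui i) M x f).
  have hmuB : \forall i \near \oo, forall l, nrm (mui i l) <= Bmu.
    apply: filter_forall => l; have /cvgCP /(_ _ ltr01) := hmu l.
    apply: filterS => i h; have := nrm_triB (mui i l) (mu l).
    have : nrm (mu l) <= \sum_(l < n) nrm (mu l).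
      by rewrite (bigD1 l)//= lerDl sumr_ge0// => q _; exact: nrm_ge0.
    by rewrite /Bmu; lra.
  have hadm := admissible_near hmu smui smu adm; near=> i.
  have ai : admissible (mui i) M sigma f by near: i.
  split; last exact: (contour_integrand_continuous cf cf' (admissible_avoids ai)).
  move=> t; have o0 := omega_gt0 d t; have [tT|Tt] := leP `|t| T1; last first.
    have hi : forall l, nrm (mui i l) <= Bmu by near: i.
    apply: le_trans (hA _ hi (smui i) t (ltW Tt)) _.
    by rewrite ler_pM2r// /W lerDl divr_ge0 ?mulr_ge0// ltW// omega_gt0.
  have h2 : nrm (Hfun (mui i) M x (Complex (f t) t)) <= `|B2|.
    have : forall s, D s -> nrm (Hfun (mui i) M x s) <= B2 by near: i.
    by move=> /(_ (Complex (f t) t)) h; apply: le_trans (h _) (ler_norm _); exists t.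
  have h3 : nrm (Complex (f^`() t) 1) <= B3 by apply: hB3; rewrite -ler_norml.
  rewrite /contour_integrand nrmM; apply: (@le_trans _ _ (`|B2| * B3)).
    by apply: ler_pM; rewrite ?nrm_ge0.
  have h4 : omega d T1 <= omega d t.
    by apply: omega_antitone; [exact: ltW|rewrite (ger0_norm (ltW T10))].
  apply: (@le_trans _ _ (`|B2| * B3 / omega d T1 * omega d t)).
    by rewrite -mulrA ler_peMr ?mulr_ge0// mulrC ler_pdivlMr ?mul1r// omega_gt0.
  by rewrite ler_pM2r// /W lerDr.
(* The majorant is available only from index [N0] on, hence the shifted sequence. *)
have [N0 _ hN0] := near_dom; rewrite -(cvg_shiftn N0).
rewrite jkernelE; under eq_fun do rewrite jkernelE.
apply: cvgM; first exact: cvg_cst.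
apply: (cintegral_dominated d0 (D := W)).
- by move=> i; have [_ h] := hN0 (i + N0)%N (leq_addl _ _).
- exact: (contour_integrand_continuous cf cf' fp).
- move=> t; apply: cvgM; last exact: cvg_cst.
  exact: (cvg_comp _ _ (cvg_addnr N0) (pt t)).
- by move=> i t; have [h _] := hN0 (i + N0)%N (leq_addl _ _).
Unshelve. all: by end_near. Qed.

End ParameterLimit.

(** * Symmetric sums over the integers *)

Section BilateralSums.
Variable R : realType.
Local Notation C := (C R).
Implicit Types (F a : int -> C) (K : nat) (B : R).

Definition bilateral F (N : nat) : C := \sum_(i < (2 * N).+1) F (i%:Z - N%:Z).

Lemma bilateralE F (N : nat) :
  bilateral F N = F 0 + \sum_(j < N) (F j.+1%:Z + F (- j.+1%:Z)).
Proof.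
elim: N => [|N IH].
  by rewrite /bilateral big_ord0 addr0 big_ord_recl big_ord0 addr0.
rewrite big_ord_recr /= addrA -IH /bilateral.
have -> : (2 * N.+1).+1 = (2 * N).+3 by lia.
rewrite big_ord_recl big_ord_recr /=.
have -> : \sum_(i < (2 * N).+1) F ((bump 0 i)%:Z - N.+1%:Z) = \sum_(i < (2 * N).+1) F (i%:Z - N%:Z).
  by apply: eq_bigr => i _; congr F; rewrite /bump /=; lia.
have -> : (bump 0 (2 * N).+1)%:Z - N.+1%:Z = N.+1%:Z by rewrite /bump /=; lia.
by rewrite sub0r; ring.
Qed.

Definition inv_square_bound B K F := forall k : int, (K <= absz k)%N -> nrm (F k) <= B / (absz k)%:R ^+ 2.

(** With k and -k grouped, the bound 2B/(j+1)^2 is at most 2B(1/j - 1/(j+1)), which telescopes. *)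
Lemma bilateral_tail B K F (N M : nat) : 0 <= B -> inv_square_bound B K F -> (K <= N)%N -> (0 < N)%N ->
  (N <= M)%N -> nrm (bilateral F M - bilateral F N) <= 2 * B / N%:R.
Proof.
move=> B0 hF KN N0 NM; rewrite !bilateralE opprD addrACA subrr add0r.
have term j : (N <= j)%N -> nrm (F j.+1%:Z + F (- j.+1%:Z)) <= 2 * B * (j%:R^-1 - j.+1%:R^-1).
  move=> Nj; have jn : (0 < j)%N by apply: leq_trans Nj.
  have j0 : (0 : R) < j%:R by rewrite ltr0n.
  have h1 := hF j.+1%:Z (leq_trans KN (leq_trans Nj (leqnSn j))).
  have h2 := hF (- j.+1%:Z); rewrite abszN in h2.
  have {}h2 := h2 (leq_trans KN (leq_trans Nj (leqnSn j))).
  have h3 : (j.+1%:R ^+ 2)^-1 <= j%:R^-1 - j.+1%:R^-1 :> R.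
    have -> : j%:R^-1 - j.+1%:R^-1 = (j%:R * j.+1%:R)^-1 :> R.
      by rewrite -natr1; field; rewrite ?gt_eqF//; lra.
    rewrite lef_pV2 ?posrE ?mulr_gt0 ?exprn_gt0 ?ltr0n//.
    by rewrite expr2 ler_wpM2r// ler_nat.
  apply: le_trans (nrmD _ _) _; rewrite /= in h1 h2.
  have h4 : B / j.+1%:R ^+ 2 <= B * (j%:R^-1 - j.+1%:R^-1) by rewrite ler_wpM2l.
  by rewrite -mulrA mulr_natl mulr2n; apply: lerD; apply: le_trans h4.
rewrite -(big_mkord xpredT (fun j => F j.+1%:Z + F (- j.+1%:Z))).
rewrite -(big_mkord xpredT (fun j => F j.+1%:Z + F (- j.+1%:Z))) (big_cat_nat _ NM)//=.
rewrite addrAC subrr add0r; apply: le_trans (nrm_sum _ _ _) _.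
apply: (@le_trans _ _ (\sum_(N <= j < M) 2 * B * (j%:R^-1 - j.+1%:R^-1))).
  by apply: ler_sum_nat => j /andP[Nj _]; exact: term.
rewrite -mulr_sumr ler_wpM2l ?mulr_ge0//.
have -> : \sum_(N <= j < M) (j%:R^-1 - j.+1%:R^-1) = N%:R^-1 - M%:R^-1 :> R.
  elim: M NM => [|M IH]; first by rewrite leqn0 => /eqP ->; rewrite big_geq// subrr.
  rewrite leq_eqVlt => /orP[/eqP->|NM]; first by rewrite big_geq// subrr.
  by rewrite big_nat_recr//= IH//; ring.
by rewrite gerBl invr_ge0.
Qed.

Lemma cvg_over_nat (B : R) : B / N%:R @[N --> \oo] --> (0 : R).
Proof.
by rewrite -[X in _ --> X](mulr0 B); apply: cvgM; [exact: cvg_cst|exact: cvg_invn].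
Qed.

Lemma bilateral_cvg B K F : 0 <= B -> inv_square_bound B K F ->
  exists s : C, bilateral F @ \oo --> s.
Proof.
move=> B0 hF; apply: cauchyC_cvg => e e0.
have /cvgrPdist_lt /(_ _ e0) [N _ hN] := cvg_over_nat (2 * B).
pose N1 := (N + K).+1; exists N1 => M NM.
apply: le_trans (bilateral_tail B0 hF _ _ NM) _; rewrite ?/N1//; first by lia.
have := hN N1; rewrite /N1 /= sub0r normrN => /(_ _)/ltW h.
by apply: le_trans (ler_norm _) (h _); lia.
Qed.

Lemma bilateral_lim_tail B K F (s : C) (N : nat) : 0 <= B -> inv_square_bound B K F ->
  bilateral F @ \oo --> s -> (K <= N)%N -> (0 < N)%N ->
  nrm (s - bilateral F N) <= 2 * B / N%:R.
Proof.
move=> B0 hF hs KN N0.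
have h : bilateral F M - bilateral F N @[M --> \oo] --> s - bilateral F N.
  by apply: cvgB; [exact: hs|exact: cvg_cst].
apply: (cvgr_to_le (cvg_nrm h)); near=> M.
have NM : (N <= M)%N by near: M; exact: nbhs_infty_ge.
exact: (bilateral_tail B0 hF KN N0 NM).
Unshelve. all: by end_near. Qed.

(** Tannery's theorem: the common bound makes the tails beyond [N1] small uniformly in i, and the
    finite rest converges termwise. *)
Lemma bilateral_dominated B K (Fi : nat -> int -> C) F (si : nat -> C) (s : C) : 0 <= B ->
  (forall i, inv_square_bound B K (Fi i)) -> inv_square_bound B K F ->
  (forall i, bilateral (Fi i) @ \oo --> si i) -> bilateral F @ \oo --> s ->
  (forall k, Fi i k @[i --> \oo] --> F k) -> si @ \oo --> s.
Proof.
move=> B0 hi hF hsi hs hk; apply/cvgCP => e e0.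
have e3 : 0 < e / 3 by rewrite divr_gt0.
have /cvgrPdist_lt /(_ _ e3) [N _ hN] := cvg_over_nat (2 * B).
pose N1 := (N + K).+1.
have KN : (K <= N1)%N by rewrite /N1; lia.
have small : 2 * B / N1%:R < e / 3.
  have := hN N1; rewrite /= sub0r normrN => h.
  by apply: le_lt_trans (ler_norm _) (h _); rewrite /N1; lia.
have hfin : bilateral (Fi i) N1 @[i --> \oo] --> bilateral F N1.
  by apply: cvgC_sum => j; exact: hk.
have /cvgCP /(_ _ e3) := hfin; apply: filterS => i hd.
have t1 := bilateral_lim_tail B0 (hi i) (hsi i) KN (ltn0Sn _).
have t2 := bilateral_lim_tail B0 hF hs KN (ltn0Sn _).
have -> : si i - s = (si i - bilateral (Fi i) N1) + (bilateral (Fi i) N1 - bilateral F N1)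
   - (s - bilateral F N1) by ring.
apply: le_lt_trans (nrmB _ _) _; have := nrmD (si i - bilateral (Fi i) N1) (bilateral (Fi i) N1 - bilateral F N1).
by lra.
Qed.

End BilateralSums.

(** * Uniform bounds, generic approximation and conclusion *)

Section MainTheorem.
Variables (R : realType) (n : nat).
Local Notation C := (C R).
Implicit Types (mu : 'I_n -> C) (m : 'I_n -> int) (k : int) (x : R).

(** For large |k| the line Re s = - (Bmu + 2) is itself an admissible contour, so the residue series
    equals the integral along it. The constants depend on [mu] only through [Bmu], which lets the
    bound survive a limit of parameters. *)
Lemma residue_series_bound m x (Bmu : R) : (0 < n)%N -> 0 <= Bmu -> 0 < x ->
  exists (B : R) (K : nat), 0 <= B /\ forall mu, (forall l, nrm (mu l) <= Bmu) ->
    \sum_(l < n) mu l = 0 -> generic mu m -> inv_square_bound B K (residue_series mu m x).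
Proof.
move=> n0 Bmu0 x0; have [A [K [A0 K0 hA]]] := @Hfun_decay_large R n m x Bmu n0 Bmu0.
pose I1 := Rintegral (@lebesgue_measure R) setT (omega 1).
pose c := nrm ((2 * cR pi * cI R)^-1).
have I10 : 0 <= I1 by apply: Rintegral_ge0 => t _; rewrite ltW// omega_gt0.
exists (c * (2 * (A * I1))), K; split; first by rewrite mulr_ge0 ?nrm_ge0// !mulr_ge0.
move=> mu muB smu gen k Kk; have [hp hd] := hA mu k muB Kk.
pose s0 := - (Bmu + 2).
have c0' : (fun _ : R => s0)^`() = fun=> 0 by apply/funext => t; exact: derive1_cst.
have adm : admissible mu (fun l => m l + k) s0 (fun=> s0).
  split.
  - rewrite smu mulr0 sub0r; have n1 : (1 : R) <= n%:R by rewrite ler1n.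
    have : 1 / (2 * n%:R) <= 1 / 2 :> R by rewrite !mul1r lef_pV2 ?posrE; lra.
    by rewrite mulNr /s0; lra.
  - split; first by move=> t; exact: derivable_cst.
    by rewrite c0' => t; exact: cvg_cst.
  - by exists 0.
  - move=> l kap; apply: le_lt_trans (hp l); rewrite gerBl divr_ge0//.
rewrite -(jkernel_residue_series gen x0 smu n0 adm) jkernelE nrmM -/c -!mulrA.
rewrite ler_wpM2l ?nrm_ge0//.
have k0 : 0 <= A / (absz k)%:R ^+ 2 by rewrite divr_ge0 ?exprn_ge0.
have -> : 2 * (A * (I1 * ((absz k)%:R ^+ 2)^-1)) = 2 * (A / (absz k)%:R ^+ 2 * I1) by ring.
apply: (nrm_cintegral_le ltr01).
  apply: contour_integrand_continuous; last exact: (admissible_avoids adm).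
    by move=> t; exact: cvg_cst.
  by rewrite c0' => t; exact: cvg_cst.
move=> t; rewrite /contour_integrand c0' nrmM -[Complex 0 1]cI_E nrm_cI mulr1; exact: hd.
Qed.

(** Genericity only excludes real values of [mu l - mu q]; distinct imaginary
    shifts summing to [0] therefore restore it. *)
Lemma generic_sequence mu m : \sum_(l < n) mu l = 0 -> exists mui : nat -> 'I_n -> C,
  [/\ forall i, \sum_(l < n) mui i l = 0, forall i, generic (mui i) m &
      forall l, mui i l @[i --> \oo] --> mu l].
Proof.
move=> smu.
pose V : R := \sum_(q < n) (q : nat)%:R.
(* Subtracting [V] centres the shifts n l: they sum to 0, while v_l - v_q = n(l - q) stays
   nonzero. *)
pose v (l : 'I_n) : R := n%:R * (l : nat)%:R - V.
pose mui (i : nat) l : C := mu l + cI R * cR (v l / i.+1%:R).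
have hgen : \forall i \near \oo, generic (mui i) m.
  (* A collision would force Im (mu_l - mu_q) = - n(l - q)/(i + 1). This is impossible if the left
     side vanishes, and otherwise as soon as n^2/(i + 1) is smaller than its modulus. *)
  have hnear : \forall i \near \oo, forall l q : 'I_n,
     cIm (mu l - mu q) != 0 -> n%:R ^+ 2 / i.+1%:R < `|cIm (mu l - mu q)|.
    apply: filter_forall => l; apply: filter_forall => q.
    have [->|d0] := eqVneq (cIm (mu l - mu q)) 0; first exact: nearW.
    have hc : n%:R ^+ 2 / i.+1%:R @[i --> \oo] --> (0 : R).
      by have := @cvg_over_nat R (n%:R ^+ 2); rewrite -(cvg_shiftS _).
    have p0 : 0 < `|cIm (mu l - mu q)| by rewrite normr_gt0.
    by near=> i => _; near: i; exact: (cvgr_lt _ hc _ p0).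
  apply: filterS hnear => i hi l q lq j; apply/eqP => /(congr1 (@cIm R)).
  have i0 : (0 : R) < i.+1%:R by rewrite ltr0n.
  have imR (a : R) : cIm (cI R * cR a) = a by rewrite mulrC cImMR cIm_cI mulr1.
  have im2 (w : C) : cIm (2 * w) = 2 * cIm w by rewrite -[2 : C]cR_nat cImMR.
  rewrite cImB cIm_nat subr0 !im2 -[j%:~R]cR_int cIm_cR mulr0.
  rewrite cImB !cImD !imR => h.
  have h2 : cIm (mu l - mu q) = - (n%:R * ((l : nat)%:R - (q : nat)%:R) / i.+1%:R).
    have -> : n%:R * ((l : nat)%:R - (q : nat)%:R) / i.+1%:R = v l / i.+1%:R - v q / i.+1%:R.
      by rewrite -mulrBl /v; congr (_ / _); ring.
    by rewrite cImB; move: h; move: (v l / _) (v q / _) (cIm _) (cIm _) => ? ? ? ? h; lra.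
  have lqR : (l : nat)%:R - (q : nat)%:R != 0 :> R by rewrite subr_eq0 eqr_nat.
  have n0 : (0 < n)%N by case: n l {mu m smu V v mui hi q lq j h h2 lqR} => [[]|].
  have d0 : cIm (mu l - mu q) != 0.
    by rewrite h2 oppr_eq0 !mulf_eq0 invr_eq0 (negbTE lqR) !pnatr_eq0 eqn0Ngt n0.
  have := hi l q d0; rewrite h2 normrN normf_div normrM normr_nat (ger0_norm (ltW i0)).
  rewrite ltr_pM2r ?invr_gt0// expr2 ltr_pM2l ?ltr0n// ltNge => /negP; apply.
  have ltR (p : 'I_n) : (p : nat)%:R <= n%:R :> R by rewrite ler_nat ltnW.
  have := ltR l; have := ltR q; have := ler0n R l; have := ler0n R q; clear.
  move: (l%:R : R) (q%:R : R) (n%:R : R) => a1 a2 a3 *.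
  by rewrite ler_norml; apply/andP; split; lra.
have [N0 _ hN0] := hgen; exists (fun i => mui (i + N0)%N); split.
- move=> i; rewrite /mui big_split /= smu add0r -mulr_sumr.
  have -> : \sum_(l < n) cR (v l / (i + N0).+1%:R) = cR ((\sum_(l < n) v l) / (i + N0).+1%:R) :> C.
    rewrite mulr_suml; elim/big_rec2 : _ => // l a b _ ->; by rewrite cRD.
  by rewrite /v sumrB sumr_const card_ord -mulr_sumr -/V mulr_natl subrr mul0r mulr0.
- by move=> i; apply: hN0; exact: leq_addl.
- move=> l; rewrite (@cvg_shiftn N0 _ (fun i => mui i l)).
  apply: (@cvgC_le R _ _ _ _ _ (fun i : nat => `|v l| / i.+1%:R)).
    apply: nearW => i; rewrite /mui addrAC subrr add0r nrmM nrm_cI mul1r nrm_cR normf_div.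
    by rewrite normr_nat.
  by have := @cvg_over_nat R `|v l|; rewrite -(cvg_shiftS _).
Unshelve. all: by end_near. Qed.

End MainTheorem.

(** The partial sums involve neither [phi] nor [b], and limits are unique. Hence [bessel_rhs], or
    its limit in the non-generic case, is the same for every argument phi of z and for both
    signs. *)
Theorem theorem7p1 (R : realType) (n : nat) (mu : 'I_n -> C R)
  (m : 'I_n -> int) (b : bool) (c : int -> R * (R -> R)) (z : C R) (phi : R) :
  (0 < n)%N ->
  \sum_(l < n) mu l = 0 ->
  (forall k : int, admissible mu (fun l => m l + k) (c k).1 (c k).2) ->
  z != 0 ->
  z = `|z| * cexp (cI R * cR phi) ->
  exists J0 : C R,
    (Jkernel_partial mu m c z N @[N --> \oo] --> J0) /\
    (generic mu m -> J0 = bessel_rhs mu m b (cRe `|z|) phi) /\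
    (~ generic mu m ->
       forall eps : R, 0 < eps -> exists2 delta : R, 0 < delta &
         forall mu' : 'I_n -> C R,
           \sum_(l < n) mu' l = 0 -> generic mu' m ->
           (forall l, `|mu' l - mu l| < cR delta) ->
           `|bessel_rhs mu' m b (cRe `|z|) phi - J0| < cR eps).
Proof.
move=> n0 smu adm z0 zE; rewrite -[cRe `|z|]/(nrm z).
set x := nrm z; have x0 : 0 < x by rewrite nrm_gt0.
pose e k := cexp (cI R * cR phi) ^ k.
have ne k : nrm (e k) = 1.
  rewrite /e -cexpMz nrm_cexp -cR_int cReMR mulrC cReM cRe_cI cIm_cR.
  by rewrite mul0r mulr0 subrr mul0r expR0.
have p0 : 2 * cR pi != 0 :> C R by rewrite mulf_neq0 ?pnatr_eq0// cR_eq0 gt_eqF// pi_gt0.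
have zz : z / `|z| = cexp (cI R * cR phi).
  by rewrite {1}zE mulrAC divff ?mul1r// normr_eq0.
pose J k := jkernel mu (fun l => m l + k) (c k).2 x.
pose Bmu := \sum_(l < n) nrm (mu l) + 1.
have Bmu0 : 0 <= Bmu by rewrite addr_ge0// sumr_ge0// => l _; exact: nrm_ge0.
have muB mu' : (forall l, nrm (mu' l - mu l) < 1) -> forall l, nrm (mu' l) <= Bmu.
  move=> h l; have := nrm_triB (mu' l) (mu l).
  have : nrm (mu l) <= \sum_(l < n) nrm (mu l).
    by rewrite (bigD1 l)//= lerDl sumr_ge0// => q _; exact: nrm_ge0.
  by have := h l; rewrite /Bmu; lra.
have [B [K [B0 hB]]] := @residue_series_bound R n m x Bmu n0 Bmu0 x0.
(* Each [mui i] with i large is admissible for the given contour; from then on its kernel is the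
   contour-free series. *)
have rsJ (mui : nat -> 'I_n -> C R) : (forall i, \sum_(l < n) mui i l = 0) ->
    (forall i, generic (mui i) m) -> (forall l, mui i l @[i --> \oo] --> mu l) ->
    forall k, residue_series (mui i) m x k @[i --> \oo] --> J k.
  move=> smui geni hmu k.
  have hJ := jkernel_cvg (x := x) n0 hmu smui smu (adm k).
  have hadm := admissible_near hmu smui smu (adm k).
  apply: cvg_trans hJ; apply: near_eq_cvg; near=> i.
  have ai : admissible (mui i) (fun l => m l + k) (c k).1 (c k).2.
    by near: i; exact: hadm.
  exact: (jkernel_residue_series (geni i) x0 (smui i) n0 ai).
(* [mu] itself may be non-generic, so the bound is taken from generic neighbours and passed to the
   limit. It yields the convergence of the sum over k in all cases. *)
have JB : inv_square_bound B K (fun k => J k * e k).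
  move=> k Kk; rewrite nrmM ne mulr1.
  have [mui [smui geni hmu]] := generic_sequence m smu.
  apply: (cvgr_to_le (cvg_nrm (rsJ mui smui geni hmu k))); near=> i.
  apply: (hB (mui i)) => //; apply: muB.
  near: i; apply: filter_forall => l; have /cvgCP /(_ _ ltr01) := hmu l; exact.
have [s hs] := bilateral_cvg B0 JB.
have cvg_rhs mu' : \sum_(l < n) mu' l = 0 -> generic mu' m ->
   bilateral (fun k => residue_series mu' m x k * e k) @ \oo --> 2 * cR pi * bessel_rhs mu' m b x phi.
  move=> smu' gen'; have h := residue_series_cvg gen' x0 smu' (b := b) (phi := phi).
  have h2 : 2 * cR pi * ((2 * cR pi)^-1 * bilateral (fun k => residue_series mu' m x k * e k) N)
     @[N --> \oo] --> 2 * cR pi * bessel_rhs mu' m b x phi.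
    by apply: cvgM; [exact: cvg_cst|exact: h].
  by apply: cvg_trans h2; apply: near_eq_cvg; apply: nearW => N; rewrite mulrA divff// mul1r.
exists ((2 * cR pi)^-1 * s); split; last split.
- have -> : Jkernel_partial mu m c z = fun N => (2 * cR pi)^-1 * bilateral (fun k => J k * e k) N.
    by apply/funext => N; rewrite /Jkernel_partial zz.
  by apply: cvgM; [exact: cvg_cst|exact: hs].
- move=> gen; have h := cvg_rhs mu smu gen.
  have E : (fun k => residue_series mu m x k * e k) = fun k => J k * e k.
    by apply/funext => k; rewrite -(jkernel_residue_series gen x0 smu n0 (adm k)).
  by rewrite E in h; rewrite (cvgC_unique hs h) mulrA mulVf ?mul1r.
(* If no delta works, delta = 1/(i + 1) provides generic parameters tending to [mu] whose right-hand
   sides stay eps away from the sum; this contradicts the dominated passage to the limit. *)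
- move=> _ eps eps0; apply: contrapT => hno.
  have hseq (i : nat) : exists mu' : 'I_n -> C R, [/\ \sum_(l < n) mu' l = 0, generic mu' m,
      forall l, nrm (mu' l - mu l) < i.+1%:R^-1 &
      eps <= nrm (bessel_rhs mu' m b x phi - (2 * cR pi)^-1 * s)].
    apply: contrapT => hi; apply: hno; exists i.+1%:R^-1; first by rewrite invr_gt0.
    move=> mu' smu' gen' hd; rewrite normE ltcR ltNge; apply/negP => hge.
    by apply: hi; exists mu'; split=> // l; have := hd l; rewrite normE ltcR.
  have [mui hmui] := choice hseq.
  have smui i : \sum_(l < n) mui i l = 0 by case: (hmui i).
  have geni i : generic (mui i) m by case: (hmui i).
  have hmu l : mui i l @[i --> \oo] --> mu l.
    apply: (@cvgC_le R _ _ _ _ _ (fun i : nat => 1 / i.+1%:R)).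
      by apply: nearW => i; have [_ _ h _] := hmui i; rewrite mul1r ltW.
    by have := @cvg_over_nat R 1; rewrite -(cvg_shiftS _).
  have hFi i : inv_square_bound B K (fun k => residue_series (mui i) m x k * e k).
    move=> k Kk; rewrite nrmM ne mulr1; apply: (hB (mui i)) => //; apply: muB => l.
    have [_ _ h _] := hmui i; apply: lt_le_trans (h l) _.
    by rewrite invf_le1// ler1n.
  have hlim : 2 * cR pi * bessel_rhs (mui i) m b x phi @[i --> \oo] --> s.
    apply: (bilateral_dominated B0 hFi JB (fun i => cvg_rhs _ (smui i) (geni i)) hs) => k.
    by apply: cvgM; [exact: (rsJ mui smui geni hmu k)|exact: cvg_cst].
  have p1 : 0 < nrm (2 * cR pi : C R) by rewrite nrm_gt0.
  have /cvgCP /(_ _ (mulr_gt0 p1 eps0)) [N _ hN] := hlim.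
  have [_ _ _ h] := hmui N; have := hN N (leqnn N).
  have -> : 2 * cR pi * bessel_rhs (mui N) m b x phi - s =
     2 * cR pi * (bessel_rhs (mui N) m b x phi - (2 * cR pi)^-1 * s).
    by rewrite mulrBr [2 * cR pi * (_ * s)]mulrA divff// mul1r.
  by rewrite nrmM ltr_pM2l// ltNge h.
Unshelve. all: by end_near. Qed.
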